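(* Let $(\mathscr V_0,\mathscr V_1)$ be an interpolation couple and let $s\in(0,1)$. There exists a constant $C>0$, depending only on $s$ and on the couple $(\mathscr V_0,\mathscr V_1)$, such that the following holds for every finite-dimensional (finite element) subspace $V_h\subset\mathscr V_1$, every $r\in\mathbb N$, every $f\in V_h$, every $0<\lambda_L^2<\lambda_U^2$ with $[\lambda_L^2,\lambda_U^2]\supset\{\lambda_1^2,\dots,\lambda_N^2\}$ (the discrete eigenvalues), and the corresponding Zolotarëv space $\mathcal V_r\subset V_h$ generated by $f$. Put $$\delta:=\frac{\lambda_L^2}{\lambda_U^2},\qquad \kappa:=\frac{\lambda_U^2}{\lambda_L^2},\qquad \mu:=\left(\frac{1-\sqrt\delta}{1+\sqrt\delta}\right)^2,\qquad \mu_1:=\sqrt{1-\mu^2},\qquad C^*:=\frac{\pi\,\mathcal K(\mu_1)}{4\,\mathcal K(\mu)} .$$ Then $$0\le \|f\|_{H^{-s}_{*,r}}^2-\|f\|_{H^{-s}}^2\le C\,e^{-2C^*r}\,\|f\|_0^2,$$ and $$\|u_r^*(s)-u(s)\|_0\le C\,e^{-C^*r}\begin{cases}\|f\|_0, & s>\tfrac12,\\ \|f\|_1, & s\le\tfrac12.\end{cases}$$ Moreover, $C^*$ depends only on $\kappa$ and satisfies $C^*(\kappa)=\mathcal O\!\left(\frac{1}{\ln\kappa}\right)$ as $\kappa\to\infty$.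
   Context: All Hilbert spaces are real. An interpolation couple $(\mathscr V_0,\mathscr V_1)$ is a pair of Hilbert spaces with norms $\|\cdot\|_0,\|\cdot\|_1$ and inner products $\langle\cdot,\cdot\rangle_0,\langle\cdot,\cdot\rangle_1$ such that $\mathscr V_1\subset\mathscr V_0$ is dense with compact embedding. Discrete setting. $V_h\subset\mathscr V_1$ has dimension $N$; $(\varphi_k)_{k=1}^N$ is a $\langle\cdot,\cdot\rangle_0$-orthonormal basis of $V_h$ with $\langle\varphi_k,v\rangle_1=\lambda_k^2\langle\varphi_k,v\rangle_0$ for all $v\in V_h$. Each $v\in V_h$ is identified with the functional $w\mapsto\langle v,w\rangle_0$ on $V_h$, and $\|v\|_{-1}:=\sup_{0\ne w\in V_h}\langle v,w\rangle_0/\|w\|_1$ denotes its dual norm, with induced inner product $\langle\cdot,\cdot\rangle_{-1}$. The Riesz map $\mathcal R$ of $(V_h,\|\cdot\|_1)$ sends $v\in V_h$ to the element $\mathcal Rv\in V_h$ with $\langle \mathcal Rv,w\rangle_1=\langle v,w\rangle_0$ for all $w\in V_h$. Exact quantities, for $f\in V_h$: $u(s):=\sum_{k=1}^N\lambda_k^{-2s}\langle\varphi_k,f\rangle_0\varphi_k$, and $\|f\|_{H^{-s}}$ is the Hilbert interpolation norm of order $1-s$ of the couple $((V_h,\|\cdot\|_{-1}),(V_h,\|\cdot\|_0))$. Here, for a finite-dimensional space $W$ with two Hilbert norms $\|\cdot\|_a,\|\cdot\|_b$, with $\|\cdot\|_a$-orthonormal basis $(\psi_j)$ and numbers $\mu_j^2>0$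 satisfying $\langle\psi_j,w\rangle_b=\mu_j^2\langle\psi_j,w\rangle_a$ for all $w\in W$, the Hilbert interpolation norm of order $\theta\in(0,1)$ of $((W,\|\cdot\|_a),(W,\|\cdot\|_b))$ is $\big(\sum_j\mu_j^{2\theta}\langle w,\psi_j\rangle_a^2\big)^{1/2}$, and the Hilbert interpolation operator of order $\theta$ is $w\mapsto\sum_j\mu_j^{2\theta}\langle \psi_j,w\rangle_a\psi_j$. Reduced basis quantities. For $t\ge0$ let $v_N(t)\in V_h$ be the unique solution of $\langle v_N(t),w\rangle_0+t^2\langle v_N(t),w\rangle_1=\langle f,w\rangle_0$ for all $w\in V_h$ (so $v_N(0)=f$). For $0=t_0<t_1<\dots<t_r$ set $\mathcal V_r:=\operatorname{span}\{v_N(t_0),\dots,v_N(t_r)\}\subset V_h$. Then $\|f\|_{H^{-s}_{*,r}}$ is the Hilbert interpolation norm of order $1-s$ of the couple $((\mathcal V_r,\|\cdot\|_{-1}),(\mathcal V_r,\|\cdot\|_0))$ evaluated at $f\in\mathcal V_r$ (here $\|\cdot\|_{-1}$ is the dual norm $\|v\|_{-1}=\sup_{0\ne w\in V_h}\langle v,w\rangle_0/\|w\|_1$ with supremum over $V_h$, restricted to $v\in\mathcal V_r$). With $\mathcal L$ the Hilbert interpolation operator of order $1-s$ of the couple $((\mathcal V_r,\|\cdot\|_{-1}),(\mathcal V_r,\|\cdot\|_0))$, $u_r^*(s):=\mathcal R\,\mathcal L f\in V_h$. Zolotarëv points. For $\delta\in(0,1)$ and $r\in\mathbb N$ the Zolotarëv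 points on $[\delta,1]$ are $\mathcal Z_j:=\operatorname{dn}\!\big(\tfrac{2(r-j)+1}{2r}\mathcal K(\delta'),\delta'\big)$, $j=1,\dots,r$, $\delta':=\sqrt{1-\delta^2}$, where $\operatorname{dn}(\theta,k)$ is the Jacobi elliptic function with modulus $k$ and $\mathcal K(k)=\int_0^{\pi/2}(1-k^2\sin^2\vartheta)^{-1/2}\,d\vartheta$ is the complete elliptic integral of the first kind with modulus $k$. The transformed Zolotarëv points on $[a,b]\subset(0,\infty)$ are $b\mathcal Z_j$ with $\mathcal Z_j$ the Zolotarëv points on $[a/b,1]$. $\mathcal V_r$ is the Zolotarëv space corresponding to $[\lambda_L^2,\lambda_U^2]$ if the squared snapshots $t_1^2,\dots,t_r^2$ (with $t_0=0$) are exactly the transformed Zolotarëv points on $[\lambda_U^{-2},\lambda_L^{-2}]$. *)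

(* Defs.v *)
From HB Require Import structures.
From mathcomp Require Import all_boot all_order all_algebra.
From mathcomp Require Import all_classical all_reals all_analysis.

Set Implicit Arguments.
Unset Strict Implicit.
Unset Printing Implicit Defensive.

Import Order.TTheory GRing.Theory Num.Theory.
Import numFieldNormedType.Exports.

Local Open Scope classical_set_scope.
Local Open Scope ring_scope.

(* Lets the Landau notations of the library be used at [+oo]. *)
Canonical pinfty_filter_on (R : realType) :=
  FilterType (pinfty_nbhs R) (@proper_pinfty_nbhs R).

(* The inclusion of the smaller space in the larger one is the injective linear
   map [emb]; an element [v] of the smaller space, seen in the larger one, is
   [emb v]. *)
Record interpolation_couple (R : realType) := InterpolationCouple {
  space0 : completeNormedModType R;
  space1 : completeNormedModType R;
  ip0 : {dot space0 for idfun};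
  ip1 : {dot space1 for idfun};
  ip0E : forall v, ip0 v v = `|v| ^+ 2;
  ip1E : forall v, ip1 v v = `|v| ^+ 2;
  emb : {linear space1 -> space0};
  emb_inj : injective emb;
  emb_dense : dense (range emb);
  emb_compact : forall A : set space1, bounded_set A -> precompact (emb @` A) }.

Section HilbertInterpolation.
Variables (R : realType) (V : lmodType R).
Implicit Types (W : set V) (a b : V -> V -> R) (theta : R) (w : V).

Definition lin_span n (e : 'I_n -> V) : set V :=
  [set v | exists c : 'I_n -> R, v = \sum_(i < n) c i *: e i].

(* [psi] is an [a]-orthonormal basis of [W] diagonalizing [b] relative to [a],
   with eigenvalues [mu j ^+ 2] (linear independence of [psi] follows from
   orthonormality). *)
Definition eigenbasis W a b n (psi : 'I_n -> V) (mu : 'I_n -> R) : Prop :=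
  [/\ W = lin_span psi,
      forall i j, a (psi i) (psi j) = (i == j)%:R,
      forall j, 0 < mu j
    & forall j w, W w -> b (psi j) w = mu j ^+ 2 * a (psi j) w].

(* The two values below do not depend on the eigenbasis, which always exists
   when [W] is finite-dimensional and [a], [b] are inner products on [W]. *)
Definition interp_norm W a b theta w : R :=
  get [set x | exists n (psi : 'I_n -> V) (mu : 'I_n -> R),
    eigenbasis W a b psi mu /\
    x = Num.sqrt (\sum_(j < n) mu j `^ (2 * theta) * a w (psi j) ^+ 2)].

Definition interp_op W a b theta w : V :=
  xget 0 [set v | exists n (psi : 'I_n -> V) (mu : 'I_n -> R),
    eigenbasis W a b psi mu /\
    v = \sum_(j < n) (mu j `^ (2 * theta) * a (psi j) w) *: psi j].

End HilbertInterpolation.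

Section Discrete.
Variables (R : realType) (X : interpolation_couple R).
Notation V1 := (space1 X).
Implicit Types (Vh W : set V1) (f v w : V1).

Definition ip0_on1 v w : R := ip0 X (emb X v) (emb X w).

Definition norm0_on1 v : R := `|emb X v|.

Definition dual_norm Vh v : R :=
  sup [set ip0_on1 v w / `|w| | w in Vh `\ 0].

(* Polarization of [dual_norm]. *)
Definition dual_ip Vh v w : R :=
  (dual_norm Vh (v + w) ^+ 2 - dual_norm Vh (v - w) ^+ 2) / 4.

Definition riesz Vh v : V1 :=
  xget 0 [set z | Vh z /\ forall w, Vh w -> ip1 X z w = ip0_on1 v w].

Definition snapshot Vh f (t : R) : V1 :=
  xget 0 [set v | Vh v /\ forall w, Vh w ->
    ip0_on1 v w + t ^+ 2 * ip1 X v w = ip0_on1 f w].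

Definition rb_space Vh f r (t : 'I_r.+1 -> R) : set V1 :=
  lin_span (fun i => snapshot Vh f (t i)).

(* The [H^{-s}] norm computed on the subspace [W] of [Vh]: [W := Vh] gives the
   exact norm, [W := rb_space Vh f t] the reduced basis norm. The supremum in
   the dual norm ranges over [Vh] in both cases. *)
Definition neg_norm Vh W (s : R) f : R :=
  interp_norm W (dual_ip Vh) ip0_on1 (1 - s) f.

Definition rb_solution Vh W (s : R) f : V1 :=
  riesz Vh (interp_op W (dual_ip Vh) ip0_on1 (1 - s) f).

Definition exact_solution N (phi : 'I_N -> V1) (lam : 'I_N -> R) (s : R) f : V1 :=
  \sum_(k < N) (lam k `^ (- (2 * s)) * ip0_on1 (phi k) f) *: phi k.

End Discrete.

Section Zolotarev.
Variable R : realType.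
Implicit Types (k x u delta a b : R).

Definition legendre_integrand k (x : R) : R :=
  (Num.sqrt (1 - k ^+ 2 * sin x ^+ 2))^-1.

Definition ellipticK k : R :=
  \int[lebesgue_measure]_(x in `[0, pi / 2]) legendre_integrand k x.

(* Integral from [0] to [x] for [x] of either sign: one of the two intervals is
   empty or reduced to a point. *)
Definition ellipticF x k : R :=
  \int[lebesgue_measure]_(y in `[0, x]) legendre_integrand k y -
  \int[lebesgue_measure]_(y in `[x, 0]) legendre_integrand k y.

Definition jacobi_am u k : R := get [set x | ellipticF x k = u].

Definition jacobi_dn u k : R :=
  Num.sqrt (1 - k ^+ 2 * sin (jacobi_am u k) ^+ 2).

(* Meaningful for [1 <= j <= r]. *)
Definition zolotarev_point delta (r j : nat) : R :=
  let delta' := Num.sqrt (1 - delta ^+ 2) in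
  jacobi_dn ((2 * (r - j) + 1)%:R / (2 * r)%:R * ellipticK delta') delta'.

Definition transformed_zolotarev_points a b (r : nat) : set R :=
  [set b * zolotarev_point (a / b) r j | j in [set j : nat | (1 <= j <= r)%N]].

Definition zolotarev_snapshots (lamL lamU : R) r (t : 'I_r.+1 -> R) : Prop :=
  [/\ t ord0 = 0,
      forall i j : 'I_r.+1, (i < j)%N -> t i < t j
    & [set t i ^+ 2 | i in ~` [set ord0]] =
      transformed_zolotarev_points (lamU ^- 2) (lamL ^- 2) r].

Definition zolotarev_rate delta : R :=
  let mu := ((1 - Num.sqrt delta) / (1 + Num.sqrt delta)) ^+ 2 in
  let mu1 := Num.sqrt (1 - mu ^+ 2) in
  pi * ellipticK mu1 / (4 * ellipticK mu).

End Zolotarev.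

(* Main.v *)
Require Import Defs.
From HB Require Import structures.
From mathcomp Require Import all_boot all_order all_algebra.
From mathcomp Require Import all_classical all_reals all_analysis.
From mathcomp Require Import ring lra.

Set Implicit Arguments.
Unset Strict Implicit.
Unset Printing Implicit Defensive.

Import Order.TTheory GRing.Theory Num.Theory.
Import numFieldNormedType.Exports.

Local Open Scope classical_set_scope.
Local Open Scope ring_scope.

(* Let [L] be the discrete operator with eigenvalues [lam k ^+ 2], and [theta = 1 - s].
   Since [x^theta] is a constant times the integral over [tau > 0] of
   [tau^(-theta-1) * (tau x / (1 + tau x))], the difference of the two squared norms is
   an integral of errors of Galerkin approximations in the reduced space of
   [(1 + tau L)^-1 f], with respect to the dual inner product. A Galerkin solution is
   the best approximation in the energy norm, so each error is at most the one of an
   explicit competitor. With [Theta x = \prod (1 - t_i^2 x) / (1 + t_i^2 x)], the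
   vectors [(1 - Theta(L) Theta(1/tau)) (1 + tau L)^-1 f] and
   [(1 - Theta(L) Theta(1/tau)) (1 + tau L)^-1 f + Theta(L) Theta(1/tau) f] are in the
   reduced space by partial fractions, and their errors are controlled by the maximum
   of [Theta^2] on the spectrum. Testing the same identity against the error of the
   solution itself gives the second estimate.

   For the Zolotarev points and [x = dn u], the addition theorem turns [Theta^2] into
   a product of [(1 - dn) / (1 + dn)] over shifts of [u], which is periodic of period
   [K / r] and hence maximal at [u = 0]. There its logarithm is a midpoint sum for the
   integral of [ln ((1 + dn) / (1 - dn))] over [[0, K]], which equals [pi K']. Two Landen
   transformations identify [pi K' / K] with [C^*]. *)

(** * Calculus *)

(** The factor [Theta (1/tau)] makes the competitors lie in a space independent of [tau]: since
    [Theta (-x) * Theta x = 1], the function [1 - Theta x * Theta (1/tau)] vanishes at [x = -1/tau]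
    and cancels the pole of [(1 + tau x)^-1]. Two competitors are needed because the kernel
    [tau^(-theta-1)] is integrable at infinity only: the error of one is bounded uniformly in [tau],
    which serves for [tau >= 1], and that of the other vanishes as [tau] tends to 0. In the second
    estimate Cauchy-Schwarz takes a square root of the energy error, which leaves [tau^(1/2)] near
    0. This is integrable when [theta < 1/2]; otherwise the norm of [f] in the smaller space pays
    for a full power of [tau]. The couple enters the constant only through a bound of the embedding,
    which bounds the inverses of the eigenvalues. The integrand compared with the midpoint sum has a
    logarithmic singularity at 0: the half cell next to 0 costs one mesh width [K / r], hence a
    factor independent of [r]. *)

Section Calculus.
Variable R : realType.
Implicit Types (f df F : R -> R) (a b x : R).
Notation mu := (@lebesgue_measure R).

Lemma is_derive_continuous f x l : is_derive x 1 f l -> {for x, continuous f}.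
Proof. by move=> [d _]; apply/differentiable_continuous/derivable1_diffP. Qed.

Lemma is_derive_within f df a b :
  (forall x, a <= x <= b -> is_derive x 1 f (df x)) -> {within `[a, b], continuous f}.
Proof.
move=> d; apply: continuous_in_subspaceT => x.
by rewrite inE/= in_itv/= => xab; exact: is_derive_continuous (d _ xab).
Qed.

Lemma is_derive_le f df a b : a <= b ->
  (forall x, a <= x <= b -> is_derive x 1 f (df x)) ->
  (forall x, a <= x <= b -> 0 <= df x) -> f a <= f b.
Proof.
move=> ab d d0.
have [||c] := @MVT_segment R f df a b ab.
- by move=> x; rewrite in_itv/= => /andP[/ltW ax /ltW xb]; apply: d; rewrite ax.
- exact: is_derive_within d.
rewrite in_itv/= => cab E; rewrite -subr_ge0 E mulr_ge0 ?d0//.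
by rewrite subr_ge0.
Qed.

Lemma is_derive_prim f a x : continuous f -> a < x ->
  is_derive x 1 (fun y => \int[mu]_(t in `[a, y]) f t) (f x).
Proof.
move=> cf ax.
have xx1 : x < x + 1 by rewrite ltrDl.
have fi : mu.-integrable `[a, x + 1] (EFin \o f).
  apply: continuous_compact_integrable; first exact: segment_compact.
  exact: continuous_subspaceT.
have [d1 d2] := continuous_FTC1_closed xx1 fi ax (cf x).
by rewrite -d2 derive1E; exact: derivableP.
Qed.

Lemma Rintegral_FTC f F a b : a <= b -> continuous f ->
  (forall x, is_derive x 1 F (f x)) -> \int[mu]_(t in `[a, b]) f t = F b - F a.
Proof.
rewrite le_eqVlt => /predU1P[<- _ _|ab cf dF].
  by rewrite set_itv1 Rintegral_set1 subrr.
have cF : continuous F by move=> x; exact: is_derive_continuous (dF x).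
rewrite /Rintegral (@continuous_FTC2 _ f F)//.
- exact: continuous_subspaceT.
- split; first by move=> x _; have [] := dF x.
  + by apply: cvg_at_right_filter; exact: cF.
  + by apply: cvg_at_left_filter; exact: cF.
- by move=> x _; rewrite derive1E; have [_ ->] := dF x.
Qed.

(** It has the shape of [ellipticF], which is thereby convertible to [prim] of the Legendre
    integrand. *)
Definition prim f y :=
  \int[mu]_(t in `[0, y]) f t - \int[mu]_(t in `[y, 0]) f t.

Lemma Rintegral_itv_cat f a b x : continuous f -> a <= b -> b <= x ->
  \int[mu]_(t in `[a, x]) f t - \int[mu]_(t in `[a, b]) f t =
  \int[mu]_(t in `[b, x]) f t.
Proof.
move=> cf ab bx.
have I u v : mu.-integrable `[u, v] (EFin \o f).
  apply: continuous_compact_integrable; first exact: segment_compact.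
  exact: continuous_subspaceT.
rewrite Rintegral_itvB ?bnd_simp// Rintegral_itv_obnd_cbnd//.
by apply: integrableS (I b x) => //; exact: subset_itv_oc_cc.
Qed.

Lemma primE f a y : continuous f -> a <= 0 -> a <= y ->
  prim f y = \int[mu]_(t in `[a, y]) f t - \int[mu]_(t in `[a, 0]) f t.
Proof.
move=> cf a0 ay; rewrite /prim; have [y0|y0] := leP 0 y.
  have E0 : \int[mu]_(t in `[y, 0]) f t = 0.
    move: y0; rewrite le_eqVlt => /predU1P[<-|y0].
      by rewrite set_itv1 Rintegral_set1.
    by rewrite set_itv_ge ?Rintegral_set0// bnd_simp -ltNge.
  by rewrite E0 subr0 (Rintegral_itv_cat cf a0 y0).
have E0 : \int[mu]_(t in `[0, y]) f t = 0.
  by rewrite set_itv_ge ?Rintegral_set0// bnd_simp -ltNge.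
by rewrite E0 sub0r -(Rintegral_itv_cat cf ay (ltW y0)) opprB.
Qed.

Lemma is_derive_prim0 f x : continuous f -> is_derive x 1 (prim f) (f x).
Proof.
(* The base point is strictly to the left of both 0 and [x], so that near [x], whatever its sign,
   [prim f] is the integral from [a] up to a constant. *)
move=> cf; pose a := Num.min 0 x - 1.
have a0 : a < 0 by rewrite /a; case: (ltP 0 x) => ?; lra.
have ax : a < x by rewrite /a; case: (ltP 0 x) => ?; lra.
have D := is_derive_prim cf ax.
have D2 : is_derive x 1 (fun y => \int[mu]_(t in `[a, y]) f t - \int[mu]_(t in `[a, 0]) f t) (f x).
  by apply: is_derive_eq; rewrite subr0.
apply: near_eq_is_derive D2.
near=> y; rewrite (primE cf (ltW a0)); first by [].
by apply/ltW; near: y; exact: lt_nbhsr.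
Unshelve. all: by end_near. Qed.

Lemma prim0 f : prim f 0 = 0.
Proof. by rewrite /prim subrr. Qed.

(** The rules [df...] restate differentiation for pointwise lambda terms, the form on which [dstep]
    works by unification. *)
Lemma dfcst (c : R) x : is_derive x 1 (fun=> c) (0 : R).
Proof. exact: is_derive_cst. Qed.

Lemma dfid x : is_derive x 1 (fun y : R => y) (1 : R).
Proof. exact: is_derive_id. Qed.

Lemma dfD f g x (u v : R) : is_derive x 1 f u -> is_derive x 1 g v ->
  is_derive x 1 (fun y => f y + g y) (u + v).
Proof. by move=> fu gv; exact: is_deriveD. Qed.

Lemma dfN f x (u : R) : is_derive x 1 f u -> is_derive x 1 (fun y => - f y) (- u).
Proof. by move=> fu; exact: is_deriveN. Qed.

Lemma dfM f g x (u v : R) : is_derive x 1 f u -> is_derive x 1 g v ->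
  is_derive x 1 (fun y => f y * g y) (f x * v + g x * u).
Proof. by move=> fu gv; exact: is_deriveM. Qed.

Lemma dfX f n x (u : R) : is_derive x 1 f u ->
  is_derive x 1 (fun y => f y ^+ n.+1) (n.+1%:R * f x ^+ n * u).
Proof.
move=> fu; have -> : (fun y => f y ^+ n.+1) = f ^+ n.+1 by rewrite exprfctE.
exact: is_deriveX.
Qed.

Lemma dfV f x (u : R) : is_derive x 1 f u -> f x != 0 ->
  is_derive x 1 (fun y => (f y)^-1) (- u / f x ^+ 2).
Proof.
move=> fu f0; apply: is_derive_eq (is_deriveV f0 fu) _.
by rewrite -[_ *: _]/(_ * _) mulrC mulrN mulNr.
Qed.

Lemma dfcomp (f g : R -> R) x (u v : R) : is_derive (g x) 1 f u -> is_derive x 1 g v ->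
  is_derive x 1 (fun y => f (g y)) (u * v).
Proof. by move=> fu gv; exact: is_derive1_comp. Qed.

Lemma dfsqrt f x (u : R) : is_derive x 1 f u -> 0 < f x ->
  is_derive x 1 (fun y => Num.sqrt (f y)) (u / (2 * Num.sqrt (f x))).
Proof.
move=> fu f0; apply: is_derive_eq (dfcomp (is_derive1_sqrt f0) fu) _.
by rewrite mulrC.
Qed.

Lemma dfsin f x (u : R) : is_derive x 1 f u ->
  is_derive x 1 (fun y => sin (f y)) (cos (f x) * u).
Proof. by move=> fu; exact: dfcomp. Qed.

Lemma dfcos f x (u : R) : is_derive x 1 f u ->
  is_derive x 1 (fun y => cos (f y)) (- sin (f x) * u).
Proof. by move=> fu; exact: dfcomp. Qed.

Lemma dfatan f x (u : R) : is_derive x 1 f u ->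
  is_derive x 1 (fun y => atan (f y)) (u / (1 + f x ^+ 2)).
Proof. by move=> fu; apply: is_derive_eq (dfcomp _ fu) _; rewrite mulrC. Qed.

Lemma dfln f x (u : R) : is_derive x 1 f u -> 0 < f x ->
  is_derive x 1 (fun y => ln (f y)) (u / f x).
Proof.
by move=> fu f0; apply: is_derive_eq (dfcomp (is_derive1_ln f0) fu) _; rewrite mulrC.
Qed.

Lemma is_derive_cst_eq f a b : (forall x, is_derive x 1 f 0) -> f a = f b.
Proof. exact: is_derive_0_is_cst. Qed.

End Calculus.

Ltac dstep := first
 [ eapply dfcst | eapply dfid | eassumption
 | eapply dfX | eapply dfV | eapply dfsqrt | eapply dfsin
 | eapply dfcos | eapply dfatan | eapply dfln
 | eapply dfN | eapply dfM | eapply dfD ].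
Ltac dsolve := eapply is_derive_eq; [repeat dstep |]; cbv beta.

Lemma cvg_bigsum (R : realType) (T : Type) (I : Type) (r : seq I) (f : I -> T -> R)
    (l : I -> R) (F : set_system T) : Filter F -> (forall i, f i x @[x --> F] --> l i) ->
  (\sum_(i <- r) f i x) @[x --> F] --> \sum_(i <- r) l i.
Proof.
move=> FF fl; elim: r => [|i r IH].
  by rewrite big_nil; under eq_fun do rewrite big_nil; exact: cvg_cst.
by rewrite big_cons; under eq_fun do rewrite big_cons; exact: cvgD.
Qed.

(* Closes the side conditions of [field], which are hypotheses up to [ring]. *)
Ltac nz := repeat (apply/andP; split);
  first [ assumption
        | match goal with H : is_true (_ != 0) |- _ =>
            solve [move: (H); apply: contra => /eqP <-; apply/eqP; ring] end ].

(** * Landen's transformation and the Zolotarev rate *)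

Section Landen.
Variable R : realType.
Implicit Types (a b x : R).

Definition agm_integrand a b x : R :=
  (Num.sqrt (a ^+ 2 * cos x ^+ 2 + b ^+ 2 * sin x ^+ 2))^-1.

Lemma agm_quad_gt0 a b x : 0 < a -> 0 < b ->
  0 < a ^+ 2 * cos x ^+ 2 + b ^+ 2 * sin x ^+ 2.
Proof.
move=> a0 b0; have E := cos2Dsin2 x.
have [c0|c0] := eqVneq (cos x) 0.
  move: E; rewrite c0 !expr0n/= add0r mulr0 add0r => ->.
  by rewrite mulr1 exprn_gt0.
apply: ltr_pwDl; last by rewrite mulr_ge0 ?sqr_ge0.
apply: mulr_gt0; first exact: exprn_gt0.
by rewrite exprn_even_gt0.
Qed.

Lemma continuous_agm_integrand a b : 0 < a -> 0 < b -> continuous (agm_integrand a b).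
Proof.
move=> a0 b0 x; have q := agm_quad_gt0 x a0 b0.
eapply is_derive_continuous; unfold agm_integrand; repeat dstep => //.
by rewrite sqrtr_eq0 -ltNge.
Qed.

Definition agm_int a b : R := prim (agm_integrand a b) (pi / 2).

(** The integrand is invariant under [x -> pi - x]. *)
Lemma prim_agm_pi a b : 0 < a -> 0 < b ->
  prim (agm_integrand a b) pi = 2 * agm_int a b.
Proof.
move=> a0 b0; set w := agm_integrand a b.
have cw : continuous w by exact: continuous_agm_integrand.
have dw x : is_derive x 1 (prim w) (w x) by exact: is_derive_prim0.
have : prim w (pi - 0) + prim w 0 = prim w (pi - pi / 2) + prim w (pi / 2).
  apply: (@is_derive_cst_eq R (fun x => prim w (pi - x) + prim w x)) => x.
  eapply is_derive_eq.
    eapply dfD; [eapply (dfcomp (dw _)); repeat dstep|exact: dw].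
  cbv beta; have -> : w (pi - x) = w x.
    by rewrite /w /agm_integrand cosB sinB cospi sinpi; congr (Num.sqrt _)^-1; ring.
  by ring.
rewrite subr0 prim0 addr0 => ->.
by rewrite /agm_int -/w (_ : pi - pi / 2 = pi / 2); [ring|field].
Qed.

(* This is [x + atan (b / a * tan x)], written without the pole of [tan] at [pi / 2]. *)
Definition landen_phase a b x : R :=
  2 * x - atan ((a - b) * sin x * cos x / (a * cos x ^+ 2 + b * sin x ^+ 2)).

Lemma agm_lin_gt0 a b x : 0 < a -> 0 < b -> 0 < a * cos x ^+ 2 + b * sin x ^+ 2.
Proof.
move=> a0 b0; have := @agm_quad_gt0 (Num.sqrt a) (Num.sqrt b) x.
by rewrite !sqr_sqrtr ?(ltW a0) ?(ltW b0)// !sqrtr_gt0; exact.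
Qed.

Lemma is_derive_landen_phase a b x : 0 < a -> 0 < b ->
  is_derive x 1 (landen_phase a b) ((a + b) * (a * cos x ^+ 2 + b * sin x ^+ 2) /
    (a ^+ 2 * cos x ^+ 2 + b ^+ 2 * sin x ^+ 2)).
Proof.
move=> a0 b0; have D0 := agm_quad_gt0 x a0 b0; have e0 := agm_lin_gt0 x a0 b0.
rewrite /landen_phase; dsolve; first exact: lt0r_neq0.
move: e0 D0; have := cos2Dsin2 x.
set c := cos x; set s := sin x; set e := _ + b * s ^+ 2; set D := a ^+ 2 * _ + _.
move=> cs e0 D0.
have en : a * c ^+ 2 + b * s ^+ 2 != 0 by rewrite gt_eqF.
have Dn : a ^+ 2 * c ^+ 2 + b ^+ 2 * s ^+ 2 != 0 by rewrite gt_eqF.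
have -> : 1 + ((a - b) * s * c / e) ^+ 2 = D * (c ^+ 2 + s ^+ 2) / e ^+ 2.
  by rewrite /D /e; field.
transitivity ((a + b) * (e * (c ^+ 2 + s ^+ 2)) / D); last by rewrite cs mulr1.
have -> : 2 * 1 + x * 0 = 2 * (c ^+ 2 + s ^+ 2) by rewrite cs; ring.
have -> : D * (c ^+ 2 + s ^+ 2) / e ^+ 2 = D / e ^+ 2 by rewrite cs mulr1.
by rewrite /D /e; field; nz.
Qed.

Lemma landen_phase0 a b : landen_phase a b 0 = 0.
Proof. by rewrite /landen_phase sin0 !(mulr0, mul0r) atan0 subr0. Qed.

Lemma landen_phase_pihalf a b : landen_phase a b (pi / 2) = pi.
Proof. by rewrite /landen_phase cos_pihalf !(mulr0, mul0r) atan0 subr0; field. Qed.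

(** Gauss's substitution [p = landen_phase a b] maps [[0, pi / 2]] onto [[0, pi]] and satisfies
    [w1 (p x) * p' x = 2 * w x]. The integral of [w1] over [[0, pi]] is twice the one over
    [[0, pi / 2]], and the factors 2 cancel. *)
Lemma landen a b : 0 < a -> 0 < b ->
  agm_int ((a + b) / 2) (Num.sqrt (a * b)) = agm_int a b.
Proof.
move=> a0 b0; set a1 := (a + b) / 2; set b1 := Num.sqrt _.
have a10 : 0 < a1 by rewrite /a1; lra.
have ab0 : 0 < a * b by rewrite mulr_gt0.
have b10 : 0 < b1 by rewrite sqrtr_gt0.
set w := agm_integrand a b; set w1 := agm_integrand a1 b1.
have dw x : is_derive x 1 (prim w) (w x).
  by apply: is_derive_prim0; exact: continuous_agm_integrand.
have dw1 x : is_derive x 1 (prim w1) (w1 x).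
  by apply: is_derive_prim0; exact: continuous_agm_integrand.
pose E x := a * cos x ^+ 2 + b * sin x ^+ 2.
have E0 x : 0 < E x by exact: agm_lin_gt0.
pose T x := (a - b) * sin x * cos x / E x.
pose p := landen_phase a b.
have dp x := is_derive_landen_phase x a0 b0.
(* The form of the arithmetic and geometric means, pulled back by [p], is a square divided by the
   original form, so that its square root is explicit. *)
have Q x : a1 ^+ 2 * cos (p x) ^+ 2 + b1 ^+ 2 * sin (p x) ^+ 2 =
    ((a + b) * E x) ^+ 2 / (4 * (a ^+ 2 * cos x ^+ 2 + b ^+ 2 * sin x ^+ 2)).
  have D0 := agm_quad_gt0 x a0 b0.
  have sA : sin (atan (T x)) = T x * cos (atan (T x)).
    rewrite -{2}(atanK (T x)) /tan divfK// cos_atan invr_eq0 sqrtr_eq0 -ltNge.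
    by rewrite ltr_pwDl ?sqr_ge0.
  have cA : cos (atan (T x)) ^+ 2 = (1 + T x ^+ 2)^-1.
    by rewrite cos_atan exprVn sqr_sqrtr// addr_ge0 ?sqr_ge0.
  have b12 : b1 ^+ 2 = a * b by rewrite sqr_sqrtr// ltW.
  rewrite /p /landen_phase -/(E x) -/(T x) cosB sinB sA mulr_natl sin_mulr2n cos_mulr2n b12.
  move: cA D0 (E0 x) (cos2Dsin2 x); rewrite /T /a1 /E.
  set k := cos (atan _); set c := cos x; set s := sin x.
  move=> cA D0 e0 cs.
  have en : a * c ^+ 2 + b * s ^+ 2 != 0 by rewrite gt_eqF.
  have Dn : a ^+ 2 * c ^+ 2 + b ^+ 2 * s ^+ 2 != 0 by rewrite gt_eqF.
  have k2 : k ^+ 2 = (a * c ^+ 2 + b * s ^+ 2) ^+ 2 /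
      ((a ^+ 2 * c ^+ 2 + b ^+ 2 * s ^+ 2) * (c ^+ 2 + s ^+ 2)).
    rewrite cA -[RHS]invf_div; congr _^-1.
    by field; nz.
  have -> : c ^+ 2 *+ 2 - 1 = c ^+ 2 - s ^+ 2 by rewrite -cs; ring.
  rewrite cs mulr1 in k2.
  (* A power of [c ^+ 2 + s ^+ 2 = 1] makes both sides homogeneous of the same degree. The identity
     then holds between rational functions in [c] and [s], and [field] can prove it. *)
  transitivity (((a + b) * (a * c ^+ 2 + b * s ^+ 2)) ^+ 2 /
      (4 * (a ^+ 2 * c ^+ 2 + b ^+ 2 * s ^+ 2)) * (c ^+ 2 + s ^+ 2) ^+ 2); last first.
    by rewrite cs expr1n mulr1.
  set t := (a - b) * s * c / (a * c ^+ 2 + b * s ^+ 2).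
  transitivity (k ^+ 2 * (((a + b) / 2) ^+ 2 * (c ^+ 2 - s ^+ 2 + (c * s *+ 2) * t) ^+ 2 +
    a * b * (c * s *+ 2 - (c ^+ 2 - s ^+ 2) * t) ^+ 2)); first by ring.
  by rewrite k2 /t; field; nz.
have c0 : prim w1 (p 0) - 2 * prim w 0 = prim w1 (p (pi / 2)) - 2 * prim w (pi / 2).
  apply: (@is_derive_cst_eq R (fun x => prim w1 (p x) - 2 * prim w x)) => x.
  eapply is_derive_eq.
    eapply dfD; [exact: (dfcomp (dw1 _) (dp _))|eapply dfN].
    by eapply dfM; [exact: dfcst|exact: dw].
  have D0 := agm_quad_gt0 x a0 b0.
  rewrite /w1 /w /agm_integrand Q sqrtrM ?sqr_ge0 // sqrtr_sqr sqrtrV ?mulr_ge0// ?(ltW D0)//.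
  rewrite sqrtrM// (_ : 4 = 2 ^+ 2); last by ring.
  have e0 := E0 x; have ab0' : 0 < a + b by rewrite addr_gt0.
  rewrite sqrtr_sqr !gtr0_norm ?mulr_gt0//.
  move: D0; set D := (_ + _ * sin x ^+ 2) => D0.
  have DE : Num.sqrt D ^+ 2 = D by rewrite sqr_sqrtr// ltW.
  have : Num.sqrt D != 0 by rewrite gt_eqF ?sqrtr_gt0.
  rewrite -/(E x); move: DE (E0 x); set e := E x; set d := Num.sqrt D => <- {}e0 d0.
  have ab : a + b != 0 by rewrite gt_eqF ?addr_gt0.
  by field; rewrite d0 ab gt_eqF.
move: c0; rewrite /p landen_phase0 landen_phase_pihalf !prim0 prim_agm_pi// -/w1 -[prim w (pi / 2)]/(agm_int a b).
by rewrite -/a1 -/b1; lra.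
Qed.

Lemma agm_int_scale c a b : 0 < c -> 0 < a -> 0 < b ->
  agm_int (c * a) (c * b) = c^-1 * agm_int a b.
Proof.
move=> c0 a0 b0; rewrite /agm_int.
have E x : agm_integrand (c * a) (c * b) x = c^-1 * agm_integrand a b x.
  rewrite /agm_integrand.
  have -> : (c * a) ^+ 2 * cos x ^+ 2 + (c * b) ^+ 2 * sin x ^+ 2 =
    c ^+ 2 * (a ^+ 2 * cos x ^+ 2 + b ^+ 2 * sin x ^+ 2) by ring.
  by rewrite sqrtrM ?sqr_ge0// sqrtr_sqr gtr0_norm// invfM.
have ca : 0 < c * a by rewrite mulr_gt0.
have cb : 0 < c * b by rewrite mulr_gt0.
have d1 x := is_derive_prim0 x (continuous_agm_integrand ca cb).
have d2 x := is_derive_prim0 x (continuous_agm_integrand a0 b0).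
have : prim (agm_integrand (c * a) (c * b)) (pi / 2) - c^-1 * prim (agm_integrand a b) (pi / 2) =
       prim (agm_integrand (c * a) (c * b)) 0 - c^-1 * prim (agm_integrand a b) 0.
  apply: (@is_derive_cst_eq R (fun x => prim (agm_integrand (c * a) (c * b)) x -
    c^-1 * prim (agm_integrand a b) x)) => x.
  eapply is_derive_eq.
    by eapply dfD; [exact: d1|eapply dfN; eapply dfM; [exact: dfcst|exact: d2]].
  by rewrite E; ring.
by rewrite !prim0 mulr0 subrr => /eqP; rewrite subr_eq0 => /eqP.
Qed.

Lemma legendre_agm k : 0 <= k < 1 ->
  legendre_integrand k = agm_integrand 1 (Num.sqrt (1 - k ^+ 2)).
Proof.
move=> /andP[k0 k1]; have kk : 0 < 1 - k ^+ 2 by rewrite subr_gt0 exprn_ilt1.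
apply/funext => x; rewrite /legendre_integrand /agm_integrand sqr_sqrtr ?(ltW kk)//.
by congr (Num.sqrt _)^-1; rewrite cos2sin2; ring.
Qed.

Lemma ellipticKE k : 0 <= k < 1 -> ellipticK k = agm_int 1 (Num.sqrt (1 - k ^+ 2)).
Proof.
move=> /andP[k0 k1]; rewrite /ellipticK /agm_int.
have kk : 0 < 1 - k ^+ 2 by rewrite subr_gt0 exprn_ilt1.
rewrite legendre_agm ?k0//.
set f := agm_integrand _ _.
have cf : continuous f by apply: continuous_agm_integrand => //; rewrite sqrtr_gt0.
have p0 : (0 : R) <= pi / 2 by rewrite divr_ge0// pi_ge0.
by rewrite (Rintegral_FTC p0 cf (fun x => is_derive_prim0 x cf)) prim0 subr0.
Qed.

Lemma agm_int_gt0 a b : 0 < a -> 0 < b -> 0 < agm_int a b.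
Proof.
move=> a0 b0; set w := agm_integrand a b.
have d x := is_derive_prim0 x (continuous_agm_integrand a0 b0).
have pi20 : (0 : R) < pi / 2 by rewrite divr_gt0// pi_gt0.
have [c _] := MVT pi20 (fun x _ => d x) (is_derive_within (fun x _ => d x)).
rewrite prim0 !subr0 /agm_int -/w => ->; rewrite mulr_gt0//.
by rewrite /w /agm_integrand invr_gt0 sqrtr_gt0 agm_quad_gt0.
Qed.

(** Let [q] be the square root of [delta]. Two Landen steps send [(1, q^2)] to [((1 + q^2) / 2, q)]
    and then to [a2] times [(1, m1)]. Two more send [((1 + q)^2, (1 - q)^2)], a multiple of
    [(1, m)], to [(1 + q^2, 1 - q^2)] and then to [(1, sqrt (1 - q^4))]. The ratio of the scale
    factors is the 4 in the definition of the rate. *)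
Lemma zolotarev_rateE delta : 0 < delta < 1 ->
  zolotarev_rate delta = pi * agm_int 1 (Num.sqrt (1 - delta ^+ 2)) / agm_int 1 delta.
Proof.
move=> /andP[d0 d1]; rewrite /zolotarev_rate; set q := Num.sqrt delta.
set m := (_ / (1 + q)) ^+ 2; set m1 := Num.sqrt _.
have q0 : 0 < q by rewrite sqrtr_gt0.
have q1 : q < 1 by rewrite -sqrtr1 ltr_sqrt.
have dq : delta = q ^+ 2 by rewrite sqr_sqrtr// ltW.
have qq : 0 < 1 + q by rewrite addr_gt0.
have qn : 1 + q != 0 by rewrite gt_eqF.
have m0 : 0 < m by rewrite /m exprn_gt0// divr_gt0// subr_gt0.
have mlt1 : m < 1.
  by rewrite /m exprn_ilt1// ?divr_ge0 ?subr_ge0 ?(ltW q1) ?(ltW qq)// ltr_pdivrMr//; lra.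
have m2 : 0 < 1 - m ^+ 2 by rewrite subr_gt0 exprn_ilt1// ltW.
have m10 : 0 < m1 by rewrite sqrtr_gt0.
have m1lt1 : m1 < 1.
  rewrite -[ltRHS]sqrtr1 ltr_sqrt//; have : 0 < m ^+ 2 by rewrite exprn_gt0.
  by move=> ?; lra.
rewrite !ellipticKE ?(ltW m0) ?(ltW m10)// -/m1.
have -> : Num.sqrt (1 - m1 ^+ 2) = m.
  by rewrite sqr_sqrtr ?(ltW m2)// opprB addrCA subrr addr0 sqrtr_sqr gtr0_norm.
set a2 := (1 + q) ^+ 2 / 4; have a20 : 0 < a2 by rewrite divr_gt0// exprn_gt0.
have q2lt : q ^+ 2 < 1 by rewrite -dq.
have q20 : 0 < q ^+ 2 by rewrite -dq.
have -> : agm_int 1 delta = a2^-1 * agm_int 1 m1.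
  have E1 : a2 * m1 = Num.sqrt ((1 + delta) / 2 * q).
    rewrite -{1}(gtr0_norm a20) -sqrtr_sqr /m1 -sqrtrM ?sqr_ge0//.
    by congr (Num.sqrt _); rewrite /a2 /m dq; field.
  have E2 : a2 * 1 = ((1 + delta) / 2 + q) / 2 by rewrite /a2 dq; field.
  have d20 : 0 < (1 + delta) / 2 by rewrite divr_gt0// addr_gt0.
  have L1 := landen ltr01 d0; rewrite mul1r -/q in L1.
  by rewrite -L1 -(landen d20 q0) -E1 -E2 agm_int_scale.
have -> : agm_int 1 m = 4 * a2 * agm_int 1 (Num.sqrt (1 - delta ^+ 2)).
  have c0 : 0 < (1 + q) ^+ 2 by rewrite exprn_gt0.
  have -> : agm_int 1 m = (1 + q) ^+ 2 * agm_int ((1 + q) ^+ 2) ((1 - q) ^+ 2).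
    have -> : (1 - q) ^+ 2 = (1 + q) ^+ 2 * m by rewrite /m; field.
    rewrite -{2}[(1 + q) ^+ 2]mulr1 agm_int_scale// mulrA divff ?mul1r//.
    by rewrite gt_eqF.
  have p0 : 0 < 1 - q by rewrite subr_gt0.
  have -> : 4 * a2 = (1 + q) ^+ 2 by rewrite /a2; field.
  have L1 := landen c0 (exprn_gt0 2 p0).
  have E1 : Num.sqrt ((1 + q) ^+ 2 * (1 - q) ^+ 2) = 1 - q ^+ 2.
    by rewrite -exprMn sqrtr_sqr gtr0_norm ?mulr_gt0//; ring.
  have E2 : ((1 + q) ^+ 2 + (1 - q) ^+ 2) / 2 = 1 + q ^+ 2 by field.
  have u0 : 0 < 1 + q ^+ 2 by rewrite addr_gt0.
  have v0 : 0 < 1 - q ^+ 2 by rewrite subr_gt0.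
  have L2 := landen u0 v0.
  have E3 : (1 + q ^+ 2 + (1 - q ^+ 2)) / 2 = 1 by field.
  have E4 : (1 + q ^+ 2) * (1 - q ^+ 2) = 1 - delta ^+ 2 by rewrite dq; ring.
  by rewrite -L1 E1 E2 -L2 E3 E4.
have n1 : agm_int 1 m1 != 0 by rewrite gt_eqF// agm_int_gt0.
have a2n : a2 != 0 by rewrite gt_eqF.
by field; rewrite n1 a2n.
Qed.

Lemma sin_le_id x : 0 <= x -> sin x <= x.
Proof.
move=> x0; rewrite -subr_ge0.
have := @is_derive_le R (fun y => y - sin y) (fun y => 1 - cos y) 0 x x0.
by rewrite sin0 subrr; apply=> y _; rewrite subr_ge0 cos_le1.
Qed.

(** Since [cos x <= pi / 2 - x], the integrand dominates [(pi / 2 - x + delta)^-1], whose integral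
    is [ln (pi / 2 + delta) - ln delta] with a nonnegative first term. *)
Lemma agm_int_ge_ln delta : 0 < delta -> - ln delta <= agm_int 1 delta.
Proof.
move=> d0; set w := agm_integrand 1 delta.
have dw x := is_derive_prim0 x (continuous_agm_integrand ltr01 d0).
have p0 : (0 : R) < pi / 2 by rewrite divr_gt0// pi_gt0.
have pos x : 0 <= x <= pi / 2 -> 0 < pi / 2 - x + delta by move=> /andP[_ ?]; lra.
have := @is_derive_le R (fun x => prim w x + ln (pi / 2 - x + delta))
  (fun x => w x - (pi / 2 - x + delta)^-1) 0 (pi / 2) (ltW p0).
rewrite prim0 add0r subr0 subrr add0r -/(agm_int 1 delta) => h.
have : ln (pi / 2 + delta) <= agm_int 1 delta + ln delta.
  apply: h => x x01.
    eapply is_derive_eq; first by eapply dfD; [exact: dw|eapply dfln; [repeat dstep|exact: pos]].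
    by cbv beta; rewrite sub0r addr0 mulN1r.
  rewrite subr_ge0 /w /agm_integrand lef_pV2 ?posrE ?sqrtr_gt0 ?pos ?agm_quad_gt0//.
  have x1 : 0 <= pi / 2 - x by lra.
  rewrite -[leRHS]gtr0_norm ?pos// -sqrtr_sqr ler_sqrt ?exprn_ge0 ?(ltW (pos _ _))//.
  have cs : cos x <= pi / 2 - x.
    by rewrite -[x in cos x](subKr (pi / 2)) cosB cos_pihalf sin_pihalf mul0r mul1r add0r sin_le_id.
  have c0 : 0 <= cos x by apply: cos_ge0_pihalf; move: x01 => /andP[? ?]; lra.
  have s1 : sin x ^+ 2 <= 1 by rewrite sin2cos2 gerBl sqr_ge0.
  rewrite expr1n mul1r.
  have h1 : cos x ^+ 2 <= (pi / 2 - x) ^+ 2 by rewrite ler_pXn2r ?nnegrE.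
  have h2 : delta ^+ 2 * sin x ^+ 2 <= delta ^+ 2 by rewrite ler_piMr ?sqr_ge0.
  have h3 : 0 <= (pi / 2 - x) * delta by rewrite mulr_ge0// ltW.
  by rewrite sqrrD; lra.
have : 0 <= ln (pi / 2 + delta).
  by rewrite ln_ge0//; have := pihalf_ge1 R; lra.
by lra.
Qed.

Lemma agm_int_le b : 1 / 2 <= b -> agm_int 1 b <= pi.
Proof.
move=> b2; have b0 : 0 < b by lra.
set w := agm_integrand 1 b.
have dw x := is_derive_prim0 x (continuous_agm_integrand ltr01 b0).
have p0 : (0 : R) < pi / 2 by rewrite divr_gt0// pi_gt0.
have := @is_derive_le R (fun x => 2 * x - prim w x) (fun x => 2 - w x) 0 (pi / 2) (ltW p0).
rewrite prim0 mulr0 subrr -/(agm_int 1 b) mulrCA divff// mulr1 subr_ge0; apply => x x01.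
  eapply is_derive_eq; first by eapply dfD; [repeat dstep|eapply dfN; exact: dw].
  by rewrite -/w; ring.
rewrite subr_ge0 /w /agm_integrand -[leRHS]invrK lef_pV2 ?posrE ?sqrtr_gt0 ?agm_quad_gt0//.
rewrite -[leLHS]gtr0_norm// -sqrtr_sqr ler_sqrt ?(ltW (agm_quad_gt0 _ _ _))//.
rewrite expr1n mul1r cos2sin2.
have s0 : 0 <= sin x ^+ 2 by rewrite sqr_ge0.
have s1 : sin x ^+ 2 <= 1 by rewrite sin2cos2 gerBl sqr_ge0.
have h1 : (1 / 2) ^+ 2 <= b ^+ 2 by rewrite ler_pXn2r ?nnegrE//; lra.
have h2 : (1 / 2) ^+ 2 * sin x ^+ 2 <= b ^+ 2 * sin x ^+ 2 by rewrite ler_wpM2r.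
by rewrite !exprVn; lra.
Qed.

(** For [kappa > 2] the two preceding bounds keep the numerator of the rate below [pi * pi] and its
    denominator above [ln kappa]. *)
Lemma zolotarev_rate_bigO :
  exists g : R -> R,
    (forall lamL lamU : R, 0 < lamL ^+ 2 < lamU ^+ 2 ->
       zolotarev_rate (lamL ^+ 2 / lamU ^+ 2) = g (lamU ^+ 2 / lamL ^+ 2)) /\
    g =O_ (pinfty_nbhs R) (fun kappa : R => (ln kappa)^-1).
Proof.
exists (fun k => zolotarev_rate k^-1); split.
  by move=> a b _; rewrite invf_div.
apply/eqOP; near=> K; near=> k.
have k2 : 2 < k by near: k; exact: nbhs_pinfty_gt.
have d0 : 0 < k^-1 by rewrite invr_gt0; lra.
have d1 : k^-1 < 1 / 2 by rewrite div1r ltf_pV2 ?posrE//; lra.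
have d11 : k^-1 < 1 by lra.
have dd : 1 / 4 <= 1 - k^-1 ^+ 2.
  have : k^-1 ^+ 2 <= (1 / 2) ^+ 2 by rewrite ler_pXn2r ?nnegrE ?(ltW d0) ?(ltW d1)//; lra.
  by rewrite expr_div_n expr1n; lra.
have s2 : 1 / 2 <= Num.sqrt (1 - k^-1 ^+ 2).
  rewrite -[leLHS]gtr0_norm// -sqrtr_sqr ler_sqrt; last by lra.
  by rewrite expr_div_n expr1n; lra.
have lnk : 0 < ln k by rewrite ln_gt0//; lra.
have h1 := agm_int_le s2.
have s0 : 0 < Num.sqrt (1 - k^-1 ^+ 2) by lra.
have h1' := agm_int_gt0 ltr01 s0.
have h2 := agm_int_ge_ln d0; rewrite lnV ?posrE ?opprK in h2; last by lra.
have h2' := agm_int_gt0 ltr01 d0.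
rewrite zolotarev_rateE ?d0 ?d11// ger0_norm; last first.
  by rewrite divr_ge0 ?mulr_ge0 ?pi_ge0// ltW.
rewrite ger0_norm ?invr_ge0 ?(ltW lnk)//.
have Kp : pi * pi <= K by near: K; apply: nbhs_pinfty_ge; exact: num_real.
apply: ler_pM; rewrite ?mulr_ge0 ?pi_ge0 ?invr_ge0 ?(ltW h2') ?(ltW h1')//.
  by apply: le_trans Kp; rewrite ler_wpM2l ?pi_ge0.
by rewrite lef_pV2 ?posrE.
Unshelve. all: by end_near. Qed.

End Landen.

(** * The Jacobi function dn and the Zolotarev product *)

Section Jacobi.
Variables (R : realType) (k : R).
Hypothesis hk : 0 < k < 1.
Implicit Types (u v x : R).

Let k0 : 0 < k. Proof. by case/andP: hk. Qed.
Let k1 : k < 1. Proof. by case/andP: hk. Qed.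
Let kk : k ^+ 2 < 1. Proof. by rewrite exprn_ilt1// ltW. Qed.
Let k20 : 0 < k ^+ 2. Proof. by rewrite exprn_gt0. Qed.

Let w := legendre_integrand k.
Let F x := ellipticF x k.
Let K := F (pi / 2).

Lemma legendre_quad_gt0 x : 0 < 1 - k ^+ 2 * sin x ^+ 2.
Proof.
have s1 : sin x ^+ 2 <= 1 by rewrite sin2cos2 gerBl sqr_ge0.
have : k ^+ 2 * sin x ^+ 2 <= k ^+ 2 by rewrite ler_piMr ?sqr_ge0.
by move: kk; lra.
Qed.

Lemma continuous_legendre : continuous w.
Proof.
have k01 : 0 <= k < 1 by rewrite (ltW k0) k1.
rewrite /w legendre_agm//; apply: continuous_agm_integrand => //.
by rewrite sqrtr_gt0 subr_gt0.
Qed.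

Lemma ellipticFE x : F x = prim w x. Proof. by []. Qed.

Lemma is_derive_ellipticF x : is_derive x 1 F (w x).
Proof. exact: is_derive_prim0 continuous_legendre. Qed.

Lemma legendre_ge1 x : 1 <= w x.
Proof.
rewrite /w /legendre_integrand -[leLHS]invr1 lef_pV2 ?posrE ?sqrtr_gt0 ?legendre_quad_gt0//.
by rewrite -[leRHS]sqrtr1 ler_sqrt// gerBl mulr_ge0 ?sqr_ge0.
Qed.

Lemma ellipticF0 : F 0 = 0. Proof. exact: prim0. Qed.

(** The integrand is at least 1, so [F] expands distances. Injectivity, monotonicity and
    surjectivity of [F], hence the existence of the amplitude, all rest on this. *)
Lemma ellipticF_expand x y : x <= y -> y - x <= F y - F x.
Proof.
move=> xy; have := @is_derive_le R (fun z => F z - z) (fun z => w z - 1) x y xy.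
move=> h; suff : F x - x <= F y - y by lra.
apply: h => z _; last by rewrite subr_ge0 legendre_ge1.
by eapply dfD; [exact: is_derive_ellipticF|eapply dfN; exact: dfid].
Qed.

Lemma ellipticF_inj : injective F.
Proof.
move=> x y; wlog xy : x y / x <= y => [h E|].
  by have [/h->//|/ltW/h->//] := leP x y.
move=> E; have := ellipticF_expand xy; rewrite E subrr subr_le0 => yx.
by apply/eqP; rewrite eq_le xy.
Qed.

Lemma ellipticF_le x y : (F x <= F y) = (x <= y).
Proof.
have [xy|yx] := leP x y.
  by have := ellipticF_expand xy; lra.
by have := ellipticF_expand (ltW yx); apply: contraTF => ?; lra.
Qed.

Lemma ellipticF_lt x y : (F x < F y) = (x < y).
Proof. by rewrite !ltNge ellipticF_le. Qed.

Lemma continuous_ellipticF : continuous F.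
Proof. by move=> x; exact: is_derive_continuous (is_derive_ellipticF x). Qed.

Lemma ellipticF_surj u : exists x, F x = u.
Proof.
have h1 := @ellipticF_expand 0 `|u| (normr_ge0 _).
have h2 := @ellipticF_expand (- `|u|) 0; rewrite oppr_le0 normr_ge0 in h2.
move: h1 (h2 isT); rewrite ellipticF0 => {}h1 {}h2.
have [|||x _ Fx] := @IVT R F (- `|u|) `|u| u.
- by rewrite ge0_cp// normr_ge0.
- by apply: continuous_subspaceT; exact: continuous_ellipticF.
- have := lerNnormlW (lexx `|u|); have := ler_norm u => a b.
  by rewrite ge_min le_max; apply/andP; split; apply/orP; [left|right]; lra.
by exists x.
Qed.

Definition am u := jacobi_am u k.

Lemma amK u : F (am u) = u.
Proof. exact: (getPex (ellipticF_surj u)). Qed.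

Lemma ellipticFK x : am (F x) = x.
Proof. by apply: ellipticF_inj; rewrite amK. Qed.

Let S u := sin (am u).
Let C u := cos (am u).
Let D u := jacobi_dn u k.

Lemma jacobi_dn_sqr u : D u ^+ 2 = 1 - k ^+ 2 * S u ^+ 2.
Proof. by rewrite sqr_sqrtr// ltW// legendre_quad_gt0. Qed.

Lemma jacobi_dn_gt0 u : 0 < D u.
Proof. by rewrite sqrtr_gt0 legendre_quad_gt0. Qed.

Lemma is_derive_am u : is_derive u 1 am (D u).
Proof.
have wD : w (am u) = (D u)^-1 by [].
rewrite -[D _]invrK -wD.
have : is_derive (F (am u)) 1 am (w (am u))^-1; last by rewrite amK.
apply: is_derive_inverse.
- by near=> x; exact: ellipticFK.
- by near=> x; exact: continuous_ellipticF.
- exact: is_derive_ellipticF.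
- by rewrite wD invr_eq0 gt_eqF ?jacobi_dn_gt0.
Unshelve. all: by end_near. Qed.

Lemma is_derive_sn u : is_derive u 1 S (C u * D u).
Proof. exact: dfsin (is_derive_am u). Qed.

Lemma is_derive_cn u : is_derive u 1 C (- S u * D u).
Proof. exact: dfcos (is_derive_am u). Qed.

Lemma is_derive_dn u : is_derive u 1 D (- k ^+ 2 * S u * C u).
Proof.
have dS := is_derive_sn u; have q := legendre_quad_gt0 (am u).
rewrite /D /jacobi_dn; dsolve => //; rewrite -/(S u) -/(am u) -/(D u).
have D0 : D u != 0 by rewrite gt_eqF ?jacobi_dn_gt0.
have -> : Num.sqrt (1 - k ^+ 2 * S u ^+ 2) = D u by [].
by field.
Qed.

Lemma cn_sqr u : C u ^+ 2 = 1 - S u ^+ 2. Proof. exact: cos2sin2. Qed.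

Lemma am0 : am 0 = 0. Proof. by apply: ellipticF_inj; rewrite amK ellipticF0. Qed.

Lemma ellipticFN x : F (- x) = - F x.
Proof.
have : F (- x) + F x = F (- 0) + F 0.
  apply: (@is_derive_cst_eq R (fun y => F (- y) + F y)) => y.
  eapply is_derive_eq.
    eapply dfD; last exact: is_derive_ellipticF.
    by eapply (dfcomp (is_derive_ellipticF _)); repeat dstep.
  by cbv beta; rewrite /w /legendre_integrand sinN sqrrN; ring.
by rewrite oppr0 ellipticF0 addr0 => /eqP; rewrite addr_eq0 => /eqP.
Qed.

Lemma ellipticFpi : F pi = 2 * K.
Proof.
have k01 : 0 <= k < 1 by rewrite (ltW k0) k1.
rewrite /K !ellipticFE /w legendre_agm//; apply: prim_agm_pi => //.
by rewrite sqrtr_gt0 subr_gt0.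
Qed.

Lemma ellipticFDpi x : F (x + pi) = F x + 2 * K.
Proof.
have : F (x + pi) - F x = F (0 + pi) - F 0.
  apply: (@is_derive_cst_eq R (fun y => F (y + pi) - F y)) => y.
  eapply is_derive_eq.
    eapply dfD; last by eapply dfN; exact: is_derive_ellipticF.
    by eapply (dfcomp (is_derive_ellipticF _)); repeat dstep.
  by cbv beta; rewrite /w /legendre_integrand sinDpi sqrrN; ring.
by rewrite add0r ellipticF0 ellipticFpi; lra.
Qed.

Lemma amN u : am (- u) = - am u.
Proof. by rewrite -{1}(amK u) -ellipticFN ellipticFK. Qed.

Lemma amD2K u : am (u + 2 * K) = am u + pi.
Proof. by rewrite -{1}(amK u) -ellipticFDpi ellipticFK. Qed.

Lemma dnN u : D (- u) = D u.
Proof. by rewrite /D /jacobi_dn -!/(am _) amN sinN sqrrN. Qed.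

Lemma dnD2K u : D (u + 2 * K) = D u.
Proof. by rewrite /D /jacobi_dn -!/(am _) amD2K sinDpi sqrrN. Qed.

Lemma dn_add_den_gt0 u v : 0 < 1 - k ^+ 2 * S u ^+ 2 * S v ^+ 2.
Proof.
have s1 : S v ^+ 2 <= 1 by rewrite /S sin2cos2 gerBl sqr_ge0.
have : k ^+ 2 * S u ^+ 2 * S v ^+ 2 <= k ^+ 2 * S u ^+ 2.
  by apply: ler_piMr => //; rewrite mulr_ge0 ?sqr_ge0.
by have := legendre_quad_gt0 (am u); rewrite -/(S u); lra.
Qed.

(** Along pairs [x], [c - x] of constant sum [c], the right-hand side has zero derivative. It thus
    equals its value at [x = 0], which is [D c]. *)
Lemma dn_add u v : D (u + v) =
  (D u * D v - k ^+ 2 * S u * S v * C u * C v) / (1 - k ^+ 2 * S u ^+ 2 * S v ^+ 2).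
Proof.
pose c := u + v.
have S0 : S 0 = 0 by rewrite /S am0 sin0.
have C0 : C 0 = 1 by rewrite /C am0 cos0.
have D0 : D 0 = 1.
  by rewrite /D /jacobi_dn -/(am 0) am0 sin0 expr0n mulr0 subr0 sqrtr1.
pose f x := (D x * D (c - x) - k ^+ 2 * S x * S (c - x) * C x * C (c - x)) *
   (1 - k ^+ 2 * S x ^+ 2 * S (c - x) ^+ 2)^-1.
have -> : v = c - u by rewrite /c; ring.
have -> : u + (c - u) = c by ring.
suff : f u = f 0.
  by rewrite /f !subr0 S0 C0 D0 expr0n/= !(mulr0, mul0r) !subr0 mul1r invr1 mulr1 => ->.
apply: is_derive_cst_eq => x.
have dS := is_derive_sn x; have dC := is_derive_cn x; have dD := is_derive_dn x.
have dc : is_derive x 1 (fun x => c - x) (- 1) by dsolve; ring.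
have dS' := @dfcomp R S (fun x => c - x) x _ _ (is_derive_sn (c - x)) dc.
have dC' := @dfcomp R C (fun x => c - x) x _ _ (is_derive_cn (c - x)) dc.
have dD' := @dfcomp R D (fun x => c - x) x _ _ (is_derive_dn (c - x)) dc.
have q := dn_add_den_gt0 x (c - x); have q0 := lt0r_neq0 q.
rewrite /f; eapply is_derive_eq.
  eapply dfM; last eapply dfV.
  - by repeat first [exact dS|exact dS'|exact dC|exact dC'|exact dD|exact dD'|
      exact: dfcst | eapply dfX|eapply dfM|eapply dfN|eapply dfD].
  - by repeat first [exact dS|exact dS'|exact dC|exact dC'|exact dD|exact dD'|
      exact: dfcst | eapply dfX|eapply dfM|eapply dfN|eapply dfD].
  - exact: q0.
cbv beta; move: (jacobi_dn_sqr x) (jacobi_dn_sqr (c - x)) (cn_sqr x) (cn_sqr (c - x)) q0.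
set s1 := S x; set s2 := S (c - x); set c1 := C x; set c2 := C (c - x).
set d1 := D x; set d2 := D (c - x) => D1 D2 C1 C2.
set q' := 1 - _ => q0.
(* Together [E1] and [E2] show that the derivative of the numerator times the denominator equals the
   numerator times the derivative of the denominator. *)
have E1 : (k ^+ 2) * 2 * s1 * s2 * (s1 * c2 * d1 - s2 * c1 * d2) =
    k ^+ 2 * s2 * c2 * d1 * (1 - c1 ^+ 2 + s1 ^+ 2) +
    k ^+ 2 * s1 * c1 * d2 * (- 1 + c2 ^+ 2 - s2 ^+ 2).
  by rewrite C1 C2; ring.
have E2 : (s1 * c2 * d1 - s2 * c1 * d2) * q' =
    s1 * c2 * d1 * (d2 ^+ 2 + k ^+ 2 * s2 ^+ 2 * c1 ^+ 2) -
    s2 * c1 * d2 * (d1 ^+ 2 + k ^+ 2 * s1 ^+ 2 * c2 ^+ 2).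
  by rewrite C1 C2 D1 D2 /q'; ring.
move: q' q0 E2 => q' q0 E2.
set N := d1 * (- k ^+ 2 * s2 * c2 * -1) + _ - _.
have NE : N * q' = k ^+ 2 * 2 * s1 * s2 * ((s1 * c2 * d1 - s2 * c1 * d2) * q').
  by rewrite mulrA E1 /N; ring.
rewrite E2 in NE.
have -> : q'^-1 * N = N * q' / q' ^+ 2 by field.
by rewrite NE; field.
Qed.

Lemma dn_sub u v : D (u - v) =
  (D u * D v + k ^+ 2 * S u * S v * C u * C v) / (1 - k ^+ 2 * S u ^+ 2 * S v ^+ 2).
Proof.
rewrite dn_add dnN.
have -> : S (- v) = - S v by rewrite /S amN sinN.
have -> : C (- v) = C v by rewrite /C amN cosN.
by rewrite sqrrN; congr (_ / _); ring.
Qed.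

Let T u := (1 - D u) / (1 + D u).

Lemma dn_ratio_sqr u v :
  ((D u - D v) / (D u + D v)) ^+ 2 = T (u - v) * T (u + v).
Proof.
have q0 := lt0r_neq0 (dn_add_den_gt0 u v).
have p1 : 1 + D (u - v) != 0 by rewrite gt_eqF// addr_gt0 ?jacobi_dn_gt0.
have p2 : 1 + D (u + v) != 0 by rewrite gt_eqF// addr_gt0 ?jacobi_dn_gt0.
have p3 : D u + D v != 0 by rewrite gt_eqF// addr_gt0 ?jacobi_dn_gt0.
rewrite /T; move: p1 p2; rewrite dn_sub dn_add.
move: (jacobi_dn_sqr u) (jacobi_dn_sqr v) (cn_sqr u) (cn_sqr v) q0 p3.
set s1 := S u; set s2 := S v; set c1 := C u; set c2 := C v; set d1 := D u; set d2 := D v.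
move=> D1 D2 C1 C2; set q := 1 - _; set m := k ^+ 2 * s1 * s2 * c1 * c2 => q0 p3 p1 p2.
have m2 : m ^+ 2 = (k ^+ 2 * s1 * s2) ^+ 2 * (1 - s1 ^+ 2) * (1 - s2 ^+ 2).
  by rewrite -C1 -C2 /m; ring.
(* The values of [D] at [u - v] and [u + v] are [(d1 * d2 + m) / q] and [(d1 * d2 - m) / q]. The
   left-hand sides of [E1] and [E2] are therefore, up to the factor [q ^+ 2], the numerator and the
   denominator of the product of the two [T]. *)
have E1 : (q - d1 * d2) ^+ 2 - m ^+ 2 = q * (d1 - d2) ^+ 2.
  rewrite m2; transitivity (q ^+ 2 - 2 * q * d1 * d2 + d1 ^+ 2 * d2 ^+ 2 -
    (k ^+ 2 * s1 * s2) ^+ 2 * (1 - s1 ^+ 2) * (1 - s2 ^+ 2)); first by ring.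
  transitivity (q * (d1 ^+ 2 + d2 ^+ 2) - 2 * q * d1 * d2); last by ring.
  by rewrite D1 D2 /q; ring.
have E2 : (q + d1 * d2) ^+ 2 - m ^+ 2 = q * (d1 + d2) ^+ 2.
  rewrite m2; transitivity (q ^+ 2 + 2 * q * d1 * d2 + d1 ^+ 2 * d2 ^+ 2 -
    (k ^+ 2 * s1 * s2) ^+ 2 * (1 - s1 ^+ 2) * (1 - s2 ^+ 2)); first by ring.
  transitivity (q * (d1 ^+ 2 + d2 ^+ 2) + 2 * q * d1 * d2); last by ring.
  by rewrite D1 D2 /q; ring.
transitivity (((q - d1 * d2) ^+ 2 - m ^+ 2) / ((q + d1 * d2) ^+ 2 - m ^+ 2)).
  by rewrite E1 E2; clearbody q; field; rewrite p3 q0.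
clearbody q m d1 d2.
have n1 : q + (d1 * d2 + m) != 0.
  by apply: contra p1 => /eqP h; apply/eqP; rewrite -[1](divff q0) -mulrDl h mul0r.
have n2 : q + (d1 * d2 - m) != 0.
  by apply: contra p2 => /eqP h; apply/eqP; rewrite -[1](divff q0) -mulrDl h mul0r.
have -> : (q + d1 * d2) ^+ 2 - m ^+ 2 = (q + (d1 * d2 + m)) * (q + (d1 * d2 - m)) by ring.
by field; nz.
Qed.

Lemma ellipticKF : ellipticK k = K.
Proof.
rewrite /K ellipticFE /prim [X in _ - X](_ : _ = 0) ?subr0//.
by rewrite set_itv_ge ?Rintegral_set0// bnd_simp -ltNge divr_gt0// pi_gt0.
Qed.

Lemma K_gt0 : 0 < K.
Proof. by rewrite -ellipticF0 ellipticF_lt divr_gt0// pi_gt0. Qed.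

Lemma am_itv u : 0 <= u <= K -> 0 <= am u <= pi / 2.
Proof. by move=> /andP[a b]; rewrite -(ellipticF_le 0) -(ellipticF_le _ (pi / 2)) amK ellipticF0 a. Qed.

Lemma sn_ge0 u : 0 <= u <= K -> 0 <= S u.
Proof.
move=> /am_itv/andP[a b]; apply: sin_ge0_pi; rewrite a /=.
by apply: le_trans b _; have := pi_ge0 R; lra.
Qed.

Lemma cn_ge0 u : 0 <= u <= K -> 0 <= C u.
Proof.
move=> /am_itv/andP[a b]; apply: cos_ge0_pihalf; rewrite b andbT.
by have := pi_ge0 R; lra.
Qed.

Lemma sn_gt0 u : 0 < u <= K -> 0 < S u.
Proof.
move=> /andP[u0 uK]; apply: sin_gt0_pi.
have := am_itv (_ : 0 <= u <= K); rewrite (ltW u0) uK => /(_ isT)/andP[_ b].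
rewrite -(ellipticF_lt 0) amK ellipticF0 u0/=; apply: le_lt_trans b _.
by have := pi_gt0 R; lra.
Qed.

Lemma dn_lt1 u : 0 < u <= K -> D u < 1.
Proof.
move=> u0; have D0 := jacobi_dn_gt0 u; have s0 := sn_gt0 u0.
have h : 0 < k ^+ 2 * S u ^+ 2 by rewrite mulr_gt0 ?exprn_gt0.
by rewrite -(@ltr_pXn2r _ 2)// ?nnegrE ?(ltW D0)// jacobi_dn_sqr expr1n; lra.
Qed.

Lemma dn_le1 u : D u <= 1.
Proof.
have h : 0 <= k ^+ 2 * S u ^+ 2 by rewrite mulr_ge0 ?sqr_ge0.
by rewrite -(@ler_pXn2r _ 2)// ?nnegrE ?(ltW (jacobi_dn_gt0 u))// jacobi_dn_sqr expr1n; lra.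
Qed.

Lemma dn_decr u v : 0 <= u -> u <= v -> v <= K -> D v <= D u.
Proof.
move=> u0 uv vK.
have := @is_derive_le R (fun x => - D x) (fun x => k ^+ 2 * S x * C x) u v uv.
rewrite lerN2; apply=> x /andP[ux xv].
  by eapply is_derive_eq; [eapply dfN; exact: is_derive_dn|ring].
have x0K : 0 <= x <= K by rewrite (le_trans u0 ux) (le_trans xv vK).
by rewrite mulr_ge0 ?cn_ge0// mulr_ge0 ?sqr_ge0 ?sn_ge0.
Qed.

Lemma dn_surj x : Num.sqrt (1 - k ^+ 2) <= x <= 1 -> exists2 u, 0 <= u <= K & D u = x.
Proof.
move=> /andP[dx x1].
have x0 : 0 < x by apply: lt_le_trans dx; rewrite sqrtr_gt0 subr_gt0.
have x2 : 1 - k ^+ 2 <= x ^+ 2.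
  rewrite -[leLHS]sqr_sqrtr ?subr_ge0 ?(ltW kk)//.
  by rewrite ler_pXn2r ?nnegrE ?sqrtr_ge0 ?(ltW x0).
have x21 : x ^+ 2 <= 1 by rewrite expr_le1 ?(ltW x0).
pose y := Num.sqrt (1 - x ^+ 2) / k.
have y0 : 0 <= y by rewrite divr_ge0 ?sqrtr_ge0 ?(ltW k0).
have y1 : y <= 1.
  rewrite ler_pdivrMr// mul1r -[leRHS]gtr0_norm// -sqrtr_sqr ler_sqrt ?sqr_ge0//.
  by lra.
have yN : -1 <= y by apply: le_trans y0; rewrite oppr_le0.
exists (F (asin y)).
  rewrite -{1}ellipticF0 ellipticF_le /K ellipticF_le asin_lepi2 ?y1 ?yN// andbT.
  rewrite leNgt; apply/negP => a0.
  have : sin (asin y) < 0.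
    rewrite -oppr_gt0 -sinN; apply: sin_gt0_pihalf; rewrite oppr_gt0 a0/= ltrNl.
    rewrite lt_neqAle asin_geNpi2 ?y1 ?yN// andbT; apply/eqP => E.
    have := asinK (_ : y \in `[-1, 1]); rewrite in_itv/= yN y1 => /(_ isT).
    by rewrite -E sinN sin_pihalf => ?; lra.
  by rewrite asinK ?in_itv/= ?yN ?y1// ltNge y0.
rewrite /D /jacobi_dn -/(am _) ellipticFK asinK ?in_itv/= ?yN ?y1//.
rewrite /y expr_div_n sqr_sqrtr ?subr_ge0// mulrC divfK ?gt_eqF//.
by rewrite subKr sqrtr_sqr gtr0_norm.
Qed.

Section ZolotarevProduct.
Variable r' : nat.
Let r := r'.+1.
Let h := K / r%:R.
Let theta (j : nat) : R := (j%:R + 1 / 2) * h.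

Let h0 : 0 < h. Proof. by rewrite divr_gt0 ?K_gt0 ?ltr0n. Qed.

Let rh : r%:R * h = K. Proof. by rewrite /h mulrCA divff ?mulr1 ?pnatr_eq0. Qed.

Let P u := \prod_(j < r) ((D u - D (theta j)) / (D u + D (theta j))) ^+ 2.

Let P_T u : P u = (\prod_(j < r) T (u - theta j)) * \prod_(j < r) T (u + theta j).
Proof. by rewrite -big_split/=; apply: eq_bigr => j _; exact: dn_ratio_sqr. Qed.

(* Each of the two products over shifts of [u] is permuted cyclically, [T] having
   period [2 * K]. *)
Lemma zolotarev_prod_periodic u : P (u + h) = P u.
Proof.
have TK v : T (v + 2 * K) = T v by rewrite /T dnD2K.
rewrite !P_T [X in X * _ = _]big_ord_recl [X in _ * X = _]big_ord_recr/=.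
rewrite [X in _ = X * _]big_ord_recr [X in _ = _ * X]big_ord_recl/=.
have -> : u + h - theta 0 = u + theta 0 by rewrite /theta; field.
have -> : u + h + theta r' = u - theta r' + 2 * K.
  by rewrite -rh /theta /r -natr1; field.
rewrite TK.
have -> : \prod_(i < r') T (u + h - theta (bump 0 i)) = \prod_(i < r') T (u - theta i).
  apply: eq_bigr => i _; congr T; rewrite /bump add1n /theta -natr1; ring.
have -> : \prod_(i < r') T (u + h + theta i) = \prod_(i < r') T (u + theta (bump 0 i)).
  apply: eq_bigr => i _; congr T; rewrite /bump add1n /theta -natr1; ring.
ring.
Qed.

Let theta_itv j : (j < r)%N -> h / 2 <= theta j <= K.
Proof.
move=> jr; rewrite -rh /theta; apply/andP; split.
  by rewrite mulrDl div1r [2^-1 * _]mulrC lerDr mulr_ge0 ?ler0n ?(ltW h0).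
rewrite ler_pM2r//; have : (j.+1)%:R <= r%:R :> R by rewrite ler_nat.
by rewrite -natr1; lra.
Qed.

(** Every [theta j] is at least [h / 2], so each difference [D u - D (theta j)] is nonnegative here.
    Each ratio then increases with [D u], whose largest value is 1. *)
Lemma zolotarev_prod_near0 u : - (h / 2) <= u <= h / 2 ->
  P u <= \prod_(j < r) ((1 - D (theta j)) / (1 + D (theta j))) ^+ 2.
Proof.
move=> /andP[u1 u2]; apply: ler_prod => j _; rewrite sqr_ge0/=.
have /andP[t1 t2] := theta_itv (ltn_ord j).
have Dt0 := jacobi_dn_gt0 (theta j); have Du0 := jacobi_dn_gt0 u.
have DtDu : D (theta j) <= D u.
  have [u0|u0] := leP 0 u; first by apply: dn_decr => //; lra.
  by rewrite -(dnN u); apply: dn_decr => //; lra.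
have Du1 := dn_le1 u.
have n1 : 0 <= (D u - D (theta j)) / (D u + D (theta j)).
  by rewrite divr_ge0 ?subr_ge0// ltW// addr_gt0.
have n2 : 0 <= (1 - D (theta j)) / (1 + D (theta j)).
  by rewrite divr_ge0 ?subr_ge0 ?dn_le1// ltW// addr_gt0.
rewrite ler_pXn2r// ler_pdivrMr ?addr_gt0// mulrAC ler_pdivlMr ?addr_gt0//.
have : D (theta j) * D u <= D (theta j) by rewrite ler_piMr// ltW.
by lra.
Qed.

(** Finitely many translations by the period [h] bring [u] into the cell around 0. *)
Lemma zolotarev_prod_le u : 0 <= u <= K ->
  P u <= \prod_(j < r) ((1 - D (theta j)) / (1 + D (theta j))) ^+ 2.
Proof.
move=> /andP[u0 uK].
suff H n v : - (h / 2) <= v <= (n%:R + 1 / 2) * h ->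
    P v <= \prod_(j < r) ((1 - D (theta j)) / (1 + D (theta j))) ^+ 2.
  apply: (H r); rewrite mulrDl rh; have := h0; lra.
elim: n v => [|n IH] v.
  by rewrite add0r => ?; apply: zolotarev_prod_near0; lra.
move=> /andP[v1 v2]; have [vh|vh] := leP v (h / 2).
  by apply: zolotarev_prod_near0; rewrite v1.
rewrite -(subrK h v) zolotarev_prod_periodic; apply: IH.
rewrite -natr1 in v2; have := h0; move: v2; rewrite !mulrDl; lra.
Qed.

End ZolotarevProduct.
End Jacobi.

(** * Lower bound for the midpoint sum of the logarithm of (1 + dn) / (1 - dn) *)

Section TrapezoidBound.
Variables (R : realType) (k : R).
Hypothesis hk : 0 < k < 1.
Implicit Types (u v x t s sg : R).

Let k0 : 0 < k. Proof. by case/andP: hk. Qed.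
Let k1 : k < 1. Proof. by case/andP: hk. Qed.
Let K := ellipticF (pi / 2) k.
Let S u := sin (am k u).
Let C u := cos (am k u).
Let D u := jacobi_dn u k.
Let Y x := Num.sqrt (1 - k ^+ 2 * sin x ^+ 2).

Let D2 u : D u ^+ 2 = 1 - k ^+ 2 * S u ^+ 2. Proof. exact: jacobi_dn_sqr. Qed.
Let D0 u : 0 < D u. Proof. exact: jacobi_dn_gt0. Qed.

(** The maximal value of the Zolotarev product has the factors [expR (- 2 * g (theta j))], so an
    upper bound of the product is a lower bound of a sum of values of [g]. *)
Let g u := ln (1 + D u) - ln (1 - D u).

Lemma is_derive_log_dn u : 0 < u <= K -> is_derive u 1 g (- 2 * (C u / S u)).
Proof.
move=> uK; have D1 : D u < 1 := dn_lt1 hk uK; have Du := D0 u; have S0 := sn_gt0 hk uK.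
have dD := is_derive_dn hk u.
rewrite /g; eapply is_derive_eq.
  eapply dfD; [eapply dfln|eapply dfN; eapply dfln].
  - by eapply dfD; [exact: dfcst|exact: dD].
  - by rewrite addr_gt0.
  - by eapply dfD; [exact: dfcst|eapply dfN; exact: dD].
  - by rewrite subr_gt0.
cbv beta; rewrite -/(D u) -/(S u) -/(C u).
have n1 : 1 + D u != 0 by rewrite gt_eqF ?addr_gt0.
have n2 : 1 - D u != 0 by rewrite gt_eqF ?subr_gt0.
have n3 : S u != 0 by rewrite gt_eqF.
have n4 : k != 0 by rewrite gt_eqF.
have E : (1 + D u) * (1 - D u) = k ^+ 2 * S u ^+ 2.
  transitivity (1 - D u ^+ 2); first by ring.
  by rewrite D2; ring.
transitivity (- 2 * k ^+ 2 * S u * C u / ((1 + D u) * (1 - D u))).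
  by field; rewrite n1 n2.
by rewrite E; field; rewrite n3 n4.
Qed.

Lemma cn_sn_decr u v : 0 < u -> u <= v -> v <= K -> C v / S v <= C u / S u.
Proof.
move=> u0 uv vK.
have v0 : 0 < v by exact: lt_le_trans uv.
have uK : u <= K by exact: le_trans vK.
have Su : 0 < S u by apply: sn_gt0 => //; rewrite u0.
have Sv : 0 < S v by apply: sn_gt0 => //; rewrite v0.
have itv x : u <= x <= v -> 0 <= x <= K.
  by move=> /andP[a b]; rewrite (le_trans (ltW u0) a) (le_trans b vK).
have SS : S u <= S v.
  apply: (@is_derive_le R S (fun x => C x * D x)) => // x xuv; first exact: is_derive_sn.
  by rewrite mulr_ge0 ?(ltW (D0 _))//; apply: cn_ge0 => //; exact: itv.
have CC : C v <= C u.
  have := @is_derive_le R (fun x => - C x) (fun x => S x * D x) u v uv.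
  rewrite lerN2; apply=> x xuv.
    by eapply is_derive_eq; [eapply dfN; exact: is_derive_cn|rewrite /S /D; ring].
  by rewrite mulr_ge0 ?(ltW (D0 _))//; apply: sn_ge0 => //; exact: itv.
rewrite ler_pdivrMr// mulrAC ler_pdivlMr//; apply: ler_pM => //.
  by apply: cn_ge0 => //; rewrite (ltW v0).
exact: ltW.
Qed.

(** This is convexity of [g]: its derivative is nondecreasing by [cn_sn_decr], so the tangent at [t]
    passes below the graph at [a]. *)
Lemma log_dn_tangent a t : 0 < a -> a <= t -> t <= K ->
  g t - g a <= - 2 * (C t / S t) * (t - a).
Proof.
move=> a0 at_ tK; set m := - 2 * (C t / S t).
have := @is_derive_le R (fun x => m * x - g x) (fun x => m + 2 * (C x / S x)) a t at_.
move=> H; suff : m * a - g a <= m * t - g t by lra.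
apply: H => x /andP[ax xt].
  have x0K : 0 < x <= K by rewrite (lt_le_trans a0 ax) (le_trans xt tK).
  eapply is_derive_eq.
    by eapply dfD; [eapply dfM; [exact: dfcst|exact: dfid]|eapply dfN; exact: is_derive_log_dn].
  by cbv beta; ring.
by have := cn_sn_decr (lt_le_trans a0 ax) xt tK; rewrite /m; lra.
Qed.

Lemma log_dn_decr a t : 0 < a -> a <= t -> t <= K -> g t <= g a.
Proof.
move=> a0 at_ tK; have := log_dn_tangent a0 at_ tK.
have t0 : 0 < t by exact: lt_le_trans at_.
have Ct : 0 <= C t by apply: cn_ge0 => //; rewrite (ltW t0).
have St : 0 < S t by apply: sn_gt0 => //; rewrite t0.
have : 0 <= (C t / S t) * (t - a) by rewrite mulr_ge0 ?divr_ge0 ?subr_ge0 ?(ltW St).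
by lra.
Qed.

(** With [x = am k t] this reads [ellipticF x k <= tan x], and the derivatives compare because
    [cos y ^+ 2 <= cos y <= Y y]. The endpoint [K], where [tan] has its pole, is treated apart. *)
Lemma mul_cn_le_sn t : 0 <= t <= K -> t * C t <= S t.
Proof.
move=> /andP[t0]; rewrite le_eqVlt => /predU1P[->|tK].
  rewrite /C ellipticFK// cos_pihalf mulr0; apply: sn_ge0 => //.
  by rewrite lexx (ltW (K_gt0 hk)).
set x := am k t; have Fx : ellipticF x k = t by exact: amK.
have x0 : 0 <= x by rewrite -(ellipticF_le hk) ellipticF0// Fx.
have x1 : x < pi / 2 by rewrite -(ellipticF_lt hk) Fx.
have c0 y : 0 <= y <= x -> 0 < cos y.
  move=> /andP[y0 yx]; apply: cos_gt0_pihalf; rewrite (le_lt_trans yx x1) andbT.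
  by apply: lt_le_trans y0; rewrite oppr_lt0 divr_gt0// pi_gt0.
have cx : 0 < cos x by apply: c0; rewrite x0 lexx.
suff : t <= tan x by rewrite /tan ler_pdivlMr.
have := @is_derive_le R (fun y => tan y - ellipticF y k)
  (fun y => (cos y) ^- 2 - legendre_integrand k y) 0 x x0.
rewrite tan0 ellipticF0// subrr Fx subr_ge0; apply=> y yx.
  eapply dfD; first by apply: is_derive_tan; rewrite gt_eqF ?c0.
  by eapply dfN; exact: is_derive_ellipticF.
have cy := c0 _ yx.
rewrite subr_ge0 /legendre_integrand lef_pV2 ?posrE ?exprn_gt0 ?sqrtr_gt0 ?legendre_quad_gt0//.
apply: (@le_trans _ _ (cos y)); first by rewrite expr2 ler_piMr ?(ltW cy)// cos_le1.
rewrite -[leLHS]gtr0_norm// -sqrtr_sqr ler_sqrt ?(ltW (legendre_quad_gt0 hk y))//.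
have : k ^+ 2 * sin y ^+ 2 <= sin y ^+ 2 by rewrite ler_piMl ?sqr_ge0// expr_le1 ?(ltW k0) ?(ltW k1).
by rewrite cos2sin2; lra.
Qed.

Let Y0 x : 0 < Y x. Proof. by rewrite sqrtr_gt0 legendre_quad_gt0. Qed.
Let Y1 x : Y x <= 1.
Proof. by rewrite -[leRHS]sqrtr1 ler_sqrt// gerBl mulr_ge0 ?sqr_ge0. Qed.

Let sgY sg x : -1 < sg < 1 -> 0 < 1 - sg * Y x /\ 0 < 1 + sg * Y x.
Proof.
move=> hsg; have : `|sg * Y x| < 1.
  rewrite normrM (gtr0_norm (Y0 x)).
  by apply: le_lt_trans (_ : `|sg| < 1); rewrite ?ltr_norml// ler_piMr.
by rewrite ltr_norml => /andP[? ?]; split; lra.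
Qed.

Lemma continuous_damped_log sg : -1 < sg < 1 ->
  continuous (fun x => (ln (1 + sg * Y x) - ln (1 - sg * Y x)) / Y x).
Proof.
move=> hsg x; have q := legendre_quad_gt0 hk x; have y0 := Y0 x.
have [y1 y2] := sgY x hsg.
have dY : is_derive x 1 Y ((- k ^+ 2 * sin x * cos x) / Y x).
  rewrite /Y; dsolve => //; rewrite -/(Y x).
  by field; rewrite gt_eqF.
have dsY : is_derive x 1 (fun z => sg * Y z) (sg * ((- k ^+ 2 * sin x * cos x) / Y x)).
  by apply: is_derive_eq (dfM (dfcst sg x) dY) _; cbv beta; ring.
have d1 := dfln (dfD (dfcst 1 x) dsY) y2.
have d2 := dfln (dfD (dfcst 1 x) (dfN dsY)) y1.
exact: is_derive_continuous (dfM (dfD d1 (dfN d2)) (dfV dY (lt0r_neq0 y0))).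
Qed.

(* [g] has a logarithmic singularity at [0]; the factor [sg < 1] removes it and
   yields a smooth minorant whose primitive is computable. *)
Section Damped.
Variable sg : R.
Hypothesis hsg : 0 < sg < 1.
Let sg0 : 0 < sg. Proof. by case/andP: hsg. Qed.
Let sg1 : sg < 1. Proof. by case/andP: hsg. Qed.
Let sgN : -1 < sg < 1.
Proof. by rewrite sg1 andbT (lt_trans _ sg0)// oppr_lt0. Qed.

Let gs u := ln (1 + sg * D u) - ln (1 - sg * D u).
Let hs x := (ln (1 + sg * Y x) - ln (1 - sg * Y x)) / Y x.
Let B u := prim hs (am k u).
Let sY x : 0 < 1 - sg * Y x. Proof. by have [] := sgY x sgN. Qed.

(** The division by [Y] in [hs] is the Jacobian of the change of variable [x = am k u]. *)
Lemma is_derive_damped_prim u : is_derive u 1 B (gs u).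
Proof.
have := dfcomp (is_derive_prim0 (am k u) (continuous_damped_log sgN)) (is_derive_am hk u).
rewrite /hs; rewrite -[Y (am k u)]/(D u) divfK//.
by rewrite gt_eqF.
Qed.

Lemma damped_le u : 0 < u <= K -> gs u <= g u.
Proof.
move=> uK; have D1 : D u < 1 := dn_lt1 hk uK; have Du := D0 u.
have sD : sg * D u <= D u by rewrite ler_piMl ?ltW.
have sD0 : 0 < sg * D u by rewrite mulr_gt0.
have sY1 := sY (am k u); rewrite -[Y (am k u)]/(D u) in sY1.
by apply: lerB; rewrite ler_ln ?posrE; lra.
Qed.

Let is_derive_gs u : is_derive u 1 gs
  (- 2 * sg * k ^+ 2 * S u * C u / (1 - sg ^+ 2 * D u ^+ 2)).
Proof.
have Du := D0 u; have sY1 := sY (am k u); rewrite -[Y (am k u)]/(D u) in sY1.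
have p0 : 0 < 1 + sg * D u by rewrite addr_gt0 ?mulr_gt0.
have dD := dfM (dfcst sg u) (is_derive_dn hk u).
have d1 := dfln (dfD (dfcst 1 u) dD) p0.
have d2 := dfln (dfD (dfcst 1 u) (dfN dD)) sY1.
apply: is_derive_eq (dfD d1 (dfN d2)) _; cbv beta; rewrite -/(D u) -/(S u) -/(C u).
have n1 := lt0r_neq0 p0; have n2 := lt0r_neq0 sY1.
have -> : 1 - sg ^+ 2 * D u ^+ 2 = (1 + sg * D u) * (1 - sg * D u) by ring.
by field; rewrite n1 n2.
Qed.

(** The trapezoidal rule overestimates the integral of the convex [g], which itself dominates [gs].
    The midpoint rule would err in the wrong direction, whence trapezoids with their nodes at the
    midpoints [theta j]. *)
Lemma damped_trapezoid a b : 0 < a -> a <= b -> b <= K ->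
  B b - B a <= (b - a) * (g a + g b) / 2.
Proof.
move=> a0 ab bK.
have := @is_derive_le R (fun t => (t - a) * (g a + g t) / 2 - B t)
  (fun t => (g a + g t) / 2 + (t - a) * (- 2 * (C t / S t)) / 2 - gs t) a b ab.
move=> H; suff : (a - a) * (g a + g a) / 2 - B a <= (b - a) * (g a + g b) / 2 - B b by lra.
apply: H => t /andP[at_ tb].
  have t0K : 0 < t <= K by rewrite (lt_le_trans a0 at_) (le_trans tb bK).
  have d1 := dfM (dfD (dfid t) (dfN (dfcst a t))) (dfD (dfcst (g a) t) (is_derive_log_dn t0K)).
  have d2 := dfD (dfM d1 (dfcst (2^-1) t)) (dfN (is_derive_damped_prim t)).
  by apply: is_derive_eq d2 _; cbv beta; ring.
have t0K : 0 < t <= K by rewrite (lt_le_trans a0 at_) (le_trans tb bK).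
have := log_dn_tangent a0 at_ (le_trans tb bK); have := damped_le t0K.
by lra.
Qed.

(** This handles the half cell next to the singularity, with an excess of [2 * t] uniform in [sg].
    It amounts to a derivative of [gs] at [x] bounded below by [- 2 / x], which follows from
    [x * C x <= S x]. *)
Lemma damped_first t : 0 < t <= K -> B t <= t * (g t + 2).
Proof.
move=> tK; have /andP[t0 t1] := tK.
apply: (@le_trans _ _ (t * (gs t + 2))); last first.
  by rewrite ler_pM2l// lerD2r; exact: damped_le.
have := @is_derive_le R (fun x => x * (gs x + 2) - B x)
  (fun x => 2 + x * (- 2 * sg * k ^+ 2 * S x * C x / (1 - sg ^+ 2 * D x ^+ 2))) 0 t (ltW t0).
rewrite mul0r /B am0// prim0 subrr subr_ge0; apply=> x /andP[x0 xt].
  have d1 := dfM (dfid x) (dfD (is_derive_gs x) (dfcst 2 x)).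
  by apply: is_derive_eq (dfD d1 (dfN (is_derive_damped_prim x))) _; cbv beta; ring.
have xK : 0 <= x <= K by rewrite x0 (le_trans xt t1).
have Sx : 0 <= S x by apply: sn_ge0.
have xC := mul_cn_le_sn xK.
set q := 1 - _; have q0 : 0 < q.
  have -> : q = (1 - sg * D x) * (1 + sg * D x) by rewrite /q; ring.
  have sY1 := sY (am k x); rewrite -[Y (am k x)]/(D x) in sY1.
  by rewrite mulr_gt0// addr_gt0 ?mulr_gt0.
have -> : 2 + x * (- 2 * sg * k ^+ 2 * S x * C x / q) =
    2 * (q - sg * k ^+ 2 * S x * (x * C x)) / q by field; rewrite gt_eqF.
rewrite divr_ge0 ?(ltW q0)// mulr_ge0// subr_ge0.
apply: (@le_trans _ _ (sg * k ^+ 2 * S x * S x)).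
  by rewrite ler_wpM2l// !mulr_ge0 ?(ltW sg0) ?sqr_ge0 ?(ltW k0).
have z1 : k ^+ 2 * S x ^+ 2 <= 1 by have := D2 x; have := sqr_ge0 (D x); lra.
rewrite /q D2; have -> : sg * k ^+ 2 * S x * S x = sg * (k ^+ 2 * S x ^+ 2) by ring.
move: z1; set z := k ^+ 2 * _ => z1.
have : 0 <= (1 - sg) * (1 + sg - sg * z).
  rewrite mulr_ge0 ?subr_ge0 ?(ltW sg1)//.
  have : sg * z <= sg by rewrite ler_piMr// ltW.
  by lra.
by lra.
Qed.

Lemma damped_last a b : 0 < a -> a <= b -> b <= K -> B b - B a <= (b - a) * g a.
Proof.
move=> a0 ab bK.
have := @is_derive_le R (fun t => (t - a) * g a - B t) (fun t => g a - gs t) a b ab.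
move=> H; suff : (a - a) * g a - B a <= (b - a) * g a - B b by lra.
apply: H => t /andP[at_ tb].
  have d1 := dfM (dfD (dfid t) (dfN (dfcst a t))) (dfcst (g a) t).
  by apply: is_derive_eq (dfD d1 (dfN (is_derive_damped_prim t))) _; cbv beta; ring.
have t0K : 0 < t <= K by rewrite (lt_le_trans a0 at_) (le_trans tb bK).
have := damped_le t0K; have := log_dn_decr a0 at_ (le_trans tb bK); lra.
Qed.

Lemma damped_sum r' (h := K / r'.+1%:R) (theta := fun j : nat => (j%:R + 1 / 2) * h) :
  prim hs (pi / 2) <= h * (\sum_(j < r'.+1) g (theta j)) + h.
Proof.
have h0 : 0 < h by rewrite divr_gt0 ?(K_gt0 hk) ?ltr0n.
have rh : r'.+1%:R * h = K by rewrite /h mulrCA divff ?mulr1 ?pnatr_eq0.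
have th0 j : 0 < theta j.
  by rewrite mulr_gt0// ltr_wpDl ?ler0n.
have thK j : (j <= r')%N -> theta j + h / 2 <= K.
  move=> jr; rewrite -rh /theta -[r'.+1%:R]natr1.
  have : j%:R <= r'%:R :> R by rewrite ler_nat.
  by move=> /(ler_wpM2r (ltW h0)); lra.
have thS j : theta j.+1 = theta j + h by rewrite /theta -[j.+1%:R]natr1; ring.
(* Up to [theta n] the node [theta n] has received only the left half of its weight [h], hence the
   subtracted term. The last [h] is the excess of the first half cell. *)
have H n : (n <= r')%N ->
    B (theta n) <= h * (\sum_(j < n.+1) g (theta j)) - h / 2 * g (theta n) + h.
  elim: n => [_|n IH nr].
    rewrite big_ord_recl big_ord0 addr0.
    have t0K : 0 < theta 0 <= K by rewrite th0/=; have := thK 0 (leq0n _); lra.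
    apply: le_trans (damped_first t0K) _.
    by rewrite /theta; lra.
  rewrite big_ord_recr/=; have {}IH := IH (ltnW nr).
  have := @damped_trapezoid (theta n) (theta n.+1) (th0 n).
  have := thK _ nr; rewrite !thS => K1 T.
  have := T _ _; rewrite lerDl (ltW h0) => /(_ isT).
  have -> : theta n + h - theta n = h by ring.
  have K2 : theta n + h <= K by lra.
  move=> /(_ K2); rewrite mulrDr; lra.
have := damped_last (th0 r') _ (lexx K).
have := thK _ (leqnn r'); have := H _ (leqnn r').
have BK : B K = prim hs (pi / 2) by rewrite /B ellipticFK.
have Kr : K = theta r' + h / 2 by rewrite -rh /theta -[r'.+1%:R]natr1; field.
rewrite BK => H1 H2 H3.
have /H3 : theta r' <= K by lra.
have -> : K - theta r' = h / 2 by rewrite {1}Kr; ring.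
by lra.
Qed.

End Damped.

(* For [sg = sin s], differentiating the integral of the minorant in [s] gives an
   elementary integral in [x], so that the former is an incomplete elliptic integral
   of complementary modulus. *)
Section AngleIntegral.
Let f s x := (ln (1 + sin s * Y x) - ln (1 - sin s * Y x)) / Y x.
Let df s x := 2 * cos s / (1 - sin s ^+ 2 * (1 - k ^+ 2 * sin x ^+ 2)).
Let k' := Num.sqrt (1 - k ^+ 2).

Let sin_itv s : 0 < cos s -> -1 < sin s < 1.
Proof.
move=> c0; rewrite -ltr_norml -(@ltr_pXn2r _ 2)// ?nnegrE// real_normK ?num_real//.
by rewrite sin2cos2 expr1n ltrBlDr ltrDl exprn_gt0.
Qed.

Let den_gt0 s x : 0 < cos s -> 0 < 1 - sin s ^+ 2 * (1 - k ^+ 2 * sin x ^+ 2).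
Proof.
move=> c0; have [a b] := sgY x (sin_itv c0).
have -> : 1 - k ^+ 2 * sin x ^+ 2 = Y x ^+ 2 by rewrite sqr_sqrtr// ltW// legendre_quad_gt0.
by rewrite -exprMn -[X in X - _](expr1n _ 2) subr_sqr mulr_gt0.
Qed.

Let is_derive_f s x : 0 < cos s -> is_derive s 1 (f^~ x) (df s x).
Proof.
move=> c0; have [a b] := sgY x (sin_itv c0); have y0 := Y0 x.
have dsY : is_derive s 1 (fun z => sin z * Y x) (cos s * Y x).
  by apply: is_derive_eq (dfM (dfsin (dfid s)) (dfcst (Y x) s)) _; cbv beta; ring.
have d1 := dfln (dfD (dfcst 1 s) dsY) b.
have d2 := dfln (dfD (dfcst 1 s) (dfN dsY)) a.
apply: is_derive_eq (dfM (dfD d1 (dfN d2)) (dfcst (Y x)^-1 s)) _; cbv beta.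
rewrite /df.
have -> : 1 - k ^+ 2 * sin x ^+ 2 = Y x ^+ 2 by rewrite sqr_sqrtr// ltW// legendre_quad_gt0.
have -> : 1 - sin s ^+ 2 * Y x ^+ 2 = (1 + sin s * Y x) * (1 - sin s * Y x) by ring.
by field; rewrite !gt_eqF.
Qed.

Let continuous_df s : 0 < cos s -> continuous (df s).
Proof.
move=> c0 x; have q := den_gt0 x c0.
eapply is_derive_continuous; unfold df; repeat dstep.
exact: lt0r_neq0.
Qed.

Let k'2 : k' ^+ 2 = 1 - k ^+ 2.
Proof. by rewrite sqr_sqrtr// subr_ge0 expr_le1 ?(ltW k0) ?(ltW k1). Qed.

Let Rintegral_df s : 0 < cos s ->
  \int[lebesgue_measure]_(x in `[0, pi / 2]) df s x = pi * legendre_integrand k' s.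
Proof.
move=> c0; set a := cos s; pose b := Num.sqrt (1 - k' ^+ 2 * sin s ^+ 2).
have s1 : sin s ^+ 2 <= 1 by rewrite sin2cos2 gerBl sqr_ge0.
have q0 : 0 < 1 - k' ^+ 2 * sin s ^+ 2.
  have k2 : 0 < k ^+ 2 by rewrite exprn_gt0.
  have : k' ^+ 2 * sin s ^+ 2 <= k' ^+ 2 by rewrite ler_piMr ?sqr_ge0.
  by rewrite {2}k'2; lra.
have b0 : 0 < b by rewrite sqrtr_gt0.
have p0 : (0 : R) <= pi / 2 by rewrite divr_ge0// pi_ge0.
(* The antiderivative is a continuous form of [2 / b * atan (b / a * tan y)], which grows by
   [pi / b] over [[0, pi / 2]]. *)
have dA x : is_derive x 1 (fun y => 2 / b * (landen_phase a b y - y)) (df s x).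
  have d := dfM (dfcst (2 / b) x) (dfD (is_derive_landen_phase x c0 b0) (dfN (dfid x))).
  apply: is_derive_eq d _; cbv beta.
  have := agm_quad_gt0 x c0 b0; have := den_gt0 x c0.
  have -> : 1 - sin s ^+ 2 * (1 - k ^+ 2 * sin x ^+ 2) =
      a ^+ 2 * cos x ^+ 2 + b ^+ 2 * sin x ^+ 2.
    by rewrite sqr_sqrtr ?(ltW q0)// k'2 /a !cos2sin2; ring.
  rewrite /df (_ : 1 - sin s ^+ 2 * (1 - k ^+ 2 * sin x ^+ 2) =
      a ^+ 2 * cos x ^+ 2 + b ^+ 2 * sin x ^+ 2); last first.
    by rewrite sqr_sqrtr ?(ltW q0)// k'2 /a !cos2sin2; ring.
  move=> q1 _; have n1 := lt0r_neq0 q1; have n2 := lt0r_neq0 b0.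
  have E : a * cos x ^+ 2 + b * sin x ^+ 2 = a * cos x ^+ 2 + b * sin x ^+ 2 by [].
  have cs := cos2Dsin2 x; rewrite -/a; clearbody b a.
  set Q := a ^+ 2 * cos x ^+ 2 + b ^+ 2 * sin x ^+ 2 in n1 q1 *.
  have -> : (a + b) * (a * cos x ^+ 2 + b * sin x ^+ 2) = Q + a * b * (cos x ^+ 2 + sin x ^+ 2).
    by rewrite /Q; ring.
  by rewrite cs; clearbody Q; field; rewrite n1 n2.
rewrite (Rintegral_FTC p0 (continuous_df c0) dA) landen_phase0 landen_phase_pihalf.
rewrite /legendre_integrand -/b; have n2 := lt0r_neq0 b0; clearbody b.
by field.
Qed.

Lemma is_derive_angle_integral s : - (pi / 2) < s < pi / 2 ->
  is_derive s 1 (fun s => \int[lebesgue_measure]_(x in `[0, pi / 2]) f s x)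
    (pi * legendre_integrand k' s).
Proof.
(* On the neighbourhood []-v, v[] of [s] the cosine stays above [cos v > 0], so that the constant
   [2 / cos v] dominates the derivative under the integral. *)
move=> /andP[s1 s2]; pose v := (`|s| + pi / 2) / 2.
have sn : `|s| < pi / 2 by rewrite ltr_norml s1.
have v2 : v < pi / 2 by rewrite /v; lra.
have v0 : 0 <= v by have := normr_ge0 s; have := pi_ge0 R; rewrite /v; lra.
have cv : 0 < cos v by apply: cos_gt0_pihalf; lra.
have cI x : x \in `]-v, v[ -> cos v <= cos x.
  rewrite in_itv/= => /andP[x1 x2].
  have -> : cos x = cos `|x|.
    by have [h|h] := leP 0 x; [rewrite ger0_norm|rewrite ltr0_norm// cosN].
  have xv : `|x| <= v by rewrite ler_norml; lra.
  have := @is_derive_le R (fun x => - cos x) (fun x => sin x) `|x| v xv.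
  rewrite lerN2; apply=> y /andP[y1 y2].
    by apply: is_derive_eq (dfN (dfcos (dfid y))) _; cbv beta; ring.
  by apply: sin_ge0_pi; rewrite (le_trans _ y1)//=; have := pi_ge0 R; lra.
have cI0 x : x \in `]-v, v[ -> 0 < cos x by move=> /cI; exact: lt_le_trans.
have sI : s \in `]-v, v[ by rewrite in_itv/= -ltr_norml /v; lra.
pose G (x : R) := 2 / cos v.
have G0 x : 0 <= G x by rewrite divr_ge0 ?(ltW cv).
have mB : measurable `[0, pi / 2 : R] by [].
have int_cont (h : R -> R) : continuous h ->
    lebesgue_measure.-integrable `[0, pi / 2 : R] (EFin \o h).
  move=> ch; apply: continuous_compact_integrable; first exact: segment_compact.
  exact: continuous_subspaceT.
have intf x : [set` `]-v, v[] x -> lebesgue_measure.-integrable `[0, pi / 2] (EFin \o f x).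
  move=> /cI0 c0; apply: int_cont; exact: continuous_damped_log (sin_itv c0).
have derf x y : [set` `]-v, v[] x -> [set` `[0, pi / 2 : R]] y -> derivable (f^~ y) x 1.
  by move=> /cI0 c0 _; have [] := is_derive_f y c0.
have intG : lebesgue_measure.-integrable `[0, pi / 2] (EFin \o G).
  by apply: int_cont => x; exact: cvg_cst.
have pE x y : [set` `]-v, v[] x -> partial1of2 f x y = df x y.
  by move=> /cI0 c0; rewrite partial1of2E; have [_ ->] := is_derive_f y c0.
have Gub x y : [set` `]-v, v[] x -> [set` `[0, pi / 2 : R]] y -> `|partial1of2 f x y| <= G y.
  move=> xI _; rewrite pE//; have c0 := cI0 _ xI; have q := den_gt0 y c0.
  rewrite /df ger0_norm ?divr_ge0 ?mulr_ge0 ?(ltW c0) ?(ltW q)//.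
  apply: (@le_trans _ _ (2 / cos x)); last first.
    by rewrite /G ler_pM2l// lef_pV2 ?posrE//; exact: cI.
  rewrite ler_pdivrMr// mulrAC ler_pdivlMr// -mulrA ler_pM2l// -expr2.
  rewrite cos2sin2 lerB// ler_piMr ?sqr_ge0// gerBl mulr_ge0 ?sqr_ge0//.
have Dd := @derivable_under_integral R _ _ lebesgue_measure f _ mB s (- v) v sI intf derf G G0 intG Gub.
have Ed := @differentiation_under_integral R _ _ lebesgue_measure f _ mB s (- v) v sI intf derf G G0 intG Gub.
apply: DeriveDef => //; rewrite -derive1E Ed -Rintegral_df ?cI0//.
by apply: eq_Rintegral => x _; rewrite pE.
Qed.

Lemma damped_integralE s : 0 <= s < pi / 2 ->
  prim (f s) (pi / 2) = pi * prim (legendre_integrand k') s.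
Proof.
move=> /andP[s0 s2].
have k'0 : 0 < k' by rewrite sqrtr_gt0 subr_gt0 exprn_ilt1// ltW.
have k'1 : k' < 1.
  by rewrite -[ltRHS]sqrtr1 ltr_sqrt// gtrBl exprn_gt0.
have hk' : 0 < k' < 1 by rewrite k'0.
have p0 : (0 : R) <= pi / 2 by rewrite divr_ge0// pi_ge0.
pose Phi s := \int[lebesgue_measure]_(x in `[0, pi / 2]) f s x.
have PhiE t : 0 <= t <= s -> Phi t = prim (f t) (pi / 2).
  move=> /andP[t0 ts]; have c0 : 0 < cos t.
    by apply: cos_gt0_pihalf; apply/andP; split; lra.
  have cf := continuous_damped_log (sin_itv c0).
  by rewrite /Phi (Rintegral_FTC p0 cf (fun x => is_derive_prim0 x cf)) prim0 subr0.
rewrite -PhiE ?s0 ?lexx//.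
have dPhi t : 0 <= t <= s -> is_derive t 1 Phi (pi * legendre_integrand k' t).
  by move=> /andP[t0 ts]; apply: is_derive_angle_integral; apply/andP; split; lra.
have cl : continuous (legendre_integrand k') by exact: continuous_legendre.
have dQ t : is_derive t 1 (fun t => pi * prim (legendre_integrand k') t) (pi * legendre_integrand k' t).
  by apply: is_derive_eq (dfM (dfcst pi t) (is_derive_prim0 t cl)) _; cbv beta; ring.
have Phi0 : Phi 0 = 0.
  rewrite /Phi; under eq_Rintegral do rewrite /f sin0 mul0r addr0 subr0 subrr mul0r.
  by rewrite Rintegral_cst// mul0r.
(* The derivatives are known to agree on [[0, s]] only, so the equality is obtained from two
   monotonicity arguments. *)
apply/eqP; rewrite eq_le; apply/andP; split.
- have := @is_derive_le R (fun t => pi * prim (legendre_integrand k') t - Phi t) (fun=> 0) 0 s s0.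
  rewrite prim0 mulr0 Phi0 subrr subr_ge0; apply=> // t ts.
  by apply: is_derive_eq (dfD (dQ t) (dfN (dPhi t ts))) _; rewrite subrr.
- have := @is_derive_le R (fun t => Phi t - pi * prim (legendre_integrand k') t) (fun=> 0) 0 s s0.
  rewrite prim0 mulr0 Phi0 subrr subr_ge0; apply=> // t ts.
  by apply: is_derive_eq (dfD (dPhi t ts) (dfN (dQ t))) _; rewrite subrr.
Qed.

End AngleIntegral.

(** The right-hand side of [damped_sum] does not depend on the damping [sg = sin s], which is
    removed by letting [s] tend to [pi / 2] from the left. *)
Lemma sum_log_dn_ge r' (h := K / r'.+1%:R) :
  pi * ellipticF (pi / 2) (Num.sqrt (1 - k ^+ 2)) <=
  h * (\sum_(j < r'.+1) g ((j%:R + 1 / 2) * h)) + h.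
Proof.
set k' := Num.sqrt _; set M := (X in _ <= X).
have k'0 : 0 < k' by rewrite sqrtr_gt0 subr_gt0 exprn_ilt1// ltW.
have k'1 : k' < 1 by rewrite -[ltRHS]sqrtr1 ltr_sqrt// gtrBl exprn_gt0.
have hk' : 0 < k' < 1 by rewrite k'0.
have p0 : (0 : R) < pi / 2 by rewrite divr_gt0// pi_gt0.
have H s : 0 < s < pi / 2 -> pi * ellipticF s k' <= M.
  move=> /andP[s0 s2].
  have c0 : 0 < cos s by apply: cos_gt0_pihalf; apply/andP; split; lra.
  have sg01 : 0 < sin s < 1.
    rewrite sin_gt0_pihalf ?s0//=; have := cos2Dsin2 s.
    have : 0 < cos s ^+ 2 by rewrite exprn_gt0.
    move=> c2 e; rewrite -(@ltr_pXn2r _ 2)// ?nnegrE ?(ltW (sin_gt0_pihalf _)) ?s0//.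
    by rewrite expr1n; lra.
  rewrite ellipticFE -damped_integralE ?(ltW s0)//.
  exact: damped_sum.
have cF : pi * ellipticF s k' @[s --> (pi / 2)^'-] --> pi * ellipticF (pi / 2) k'.
  by apply: cvgMr; apply: cvg_at_left_filter; exact: continuous_ellipticF.
apply: (cvgr_to_le cF); near=> s; apply: H; apply/andP; split; near: s.
  exact: nbhs_left_gt.
exact: nbhs_left_lt.
Unshelve. all: by end_near. Qed.

End TrapezoidBound.

(** With the index [r - j] the argument of dn becomes [(j + 1 / 2) * K / r]. The summand 2 of the
    exponent stems from the extra [h] in [sum_log_dn_ge]: divided by [h] it is 1, and the squared
    ratios double it. *)
Lemma zolotarev_bound (R : realType) (delta x : R) (r : nat) :
  0 < delta < 1 -> (0 < r)%N -> delta <= x <= 1 ->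
  \prod_(j < r) ((x - zolotarev_point delta r (r - j)) /
                 (x + zolotarev_point delta r (r - j))) ^+ 2 <=
  expR (2 - 2 * zolotarev_rate delta * r%:R).
Proof.
move=> hd; have /andP[d0 d1] := hd; case: r => // r' _ dx.
set k := Num.sqrt (1 - delta ^+ 2).
have d2 : 0 < delta ^+ 2 by rewrite exprn_gt0.
have d21 : delta ^+ 2 < 1 by rewrite exprn_ilt1// ltW.
have k0 : 0 < k by rewrite sqrtr_gt0 subr_gt0.
have k1 : k < 1 by rewrite -[ltRHS]sqrtr1 ltr_sqrt// gtrBl.
have hk : 0 < k < 1 by rewrite k0.
have k2 : k ^+ 2 = 1 - delta ^+ 2 by rewrite sqr_sqrtr// subr_ge0 ltW.
have k' : Num.sqrt (1 - k ^+ 2) = delta by rewrite k2 subKr sqrtr_sqr gtr0_norm.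
set K := ellipticF (pi / 2) k.
have K0 : 0 < K by exact: K_gt0.
set h := K / r'.+1%:R.
have h0 : 0 < h by rewrite divr_gt0// ltr0n.
pose theta (j : nat) := (j%:R + 1 / 2) * h.
have zE (j : 'I_r'.+1) :
    zolotarev_point delta r'.+1 (r'.+1 - j) = jacobi_dn (theta j) k.
  rewrite /zolotarev_point -/k ellipticKF// -/K; congr jacobi_dn.
  rewrite subKn ?(ltnW (ltn_ord j))// /theta /h natrD !natrM.
  have n0 : r'.+1%:R != 0 :> R by rewrite pnatr_eq0.
  by move: n0; set n := r'.+1%:R; clearbody n => n0; field.
rewrite -k' in dx; have [u uK <-] := dn_surj hk dx.
pose D (v : R) := jacobi_dn v k.
have Dth (j : 'I_r'.+1) : D (theta j) < 1 /\ 0 < D (theta j).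
  split; last exact: jacobi_dn_gt0.
  apply: (dn_lt1 hk); apply/andP; split; first by rewrite mulr_gt0// ltr_wpDl ?ler0n.
  have rh : r'.+1%:R * h = K by rewrite /h mulrCA divff ?mulr1 ?pnatr_eq0.
  rewrite -/K -rh ler_pM2r//; have : (j.+1)%:R <= r'.+1%:R :> R by rewrite ler_nat.
  by rewrite -[j.+1%:R]natr1; lra.
under eq_bigr do rewrite zE.
apply: le_trans (zolotarev_prod_le hk r' uK) _.
have E (j : 'I_r'.+1) : ((1 - D (theta j)) / (1 + D (theta j))) ^+ 2 =
    expR (- 2 * (ln (1 + D (theta j)) - ln (1 - D (theta j)))).
  have [D1 D0] := Dth j.
  have -> : - 2 * (ln (1 + D (theta j)) - ln (1 - D (theta j))) =
      (ln (1 - D (theta j)) - ln (1 + D (theta j))) * 2%:R by ring.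
  by rewrite expRM_natr expRB !lnK// posrE ?subr_gt0 ?addr_gt0.
rewrite (eq_bigr _ (fun j _ => E j)) -expR_sum ler_expR -mulr_sumr.
have /= := sum_log_dn_ge hk r'; rewrite -/K -/h k'.
have d01 : 0 <= delta < 1 by rewrite (ltW d0).
have k01 : 0 <= k < 1 by rewrite (ltW k0).
have KE : K = agm_int 1 delta by rewrite -k' -(ellipticKE k01) ellipticKF.
rewrite zolotarev_rateE// -(ellipticKE d01) (ellipticKF delta) -KE.
set G := \sum_(j < _) _; set L := ellipticF _ delta => H.
have n0 : (0 : R) < r'.+1%:R by rewrite ltr0n.
have : pi * L / K * r'.+1%:R <= G + 1.
  rewrite -(ler_pM2r h0).
  have -> : pi * L / K * r'.+1%:R * h = pi * L.
    by rewrite /h; field; rewrite !gt_eqF.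
  by apply: le_trans H _; rewrite [(_ + 1) * h]mulrC mulrDr mulr1.
by lra.
Qed.

Lemma is_derive_bigsum (R : realType) (I : Type) (r : seq I) (f : I -> R -> R)
    (d : I -> R) (x : R) : (forall i, is_derive x 1 (f i) (d i)) ->
  is_derive x 1 (fun y => \sum_(i <- r) f i y) (\sum_(i <- r) d i).
Proof.
move=> fd; elim: r => [|i r IH].
  by rewrite big_nil; under eq_fun do rewrite big_nil; exact: dfcst.
by rewrite big_cons; under eq_fun do rewrite big_cons; exact: dfD.
Qed.

(** * Integral representation of powers and Hilbert interpolation *)

Section PowerKernel.
Variables (R : realType) (th : R).
Hypothesis hth : 0 < th < 1.
Implicit Types (z l : R).

Let th0 : 0 < th. Proof. by case/andP: hth. Qed.
Let th1 : th < 1. Proof. by case/andP: hth. Qed.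

(** In the variable [z = ln tau], an integral over [tau > 0] is the limit of increments of a
    primitive over [[-z, z]]. The two exponential majorants of [al] make these increments
    bounded. *)
Let al z := expR ((1 - th) * z) / (1 + expR z).
Let A := prim al.

Let al_den z : 0 < 1 + expR z. Proof. by rewrite addr_gt0 ?expR_gt0. Qed.

Let dexpR (c z : R) : is_derive z 1 (fun y => expR (c * y)) (c * expR (c * z)).
Proof.
apply: is_derive_eq (dfcomp (is_derive_expR (c * z)) (dfM (dfcst c z) (dfid z))) _.
by cbv beta; ring.
Qed.

Let continuous_al : continuous al.
Proof.
move=> z; have d2 : is_derive z 1 (fun y => 1 + expR y) (0 + expR z).
  exact: dfD (dfcst 1 z) (is_derive_expR z).
exact: is_derive_continuous (dfM (dexpR (1 - th) z) (dfV d2 (lt0r_neq0 (al_den z)))).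
Qed.

Let dA z : is_derive z 1 A (al z). Proof. exact: is_derive_prim0. Qed.

Let al_gt0 z : 0 < al z. Proof. by rewrite divr_gt0 ?expR_gt0. Qed.

Let A_ndecr : nondecreasing_fun A.
Proof. by move=> x y xy; apply: (is_derive_le xy (fun z _ => dA z)) => z _; exact: ltW. Qed.

Let al_le1 z : al z <= expR ((1 - th) * z).
Proof.
rewrite ler_pdivrMr// ler_peMr ?expR_ge0//.
by have := expR_ge0 z; lra.
Qed.

Let al_le2 z : al z <= expR (- th * z).
Proof.
rewrite ler_pdivrMr// mulrDr mulr1 -expRD.
have -> : - th * z + z = (1 - th) * z by ring.
by rewrite lerDr expR_ge0.
Qed.

Let A_ub z : A z <= th^-1.
Proof.
have [z0|z0] := leP z 0.
  apply: (@le_trans _ _ (A 0)); first exact: A_ndecr.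
  by rewrite /A prim0 invr_ge0 ltW.
have := @is_derive_le R (fun y => - th^-1 * expR (- th * y) - A y)
  (fun y => expR (- th * y) - al y) 0 z (ltW z0).
rewrite /A prim0 mulr0 expR0 -/A => H.
have : - th^-1 * 1 - 0 <= - th^-1 * expR (- th * z) - A z.
  apply: H => y _; last by rewrite subr_ge0.
  apply: is_derive_eq (dfD (dfM (dfcst (- th^-1) y) (dexpR (- th) y)) (dfN (dA y))) _.
  by cbv beta; field; rewrite gt_eqF.
have : 0 <= th^-1 * expR (- th * z) by rewrite mulr_ge0 ?expR_ge0// invr_ge0 ltW.
by lra.
Qed.

Let A_lb z : - (1 - th)^-1 <= A z.
Proof.
have t1 : 0 < 1 - th by rewrite subr_gt0.
have [z0|z0] := leP 0 z.
  apply: (@le_trans _ _ (A 0)); last exact: A_ndecr.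
  by rewrite /A prim0 oppr_le0 invr_ge0 ltW.
have := @is_derive_le R (fun y => (1 - th)^-1 * expR ((1 - th) * y) - A y)
  (fun y => expR ((1 - th) * y) - al y) z 0 (ltW z0).
rewrite /A prim0 mulr0 expR0 -/A => H.
have : (1 - th)^-1 * expR ((1 - th) * z) - A z <= (1 - th)^-1 * 1 - 0.
  apply: H => y _; last by rewrite subr_ge0.
  apply: is_derive_eq (dfD (dfM (dfcst (1 - th)^-1 y) (dexpR (1 - th) y)) (dfN (dA y))) _.
  by cbv beta; field; rewrite gt_eqF.
have : 0 <= (1 - th)^-1 * expR ((1 - th) * z) by rewrite mulr_ge0 ?expR_ge0// invr_ge0 ltW.
by lra.
Qed.

Let Ap := sup (range A).
Let Am := sup (range (fun z => - A (- z))).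

Let cvgAp : A z @[z --> +oo] --> Ap.
Proof.
apply: nondecreasing_cvgr => //; exists th^-1 => _ [z _ <-]; exact: A_ub.
Qed.

Let cvgAm : - A (- z) @[z --> +oo] --> Am.
Proof.
apply: nondecreasing_cvgr; first by move=> x y xy; rewrite lerN2 A_ndecr// lerN2.
by exists (1 - th)^-1 => _ [z _ <-]; rewrite lerNl A_lb.
Qed.

(* The integral of [tau^(-th) / (1 + tau)] over [tau > 0], with [tau = exp z]. *)
Definition power_mass := Ap + Am.

Lemma power_mass_gt0 : 0 < power_mass.
Proof.
have h : A 0 < A 1.
  have [c _] := MVT ltr01 (fun x _ => dA x) (is_derive_within (fun x _ => dA x)).
  by rewrite subr0 mulr1 => E; rewrite -subr_gt0 E.
have a1 : A 1 <= Ap.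
  apply: ub_le_sup; last by exists 1.
  by exists th^-1 => _ [z _ <-]; exact: A_ub.
have a0 : - A 0 <= Am.
  apply: ub_le_sup; last by exists 0 => //; rewrite oppr0.
  by exists (1 - th)^-1 => _ [z _ <-]; rewrite lerNl A_lb.
by rewrite /power_mass; lra.
Qed.

Let cvg_mass l : A (z + l) - A (- z + l) @[z --> +oo] --> power_mass.
Proof.
apply: cvgD; first exact: cvg_comp (cvg_addrr l) cvgAp.
have -> : (fun z => - A (- z + l)) = (fun z => - A (- z)) \o (fun z => z + (- l)).
  by apply/funext => z /=; congr (- A _); ring.
exact: cvg_comp (cvg_addrr (- l)) cvgAm.
Qed.

Variables (I : finType) (c x : I -> R).
Hypothesis x0 : forall i, 0 < x i.

Let Dl tau := \sum_i c i * (tau * x i / (1 + tau * x i)).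
(** Scaling [tau] by [x i] shifts [z] by [ln (x i)], so every summand sweeps the same total mass.
    The coefficients may have any sign, which lets a difference of two forms be a single sum. *)
Let Psi z := \sum_i (c i * x i `^ th) * A (z + ln (x i)).

Let is_derive_Psi z : is_derive z 1 Psi (expR (- th * z) * Dl (expR z)).
Proof.
have d i : is_derive z 1 (fun z => (c i * x i `^ th) * A (z + ln (x i)))
    (expR (- th * z) * (c i * (expR z * x i / (1 + expR z * x i)))).
  have d1 := @dfcomp R A (fun z => z + ln (x i)) z _ _ (dA (z + ln (x i))) (dfD (dfid z) (dfcst (ln (x i)) z)).
  apply: is_derive_eq (dfM (dfcst (c i * x i `^ th) z) d1) _; cbv beta.
  have xE : expR (ln (x i)) = x i by rewrite lnK ?posrE.
  have q0 : 1 + expR z * x i != 0 by rewrite gt_eqF// addr_gt0// mulr_gt0// expR_gt0.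
  rewrite /al expRD xE mulr0 addr0 addr0 mulr1.
  have -> : expR ((1 - th) * (z + ln (x i))) =
      expR (- th * z) * expR z * x i * expR (- (th * ln (x i))).
    set li := ln (x i) in xE *; rewrite -xE -!expRD; congr expR; ring.
  rewrite expRN /powR gt_eqF//.
  have := expR_eq0 (th * ln (x i)); set e := expR _ => /negbT e0.
  by field; rewrite q0 e0.
by apply: is_derive_eq (is_derive_bigsum _ d) _; rewrite mulr_sumr.
Qed.

Let cvg_Psi : Psi z - Psi (- z) @[z --> +oo] --> power_mass * \sum_i c i * x i `^ th.
Proof.
have -> : (fun z => Psi z - Psi (- z)) =
  (fun z => \sum_i (c i * x i `^ th) * (A (z + ln (x i)) - A (- z + ln (x i)))).
  by apply/funext => z; rewrite /Psi -sumrB; apply: eq_bigr => i _; ring.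
rewrite mulr_sumr; apply: cvg_bigsum => i.
by rewrite [power_mass * _]mulrC; apply: cvgMr; exact: cvg_mass.
Qed.

Lemma power_sum_ge0 : (forall tau, 0 < tau -> 0 <= Dl tau) ->
  0 <= \sum_i c i * x i `^ th.
Proof.
move=> D0; rewrite -(pmulr_rge0 _ power_mass_gt0).
apply: (cvgr_to_ge cvg_Psi); near=> z; rewrite subr_ge0.
apply: (is_derive_le _ (fun y _ => is_derive_Psi y)).
  have : 0 <= z by near: z; apply: nbhs_pinfty_ge; exact: num_real.
  by lra.
by move=> y _; rewrite mulr_ge0 ?expR_ge0// D0// expR_gt0.
Unshelve. all: by end_near. Qed.

(** The integral against [tau^(-th-1)] is cut at [tau = 1]: the part near 0 gives [K1 / (p - th)]
    and the part at infinity gives [K2 / th]. *)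
Lemma power_sum_le p K1 K2 : th < p -> 0 <= K1 -> 0 <= K2 ->
  (forall tau, 0 < tau <= 1 -> Dl tau <= K1 * tau `^ p) ->
  (forall tau, 1 <= tau -> Dl tau <= K2) ->
  \sum_i c i * x i `^ th <= (K1 / (p - th) + K2 / th) / power_mass.
Proof.
move=> thp K10 K20 H1 H2; rewrite ler_pdivlMr ?power_mass_gt0// mulrC.
have pth : 0 < p - th by rewrite subr_gt0.
apply: (cvgr_to_le cvg_Psi); near=> z.
have z0 : 0 <= z by near: z; apply: nbhs_pinfty_ge; exact: num_real.
have h1 : Psi 0 - Psi (- z) <= K1 / (p - th).
  have nz0 : - z <= 0 by rewrite oppr_le0.
  have := @is_derive_le R (fun y => K1 / (p - th) * expR ((p - th) * y) - Psi y)
    (fun y => K1 * expR ((p - th) * y) - expR (- th * y) * Dl (expR y)) (- z) 0 nz0.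
  rewrite mulr0 expR0 => H.
  have : K1 / (p - th) * expR ((p - th) * - z) - Psi (- z) <= K1 / (p - th) * 1 - Psi 0.
    apply: H => y /andP[_ y0].
      apply: is_derive_eq (dfD (dfM (dfcst (K1 / (p - th)) y) (dexpR (p - th) y)) (dfN (is_derive_Psi y))) _.
      by cbv beta; field; rewrite gt_eqF.
    rewrite subr_ge0; have := H1 (expR y).
    rewrite expR_gt0 expR_le1 y0 => /(_ isT) /(ler_wpM2l (expR_ge0 (- th * y))).
    move=> /le_trans; apply.
    rewrite -expRM mulrCA -expRD (_ : - th * y + y * p = (p - th) * y) //; ring.
  have : 0 <= K1 / (p - th) * expR ((p - th) * - z).
    by rewrite mulr_ge0 ?expR_ge0// divr_ge0// ltW.
  by lra.
have h2 : Psi z - Psi 0 <= K2 / th.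
  have := @is_derive_le R (fun y => - (K2 / th) * expR (- th * y) - Psi y)
    (fun y => K2 * expR (- th * y) - expR (- th * y) * Dl (expR y)) 0 z z0.
  rewrite mulr0 expR0 => H.
  have : - (K2 / th) * 1 - Psi 0 <= - (K2 / th) * expR (- th * z) - Psi z.
    apply: H => y /andP[y0 _].
      apply: is_derive_eq (dfD (dfM (dfcst (- (K2 / th)) y) (dexpR (- th) y)) (dfN (is_derive_Psi y))) _.
      by cbv beta; field; rewrite gt_eqF.
    rewrite subr_ge0 mulrC ler_wpM2r ?expR_ge0//; apply: H2.
    by rewrite -expR0 ler_expR.
  have : 0 <= (K2 / th) * expR (- th * z).
    by rewrite mulr_ge0 ?expR_ge0// divr_ge0// ltW.
  by lra.
by lra.
Unshelve. all: by end_near. Qed.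

End PowerKernel.

(** * Symmetric bilinear forms and their simultaneous diagonalization *)

Section SymmetricBilinear.
Variables (R : realType) (V : lmodType R).
Implicit Types (q : V -> V -> R) (W : set V).

Definition sym_bilin q :=
  (forall u v, q u v = q v u) /\
  (forall c u v w, q (c *: u + v) w = c * q u w + q v w).

Definition posdef_on W q := forall v, W v -> v != 0 -> 0 < q v v.

Variable q : V -> V -> R.
Hypothesis hq : sym_bilin q.

Lemma sbC u v : q u v = q v u. Proof. by have [] := hq. Qed.

Lemma sb0l v : q 0 v = 0.
Proof.
have := hq.2 1 0 0 v; rewrite scaler0 addr0 mul1r => /esym/eqP.
by rewrite -subr_eq0 addrK => /eqP.
Qed.

Lemma sbDl u v w : q (u + v) w = q u w + q v w.
Proof. by have := hq.2 1 u v w; rewrite scale1r mul1r. Qed.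

Lemma sbZl c u w : q (c *: u) w = c * q u w.
Proof. by have := hq.2 c u 0 w; rewrite addr0 sb0l addr0. Qed.

Lemma sbNl u w : q (- u) w = - q u w.
Proof. by rewrite -scaleN1r sbZl mulN1r. Qed.

Lemma sbBl u v w : q (u - v) w = q u w - q v w.
Proof. by rewrite sbDl sbNl. Qed.

Lemma sbDr u v w : q w (u + v) = q w u + q w v.
Proof. by rewrite sbC sbDl !(sbC w). Qed.

Lemma sbZr c u w : q w (c *: u) = c * q w u.
Proof. by rewrite sbC sbZl sbC. Qed.

Lemma sbBr u v w : q w (u - v) = q w u - q w v.
Proof. by rewrite sbC sbBl !(sbC w). Qed.

Lemma sb_suml n (e : 'I_n -> V) w : q (\sum_i e i) w = \sum_i q (e i) w.
Proof. by apply: (big_morph (fun u => q u w)) => [u v|]; rewrite ?sbDl ?sb0l. Qed.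

Lemma sb_sumr n (e : 'I_n -> V) w : q w (\sum_i e i) = \sum_i q w (e i).
Proof. by rewrite sbC sb_suml; apply: eq_bigr => i _; rewrite sbC. Qed.

End SymmetricBilinear.

Section LinSpan.
Variables (R : realType) (V : lmodType R).

Lemma lin_span_comb n (e : 'I_n -> V) c u v :
  lin_span e u -> lin_span e v -> lin_span e (c *: u + v).
Proof.
move=> [cu ->] [cv ->]; exists (fun i => c * cu i + cv i).
by rewrite scaler_sumr -big_split/=; apply: eq_bigr => i _; rewrite scalerDl scalerA.
Qed.

Lemma lin_span0 n (e : 'I_n -> V) : lin_span e 0.
Proof. by exists (fun=> 0); rewrite big1// => i _; rewrite scale0r. Qed.

Lemma lin_spanZ n (e : 'I_n -> V) c u : lin_span e u -> lin_span e (c *: u).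
Proof. by move=> eu; rewrite -[_ *: _]addr0; apply: lin_span_comb => //; exact: lin_span0. Qed.

Lemma lin_spanD n (e : 'I_n -> V) u v : lin_span e u -> lin_span e v -> lin_span e (u + v).
Proof. by move=> eu ev; rewrite -[u]scale1r; exact: lin_span_comb. Qed.

Lemma lin_spanB n (e : 'I_n -> V) u v : lin_span e u -> lin_span e v -> lin_span e (u - v).
Proof. by move=> eu ev; rewrite addrC -scaleN1r; exact: lin_span_comb. Qed.

Lemma lin_span_sum n (e : 'I_n -> V) m (f : 'I_m -> V) :
  (forall i, lin_span e (f i)) -> lin_span e (\sum_i f i).
Proof.
move=> ef; elim/big_ind: _ => //; [exact: lin_span0|exact: lin_spanD].
Qed.

Lemma lin_span_mem n (e : 'I_n -> V) i : lin_span e (e i).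
Proof.
exists (fun j => (j == i)%:R); rewrite (bigD1 i)//= eqxx scale1r big1 ?addr0// => j /negbTE ->.
by rewrite scale0r.
Qed.

Lemma lin_span_sub n (e : 'I_n -> V) m (f : 'I_m -> V) :
  (forall i, lin_span e (f i)) -> lin_span f `<=` lin_span e.
Proof. by move=> ef _ [c ->]; apply: lin_span_sum => i; exact: lin_spanZ. Qed.

End LinSpan.

Lemma quad_nonneg_lin0 (R : realFieldType) (be ga : R) :
  (forall t, 0 <= 2 * t * be + t ^+ 2 * ga) -> be = 0.
Proof.
move=> H; have g0 : 0 <= ga by have := H 1; have := H (- 1); rewrite sqrrN expr1n; lra.
(* The denominator [ga + 1], rather than the minimizing [ga], also covers [ga = 0]. *)
have := H (- be / (ga + 1)).
have g1 : 0 < ga + 1 by lra.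
have -> : 2 * (- be / (ga + 1)) * be + (- be / (ga + 1)) ^+ 2 * ga =
    - (be ^+ 2 * (ga + 2)) / (ga + 1) ^+ 2 by field; rewrite gt_eqF.
rewrite pmulr_lge0 ?invr_gt0 ?exprn_gt0// oppr_ge0 pmulr_lle0; last by lra.
by move=> h; apply/eqP; rewrite -sqrf_eq0 eq_le h sqr_ge0.
Qed.

Section Spectral.
Variables (R : realType) (V : lmodType R) (a b : V -> V -> R).
Hypotheses (ha : sym_bilin a) (hb : sym_bilin b).

(* The eigenvector maximizes the Rayleigh quotient [b v v / a v v]. *)
Lemma exists_eigenvector n (e : 'I_n.+1 -> V) :
  (forall c : 'I_n.+1 -> R, \sum_i c i *: e i = 0 -> forall i, c i = 0) ->
  posdef_on (lin_span e) a -> posdef_on (lin_span e) b ->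
  exists w m, [/\ lin_span e w, a w w = 1, 0 < m &
    forall v, lin_span e v -> b w v = m ^+ 2 * a w v].
Proof.
move=> ind pa pb.
pose E (c : 'rV[R]_n.+1) : V := \sum_i c ord0 i *: e i.
have Espan c : lin_span e (E c) by exists (fun i => c ord0 i).
have ED c d : E (c + d) = E c + E d.
  by rewrite /E -big_split/=; apply: eq_bigr => i _; rewrite mxE scalerDl.
have EZ t c : E (t *: c) = t *: E c.
  by rewrite /E scaler_sumr; apply: eq_bigr => i _; rewrite mxE scalerA.
have E0 c : c != 0 -> E c != 0.
  apply: contra => /eqP /ind c0; apply/eqP/rowP => i.
  by rewrite mxE; exact: c0.
have cq (q : V -> V -> R) : sym_bilin q -> continuous (fun c => q (E c) (E c)).
  move=> hq c.
  have -> : (fun c => q (E c) (E c)) =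
      (fun c : 'rV[R]_n.+1 => \sum_i \sum_j (c ord0 i * c ord0 j) * q (e i) (e j)).
    apply/funext => d; rewrite /E sb_suml//; apply: eq_bigr => i _.
    rewrite sb_sumr//; apply: eq_bigr => j _.
    by rewrite (sbZl hq) (sbZr hq); ring.
  apply: (@cvg_bigsum R _ _ _ _ _ (nbhs c) (nbhs_filter c)) => i.
  apply: (@cvg_bigsum R _ _ _ _ _ (nbhs c) (nbhs_filter c)) => j.
  apply: cvgM; last exact: cvg_cst.
  by apply: cvgM; exact: coord_continuous.
pose S : set 'rV[R]_n.+1 := [set c | `|c| = 1].
have S0 : S !=set0.
  pose c : 'rV[R]_n.+1 := const_mx 1.
  have c0 : c != 0.
    by apply/eqP => /rowP/(_ ord0); rewrite !mxE => /eqP; rewrite oner_eq0.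
  exists (`|c|^-1 *: c); rewrite /S/= normrZ normfV normr_id mulVf//.
  by rewrite normr_eq0.
have cS : compact S.
  apply: bounded_closed_compact.
    by exists 1; split => // x x1 c; rewrite /S/= => ->; exact: ltW.
  have -> : S = (fun c : 'rV[R]_n.+1 => `|c|) @^-1` [set 1] by [].
  by apply: closed_comp => [c _|]; [exact: norm_continuous|exact: closed_eq].
have Sn0 c : S c -> c != 0.
  by move=> Sc; apply/eqP => c0; move: Sc; rewrite /S/= c0 normr0 => /eqP; rewrite eq_sym oner_eq0.
have aE c : c != 0 -> 0 < a (E c) (E c) by move=> c0; apply: pa => //; exact: E0.
have [|c cSc cmax] := @compact_EVT_max _ R (fun c => b (E c) (E c) / a (E c) (E c)) S S0 cS.
  apply: continuous_in_subspaceT => c; rewrite inE => Sc.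
  have an : a (E c) (E c) != 0 by rewrite gt_eqF ?aE// Sn0.
  exact: (cvgM (cq _ hb c) (cvgV an (cq _ ha c))).
rewrite inE in cSc; have c0 := Sn0 _ cSc; have ac := aE _ c0.
have bc : 0 < b (E c) (E c) by apply: pb => //; exact: E0.
set M := b (E c) (E c) / a (E c) (E c).
have M0 : 0 < M by rewrite divr_gt0.
have le d : b (E d) (E d) <= M * a (E d) (E d).
  have [->|d0] := eqVneq d 0.
    rewrite (_ : E 0 = 0); first by rewrite (sb0l ha) (sb0l hb) mulr0.
    by rewrite /E big1// => i _; rewrite mxE scale0r.
  have dn : `|d| != 0 by rewrite normr_eq0.
  have := cmax (`|d|^-1 *: d); rewrite inE /S/= normrZ normfV normr_id mulVf// => /(_ erefl).
  rewrite EZ !(sbZl hb, sbZl ha) !(sbZr hb, sbZr ha) -[X in _ <= X]/M ler_pdivrMr; last first.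
    by rewrite !mulr_gt0 ?invr_gt0 ?normr_gt0// aE.
  have -> : M * (`|d|^-1 * (`|d|^-1 * a (E d) (E d))) =
      `|d|^-1 * (`|d|^-1 * (M * a (E d) (E d))) by ring.
  by rewrite !ler_pM2l ?invr_gt0 ?normr_gt0.
(* The quadratic form of [M * a - b] is nonnegative and vanishes at [E c], so its linear term at
   [E c] vanishes in every direction. *)
have eig v : lin_span e v -> b (E c) v = M * a (E c) v.
  move=> [d ->]; pose D : 'rV[R]_n.+1 := \row_i d i.
  have -> : \sum_i d i *: e i = E D by apply: eq_bigr => i _; rewrite mxE.
  apply/eqP; rewrite eq_sym -subr_eq0; apply/eqP.
  apply: (@quad_nonneg_lin0 _ _ (M * a (E D) (E D) - b (E D) (E D))) => t.
  have := le (c + t *: D); rewrite ED EZ !(sbDl ha, sbDl hb) !(sbDr ha, sbDr hb) !(sbZl ha, sbZl hb) !(sbZr ha, sbZr hb).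
  rewrite (sbC ha (E D)) (sbC hb (E D)) -subr_ge0.
  have : M * a (E c) (E c) = b (E c) (E c) by rewrite /M divfK// gt_eqF.
  by move=> h; lra.
pose s := Num.sqrt (a (E c) (E c)).
have s0 : 0 < s by rewrite sqrtr_gt0.
have s2 : s ^+ 2 = a (E c) (E c) by rewrite sqr_sqrtr// ltW.
exists (s^-1 *: E c), (Num.sqrt M); split.
- exact: lin_spanZ.
- by rewrite (sbZl ha) (sbZr ha) -s2; field; rewrite gt_eqF.
- by rewrite sqrtr_gt0.
- move=> v ev; rewrite (sbZl ha) (sbZl hb) sqr_sqrtr ?(ltW M0)// eig//; ring.
Qed.

Lemma posdef_on_sub W W' (q : V -> V -> R) : W' `<=` W -> posdef_on W q -> posdef_on W' q.
Proof. by move=> WW pq v /WW; exact: pq. Qed.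

(** Induction on the number of spanning vectors. A dependent family loses one vector; an independent
    one yields an eigenvector [w] and the projections of the other vectors along [w]. The eigenvalue
    relation makes [w] orthogonal to their span for [b] as well as for [a]. *)
Lemma eigenbasis_exists n (e : 'I_n -> V) :
  posdef_on (lin_span e) a -> posdef_on (lin_span e) b ->
  exists m (psi : 'I_m -> V) (mu : 'I_m -> R), eigenbasis (lin_span e) a b psi mu.
Proof.
elim: n e => [|n IH] e pa pb.
  by exists 0%N, e, (fun=> 1); split => // [[]|[]].
have [ind|] := pselect (forall c : 'I_n.+1 -> R, \sum_i c i *: e i = 0 -> forall i, c i = 0);
    last first.
  move=> /existsNP[c] /not_implyP[ce] /existsNP[i0 /eqP ci0].
  have E : lin_span e = lin_span (fun i => e (lift i0 i)).
    apply/seteqP; split; last by apply: lin_span_sub => i; exact: lin_span_mem.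
    apply: lin_span_sub => i; have [j ->|->] := unliftP i0 i.
      exact: (lin_span_mem (fun i => e (lift i0 i)) j).
    exists (fun j => - c (lift i0 j) / c i0).
    apply: (scalerI ci0); rewrite scaler_sumr.
    have := ce; rewrite (bigD1_ord i0)//= => /eqP; rewrite addr_eq0 => /eqP ->.
    rewrite -sumrN; apply: eq_bigr => j _.
    by rewrite scalerA mulrCA divff// mulr1 scaleNr.
  rewrite E; apply: IH; rewrite -E//.
have [w [m [ew aw m0 eig]]] := exists_eigenvector ind pa pb.
have [c wE] := ew.
have w0 : w != 0 by apply/eqP => w0; move: aw; rewrite w0 (sb0l ha) => /eqP; rewrite eq_sym oner_eq0.
have [i0 ci0] : exists i, c i != 0.
  apply/not_existsP => H; move/eqP: w0; apply; rewrite wE big1// => i _.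
  by have /negP := H i; rewrite negbK => /eqP ->; rewrite scale0r.
pose e' (j : 'I_n) := e (lift i0 j) - a w (e (lift i0 j)) *: w.
have e'e j : lin_span e (e' j).
  by apply: lin_spanB; [exact: lin_span_mem|exact: lin_spanZ].
have sub : lin_span e' `<=` lin_span e by exact: lin_span_sub.
have orth v : lin_span e' v -> a w v = 0.
  move=> [d ->]; rewrite (sb_sumr ha) big1// => j _.
  by rewrite (sbZr ha) (sbBr ha) (sbZr ha) aw mulr1 subrr mulr0.
pose P u := u - a w u *: w.
have Psum m' (d : 'I_m' -> R) (f : 'I_m' -> V) :
    P (\sum_i d i *: f i) = \sum_i d i *: P (f i).
  rewrite /P (sb_sumr ha) scaler_suml -sumrB; apply: eq_bigr => i _.
  by rewrite (sbZr ha) scalerBr scalerA.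
have PW u : lin_span e u -> lin_span e' (P u).
  case=> d ->; rewrite Psum; apply: lin_span_sum => i; apply: lin_spanZ.
  have [j ->|->] := unliftP i0 i; first exact: lin_span_mem e' j.
  (* Applying [P] to the expansion of [w], with [P w = 0], expresses the projection of the discarded
     vector by those of the others. *)
  have -> : P (e i0) = (c i0)^-1 *: - (\sum_j c (lift i0 j) *: P (e (lift i0 j))).
    apply: (scalerI ci0); rewrite scalerA mulfV// scale1r; apply/eqP.
    rewrite -addr_eq0; apply/eqP.
    transitivity (\sum_i c i *: P (e i)); first by rewrite [RHS](bigD1_ord i0).
    by rewrite -Psum -wE /P aw scale1r subrr.
  apply: lin_spanZ; rewrite -sumrN; apply: lin_span_sum => j.
  by rewrite -scaleNr; apply: lin_spanZ; exact: lin_span_mem e' j.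
have [k [psi [mu [W1 on pos eg]]]] := IH e' (posdef_on_sub sub pa) (posdef_on_sub sub pb).
have psie j : lin_span e' (psi j) by rewrite W1; exact: lin_span_mem.
pose Psi (j : 'I_k.+1) := oapp psi w (unlift ord0 j).
pose Mu (j : 'I_k.+1) := oapp mu m (unlift ord0 j).
exists k.+1, Psi, Mu.
have Psi0 : Psi ord0 = w by rewrite /Psi unlift_none.
have PsiS j : Psi (lift ord0 j) = psi j by rewrite /Psi liftK.
have Mu0 : Mu ord0 = m by rewrite /Mu unlift_none.
have MuS j : Mu (lift ord0 j) = mu j by rewrite /Mu liftK.
have PsiL : lin_span e' `<=` lin_span Psi.
  by rewrite W1; apply: lin_span_sub => j; rewrite -PsiS; exact: lin_span_mem.
have eE : lin_span e = lin_span Psi.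
  apply/seteqP; split; last first.
    apply: lin_span_sub => j; have [j' ->|->] := unliftP ord0 j; last by rewrite Psi0.
    by rewrite PsiS; apply: sub; exact: psie.
  have wP : lin_span Psi w by rewrite -Psi0; exact: lin_span_mem.
  have liftP j : lin_span Psi (e (lift i0 j)).
    rewrite -[e _](subrK (a w (e (lift i0 j)) *: w)); apply: lin_spanD.
      by apply: PsiL; exact: lin_span_mem e' j.
    exact: lin_spanZ.
  apply: lin_span_sub => i; have [j ->|->] := unliftP i0 i; first exact: liftP.
  have -> : e i0 = (c i0)^-1 *: (w - \sum_j c (lift i0 j) *: e (lift i0 j)).
    by rewrite {1}wE (bigD1_ord i0)//= addrK scalerA mulVf// scale1r.
  apply: lin_spanZ; apply: lin_spanB => //.
  by apply: lin_span_sum => j; exact: lin_spanZ.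
split => //.
- move=> i j; have [i' ->|->] := unliftP ord0 i; have [j' ->|->] := unliftP ord0 j;
    rewrite ?PsiS ?Psi0.
  + by rewrite on (inj_eq lift_inj).
  + by rewrite (sbC ha) orth.
  + by rewrite orth.
  + by rewrite aw eqxx.
- by move=> j; have [j' ->|->] := unliftP ord0 j; rewrite ?MuS ?Mu0.
- move=> j v ev; have [j' ->|->] := unliftP ord0 j; last by rewrite Psi0 Mu0 eig.
  rewrite PsiS MuS.
  pose v' := P v; have v'e : lin_span e' v' by exact: PW.
  have vE : v = a w v *: w + v' by rewrite /v' /P addrC subrK.
  have bE : b (psi j') v = a w v * b (psi j') w + b (psi j') v'.
    by rewrite {1}vE (sbDr hb) (sbZr hb).
  have aE : a (psi j') v = a w v * a (psi j') w + a (psi j') v'.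
    by rewrite {1}vE (sbDr ha) (sbZr ha).
  rewrite bE aE (eg _ _ v'e) (sbC hb _ w) (sbC ha _ w) eig; last exact: sub.
  by rewrite (orth _ (psie j')) !mulr0 !add0r.
Qed.

End Spectral.

(** * Interpolation forms and Galerkin errors of the resolvent *)

Section Interpolation.
Variables (R : realType) (V : lmodType R) (a b : V -> V -> R).
Hypotheses (ha : sym_bilin a) (hb : sym_bilin b).
Implicit Types (W : set V) (f g v w : V).

Definition resolvent n (psi : 'I_n -> V) (mu : 'I_n -> R) (tau : R) f : V :=
  \sum_j ((1 + tau * mu j ^+ 2)^-1 * a (psi j) f) *: psi j.

Definition interp_form n (psi : 'I_n -> V) (mu : 'I_n -> R) (th : R) f g : R :=
  \sum_j (a (psi j) f * a (psi j) g) * (mu j ^+ 2) `^ th.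

Lemma eigenbasis_expand W n (psi : 'I_n -> V) mu w :
  eigenbasis W a b psi mu -> W w -> w = \sum_j a (psi j) w *: psi j.
Proof.
move=> [-> on _ _] [c wE]; rewrite {1}wE; apply: eq_bigr => j _; congr (_ *: _).
rewrite wE (sb_sumr ha) (bigD1 j)//= big1 ?addr0 => [|i ij].
  by rewrite (sbZr ha) on eqxx mulr1.
by rewrite (sbZr ha) on eq_sym (negbTE ij) mulr0.
Qed.

Lemma eigenbasis_mem W n (psi : 'I_n -> V) mu j : eigenbasis W a b psi mu -> W (psi j).
Proof. by move=> [-> _ _ _]; exact: lin_span_mem. Qed.

Lemma resolvent_mem W n (psi : 'I_n -> V) mu tau f :
  eigenbasis W a b psi mu -> W (resolvent psi mu tau f).
Proof. by move=> [-> _ _ _]; exists (fun j => (1 + tau * mu j ^+ 2)^-1 * a (psi j) f). Qed.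

Let den_neq0 n (mu : 'I_n -> R) tau j : 0 < tau -> (forall j, 0 < mu j) ->
  1 + tau * mu j ^+ 2 != 0.
Proof. by move=> t0 m0; rewrite gt_eqF// addr_gt0// mulr_gt0// exprn_gt0. Qed.

Lemma resolvent_galerkin W n (psi : 'I_n -> V) mu tau f w : 0 < tau ->
  eigenbasis W a b psi mu -> W w ->
  a (resolvent psi mu tau f) w + tau * b (resolvent psi mu tau f) w = a f w.
Proof.
move=> t0 eb Ww; have [_ _ m0 eig] := eb.
rewrite /resolvent (sb_suml ha) (sb_suml hb) mulr_sumr -big_split/=.
rewrite [in RHS](eigenbasis_expand eb Ww) (sb_sumr ha); apply: eq_bigr => j _.
rewrite (sbZl ha) (sbZl hb) eig// (sbZr ha) (sbC ha f).
by have q := den_neq0 j t0 m0; field.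
Qed.

Lemma resolvent_form W n (psi : 'I_n -> V) mu tau f g : 0 < tau ->
  eigenbasis W a b psi mu -> W f ->
  \sum_j (a (psi j) f * a (psi j) g) * (tau * mu j ^+ 2 / (1 + tau * mu j ^+ 2)) =
  a (f - resolvent psi mu tau f) g.
Proof.
move=> t0 eb Wf; have [_ _ m0 eig] := eb.
rewrite (sbBl ha) {2}(eigenbasis_expand eb Wf) /resolvent !(sb_suml ha) -sumrB.
apply: eq_bigr => j _; rewrite !(sbZl ha).
by have q := den_neq0 j t0 m0; field.
Qed.

Section Pair.
Variables (U W : set V).
Hypotheses (posU : posdef_on U a) (posUb : posdef_on U b).
Variables (n : nat) (psi : 'I_n -> V) (mu : 'I_n -> R).
Variables (m : nat) (chi : 'I_m -> V) (nu : 'I_m -> R).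
Hypotheses (ebW : eigenbasis W a b psi mu) (ebU : eigenbasis U a b chi nu).
Hypothesis WU : W `<=` U.
Variable f : V.
Hypothesis Wf : W f.

Let err tau := resolvent chi nu tau f - resolvent psi mu tau f.

Let Bq tau v w := a v w + tau * b v w.

Let hB tau : sym_bilin (Bq tau).
Proof.
split=> [u v|c u v w]; rewrite /Bq; first by rewrite (sbC ha) (sbC hb).
by rewrite !(sbDl ha, sbDl hb) !(sbZl ha, sbZl hb); ring.
Qed.

Let errU tau : U (err tau).
Proof.
have [UE _ _ _] := ebU; rewrite UE; apply: lin_spanB; rewrite -UE.
  exact: resolvent_mem ebU.
by apply: WU; exact: resolvent_mem ebW.
Qed.

Let err_orth tau w : 0 < tau -> W w -> Bq tau (err tau) w = 0.
Proof.
move=> t0 Ww; rewrite /err (sbBl (hB tau)) /Bq (resolvent_galerkin f t0 ebU (WU Ww)).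
by rewrite (resolvent_galerkin f t0 ebW Ww) subrr.
Qed.

Lemma energy_ge0 tau v : 0 <= tau -> U v -> 0 <= a v v /\ a v v <= Bq tau v v.
Proof.
move=> t0 Uv; have [->|v0] := eqVneq v 0.
  by rewrite /Bq !(sb0l ha, sb0l hb) mulr0 addr0 lexx.
by rewrite (ltW (posU Uv v0)) lerDl mulr_ge0// ltW// posUb.
Qed.

(** The Galerkin equation on [U], tested with the error, turns [f] into the resolvent on [U]. The
    resolvent on [W] can be subtracted from it by orthogonality. *)
Lemma err_energy tau : 0 < tau -> a (err tau) f = Bq tau (err tau) (err tau).
Proof.
move=> t0; rewrite (sbC ha) -(resolvent_galerkin f t0 ebU (errU tau)) -/(Bq tau _ _).
rewrite -[resolvent chi nu tau f](subrK (resolvent psi mu tau f)) -/(err tau).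
have O := err_orth t0 (resolvent_mem tau f ebW).
by rewrite (sbDl (hB tau)) (sbC (hB tau) (resolvent psi mu tau f)) O addr0.
Qed.

(* Galerkin orthogonality makes the resolvent on [W] the best approximation. *)
Lemma err_energy_min tau w : 0 < tau -> W w ->
  Bq tau (err tau) (err tau) <=
  Bq tau (resolvent chi nu tau f - w) (resolvent chi nu tau f - w).
Proof.
move=> t0 Ww; set d := err tau; set z := resolvent psi mu tau f - w.
have Wz : W z.
  have [WE _ _ _] := ebW; rewrite WE; apply: lin_spanB; rewrite -WE//.
  exact: resolvent_mem ebW.
have -> : resolvent chi nu tau f - w = d + z by rewrite /d /err /z addrA subrK.
have O := err_orth t0 Wz; rewrite -/d in O.
have [h1 h2] := energy_ge0 (ltW t0) (WU Wz); clearbody d z.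
rewrite (sbDl (hB tau)) !(sbDr (hB tau)) (sbC (hB tau) z d) O addr0 add0r lerDl.
exact: le_trans h1 h2.
Qed.

Variables (th : R) (g : V).
Hypothesis hth : 0 < th < 1.

(** Both eigenbases are indexed together, with opposite signs for [W] and [U], so that one kernel
    integral represents the difference of the two forms. *)
Let c (i : 'I_n + 'I_m) : R := match i with
  | inl j => a (psi j) f * a (psi j) g
  | inr k => - (a (chi k) f * a (chi k) g) end.
Let x (i : 'I_n + 'I_m) : R := match i with
  | inl j => mu j ^+ 2 | inr k => nu k ^+ 2 end.

Let x0 i : 0 < x i.
Proof.
by case: i => j /=; rewrite exprn_gt0//; [have [_ _ ->] := ebW|have [_ _ ->] := ebU].
Qed.

Let sumE : \sum_i c i * x i `^ th =
  interp_form psi mu th f g - interp_form chi nu th f g.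
Proof.
rewrite big_sumType/=; congr (_ + _); rewrite -sumrN.
by apply: eq_bigr => k _; rewrite mulNr.
Qed.

Let DlE tau : 0 < tau -> \sum_i c i * (tau * x i / (1 + tau * x i)) = a (err tau) g.
Proof.
move=> t0; rewrite big_sumType/= (resolvent_form g t0 ebW Wf).
under [X in _ + X]eq_bigr do rewrite mulNr.
rewrite sumrN (resolvent_form g t0 ebU (WU Wf)) -(sbBl ha); congr (a _ g).
by rewrite opprB addrC addrA subrK.
Qed.

Lemma interp_form_diff_ge0 : (forall tau, 0 < tau -> 0 <= a (err tau) g) ->
  0 <= interp_form psi mu th f g - interp_form chi nu th f g.
Proof.
by move=> H; rewrite -sumE; apply: power_sum_ge0 => // tau t0; rewrite DlE// H.
Qed.

Lemma interp_form_diff_le p K1 K2 : th < p -> 0 <= K1 -> 0 <= K2 ->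
  (forall tau, 0 < tau <= 1 -> a (err tau) g <= K1 * tau `^ p) ->
  (forall tau, 1 <= tau -> a (err tau) g <= K2) ->
  interp_form psi mu th f g - interp_form chi nu th f g <=
  (K1 / (p - th) + K2 / th) / power_mass th.
Proof.
move=> thp K10 K20 H1 H2; rewrite -sumE; apply: power_sum_le => // tau t1.
  by rewrite DlE ?H1//; case/andP: t1.
by rewrite DlE ?H2// (lt_le_trans _ t1).
Qed.

End Pair.
End Interpolation.

(** * Rational approximation of the resolvent *)

Section BlaschkeProduct.
Variable R : realType.
Implicit Types (s : seq R) (x y z tau : R).

(** This is [Theta], with [s] listing the squares of the nonzero snapshot parameters. *)
Definition blaschke s x : R := \prod_(y <- s) ((1 - y * x) / (1 + y * x)).

Let pden y x : 0 < y -> 0 < x -> 1 + y * x != 0.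
Proof. by move=> y0 x0; rewrite gt_eqF// addr_gt0// mulr_gt0. Qed.

Let factor_split y z x : 0 < y -> 0 < z -> 0 < x -> y != z ->
  (1 - y * x) / (1 + y * x) / (1 + z * x) =
  2 * y / (y - z) / (1 + y * x) + (z + y) / (z - y) / (1 + z * x).
Proof.
move=> y0 z0 x0 yz; have q1 := pden y0 x0; have q2 := pden z0 x0.
have n1 : y - z != 0 by rewrite subr_eq0.
have n2 : z - y != 0 by rewrite subr_eq0 eq_sym.
by field; rewrite n1 n2 q1 q2.
Qed.

Let sum_split s y (c : R -> R) x : uniq (y :: s) -> {in y :: s, forall z, 0 < z} -> 0 < x ->
  (1 - y * x) / (1 + y * x) * (\sum_(z <- s) c z / (1 + z * x)) =
  (\sum_(z <- s) c z * (2 * y / (y - z))) / (1 + y * x) +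
  \sum_(z <- s) c z * ((z + y) / (z - y)) / (1 + z * x).
Proof.
move=> /= /andP[ys _] pos x0; rewrite mulr_sumr mulr_suml -big_split/=.
apply: eq_big_seq => z zs.
have yz : y != z by apply: contra ys => /eqP ->.
have y0 : 0 < y by apply: pos; rewrite inE eqxx.
have z0 : 0 < z by apply: pos; rewrite inE zs orbT.
by rewrite mulrCA (factor_split y0 z0 x0 yz) mulrDr !mulrA.
Qed.

Let ext y s (d0 : R) (d : R -> R) x : y \notin s ->
  d0 / (1 + y * x) + \sum_(z <- s) d z / (1 + z * x) =
  \sum_(z <- y :: s) (if z == y then d0 else d z) / (1 + z * x).
Proof.
move=> ys; rewrite big_cons eqxx; congr (_ + _); apply: eq_big_seq => z zs.
by case: eqP => // zy; rewrite -zy zs in ys.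
Qed.

Lemma blaschke_partial_fractions s : uniq s -> {in s, forall z, 0 < z} ->
  exists c0 (c : R -> R), forall x, 0 < x ->
    blaschke s x = c0 + \sum_(z <- s) c z / (1 + z * x).
Proof.
elim: s => [|y s IH] us pos.
  by exists 1, (fun=> 0) => x x0; rewrite /blaschke !big_nil addr0.
have y0 : 0 < y by apply: pos; rewrite inE eqxx.
have /andP[ys us'] := us.
have [|c0 [c E]] := IH us'; first by move=> z zs; apply: pos; rewrite inE zs orbT.
exists (- c0), (fun z => if z == y then 2 * c0 + \sum_(z <- s) c z * (2 * y / (y - z))
  else c z * ((z + y) / (z - y))) => x x0.
have q1 := pden y0 x0.
rewrite /blaschke big_cons -/(blaschke s x) E// mulrDr (sum_split _ us pos x0).
rewrite -(ext _ _ _ ys) !addrA; congr (_ + _).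
by set S := \sum_(z <- s) _; field.
Qed.

Lemma blaschke_interpolation s tau : 0 < tau -> uniq s -> {in s, forall z, 0 < z} ->
  exists d : R -> R, forall x, 0 < x ->
    (1 - blaschke s x * blaschke s tau^-1) / (1 + tau * x) =
    \sum_(z <- s) d z / (1 + z * x).
Proof.
move=> t0; elim: s => [|y s IH] us pos.
  by exists (fun=> 0) => x x0; rewrite /blaschke !big_nil mulr1 subrr mul0r.
have y0 : 0 < y by apply: pos; rewrite inE eqxx.
have /andP[ys us'] := us.
have [|d E] := IH us'; first by move=> z zs; apply: pos; rewrite inE zs orbT.
pose k := (1 - y * tau^-1) / (1 + y * tau^-1).
exists (fun z => if z == y then 2 * y / (tau + y) + k * \sum_(z <- s) d z * (2 * y / (y - z))
  else k * (d z * ((z + y) / (z - y)))) => x x0.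
have q1 := pden y0 x0; have q2 := pden t0 x0.
have q3 : tau + y != 0 by rewrite gt_eqF// addr_gt0.
have q4 : 1 + y / tau != 0 by rewrite gt_eqF// addr_gt0// divr_gt0.
have q5 : tau != 0 by rewrite gt_eqF.
rewrite -(ext _ _ _ ys) [(_ + k * _) / _]mulrDl.
have -> : \sum_(z <- s) k * (d z * ((z + y) / (z - y))) / (1 + z * x) =
    k * \sum_(z <- s) d z * ((z + y) / (z - y)) / (1 + z * x).
  by rewrite mulr_sumr; apply: eq_bigr => z _; rewrite !mulrA.
rewrite -addrA -[k * _ / _]mulrA -mulrDr -(sum_split _ us pos x0) -E//.
rewrite /blaschke !big_cons -!/(blaschke s _) -/k.
set B := blaschke s x; set B' := blaschke s _.
(* With [F] the new factor at [x], [1 - F * k * B * B'] is split as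
   [(1 - F * k) + F * k * (1 - B * B')]. The pole at [- 1 / tau] cancels in the first term, and the
   induction hypothesis handles the second. *)
transitivity ((1 - (1 - y * x) / (1 + y * x) * k) / (1 + tau * x) +
   k * ((1 - y * x) / (1 + y * x) * ((1 - B * B') / (1 + tau * x)))).
  by field; rewrite q1 q2.
by congr (_ + _); rewrite /k; field; rewrite q1 q2 q3 q5.
Qed.

Lemma blaschke_sqr_le1 s x : {in s, forall z, 0 < z} -> 0 < x -> blaschke s x ^+ 2 <= 1.
Proof.
elim: s => [|y s IH] pos x0; first by rewrite /blaschke big_nil expr1n.
have y0 : 0 < y by apply: pos; rewrite inE eqxx.
rewrite /blaschke big_cons exprMn mulr_ile1 ?sqr_ge0//; last first.
  by apply: IH => // z zs; apply: pos; rewrite inE zs orbT.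
have yx : 0 < y * x by rewrite mulr_gt0.
rewrite expr_div_n ler_pdivrMr ?exprn_gt0 ?addr_gt0// mul1r.
by rewrite sqrrB sqrrD; lra.
Qed.

End BlaschkeProduct.

Lemma discriminant_le (R : realFieldType) (A B C : R) : 0 <= C ->
  (forall t, 0 <= A + 2 * t * B + t ^+ 2 * C) -> B ^+ 2 <= A * C.
Proof.
move=> C0 H; have [CE|Cn] := eqVneq C 0.
  have A0 : 0 <= A by have := H 0; rewrite CE; lra.
  have -> : B = 0; last by rewrite expr0n CE mulr0.
  apply/eqP/negPn/negP => B0.
  have := H (- (A + 1) / (2 * B)); rewrite CE mulr0 addr0.
  have -> : A + 2 * (- (A + 1) / (2 * B)) * B = - 1 by field.
  by lra.
have Cp : 0 < C by rewrite lt_neqAle eq_sym Cn.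
have := H (- B / C).
have -> : A + 2 * (- B / C) * B + (- B / C) ^+ 2 * C = (A * C - B ^+ 2) / C by field.
by rewrite pmulr_lge0 ?invr_gt0// subr_ge0.
Qed.

Lemma sum_cauchy_schwarz (R : realFieldType) n (p q : 'I_n -> R) :
  (\sum_i p i * q i) ^+ 2 <= (\sum_i p i ^+ 2) * (\sum_i q i ^+ 2).
Proof.
apply: discriminant_le => [|t]; first by apply: sumr_ge0 => i _; rewrite sqr_ge0.
rewrite [2 * t * _]mulr_sumr [_ * \sum_i q i ^+ 2]mulr_sumr -!big_split/=.
by apply: sumr_ge0 => i _; rewrite (_ : _ + _ = (p i + t * q i) ^+ 2) ?sqr_ge0//; ring.
Qed.

(** * The discrete spaces *)

Section Concrete.
Variables (R : realType) (X : interpolation_couple R).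
Notation V1 := (space1 X).
Implicit Types (f g u v w z : V1).
Let b := @ip0_on1 R X.

Lemma ip0_on1_sym_bilin : sym_bilin b.
Proof.
split=> [u v|c u v w]; rewrite /b /ip0_on1; first by rewrite (hermC (ip0 X)) /= expr0 mul1r.
by rewrite !linearP linearPl.
Qed.

Lemma ip1_sym_bilin : sym_bilin (ip1 X).
Proof.
split=> [u v|c u v w]; first by rewrite (hermC (ip1 X)) /= expr0 mul1r.
by rewrite linearPl.
Qed.

Lemma ip0_on1E v : b v v = norm0_on1 v ^+ 2.
Proof. by rewrite /b /ip0_on1 ip0E. Qed.

Lemma ip0_on1_gt0 v : v != 0 -> 0 < b v v.
Proof.
move=> v0; rewrite ip0_on1E exprn_gt0// normr_gt0.
by apply: contra v0 => /eqP e0; apply/eqP/(@emb_inj _ X); rewrite e0 linear0.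
Qed.

(** The image of the unit ball is precompact, hence bounded. This [c] is the only quantity of the
    couple that enters the final constant. *)
Lemma emb_bounded : exists2 c : R, 0 < c & forall v, norm0_on1 v <= c * `|v|.
Proof.
have bA : bounded_set [set v : V1 | `|v| <= 1].
  by exists 1; split => // x x1 v /= /le_trans; apply; exact: ltW.
have := emb_compact bA; rewrite precompactE => /compact_bounded[M [_ HM]].
pose c := `|M| + 1; have c0 : 0 < c by rewrite ltr_wpDl.
exists c => // v; have [->|v0] := eqVneq v 0.
  by rewrite /norm0_on1 linear0 !normr0 mulr0.
have Mc : M < c by rewrite (le_lt_trans (ler_norm M))// /c ltrDl.
have n0 : 0 < `|v| by rewrite normr_gt0.
have H : `|emb X (`|v|^-1 *: v)| <= c.
  apply: (HM c Mc); apply: subset_closure; exists (`|v|^-1 *: v) => //=.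
  by rewrite normrZ gtr0_norm ?invr_gt0// mulVf// gt_eqF.
have eZ : emb X (`|v|^-1 *: v) = `|v|^-1 *: emb X v by rewrite linearZ.
by move: H; rewrite eZ normrZ gtr0_norm ?invr_gt0// ler_pdivrMl// mulrC.
Qed.

End Concrete.

Section DiscreteSpectral.
Variables (R : realType) (X : interpolation_couple R).
Notation V1 := (space1 X).
Notation b := (@ip0_on1 R X).
Variables (Vh : set V1) (N : nat) (phi : 'I_N -> V1) (lam : 'I_N -> R).
Hypothesis eb : eigenbasis Vh b (ip1 X) phi lam.
Implicit Types (f g u v w z : V1) (rho : R -> R).

Let hb := ip0_on1_sym_bilin X.
Let h1 := ip1_sym_bilin X.

(* The inner product inducing the dual norm, in spectral coordinates; see
   [dual_ip_spectral]. *)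
Definition spectral_dual v w : R :=
  \sum_k lam k ^- 2 * (b (phi k) v * b (phi k) w).

Definition spectral_fun rho v : V1 :=
  \sum_k (rho (lam k ^+ 2) * b (phi k) v) *: phi k.

Let a := spectral_dual.
Let vec := spectral_fun.

Lemma lam_sqr_gt0 k : 0 < lam k ^+ 2.
Proof. by have [_ _ l0 _] := eb; rewrite exprn_gt0. Qed.

Let lam0 k : lam k ^+ 2 != 0.
Proof. by rewrite gt_eqF// lam_sqr_gt0. Qed.

Let lam_neq0 k : lam k != 0.
Proof. by have [_ _ l0 _] := eb; rewrite gt_eqF. Qed.

Let Vh0 : Vh 0. Proof. by have [-> _ _ _] := eb; exact: lin_span0. Qed.
Lemma spectral_fun_mem rho v : Vh (vec rho v).
Proof. by have [-> _ _ _] := eb; exists (fun k => rho (lam k ^+ 2) * b (phi k) v). Qed.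

Lemma spectral_fun_coord rho v k : b (phi k) (vec rho v) = rho (lam k ^+ 2) * b (phi k) v.
Proof.
have [_ on _ _] := eb; rewrite /vec /spectral_fun (sb_sumr hb) (bigD1 k)//= big1.
  by rewrite addr0 (sbZr hb) on eqxx mulr1.
by move=> i ik; rewrite (sbZr hb) on eq_sym (negbTE ik) mulr0.
Qed.

Lemma spectral_fun1 v : Vh v -> vec (fun=> 1) v = v.
Proof.
by move=> Vv; rewrite [RHS](eigenbasis_expand hb eb Vv); apply: eq_bigr => k _; rewrite mul1r.
Qed.

Lemma ip0_spectral v w : Vh w -> b v w = \sum_k b (phi k) v * b (phi k) w.
Proof.
move=> Vw; rewrite {1}(eigenbasis_expand hb eb Vw) (sb_sumr hb).
by apply: eq_bigr => k _; rewrite (sbZr hb) mulrC (sbC hb v).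
Qed.

Lemma ip1_spectral v w : Vh v -> Vh w ->
  ip1 X v w = \sum_k lam k ^+ 2 * (b (phi k) v * b (phi k) w).
Proof.
move=> Vv Vw; rewrite {1}(eigenbasis_expand hb eb Vv) (sb_suml h1).
by have [_ _ _ eig] := eb; apply: eq_bigr => k _; rewrite (sbZl h1) eig// mulrCA.
Qed.

Lemma spectral_eq v w : Vh v -> Vh w -> (forall k, b (phi k) v = b (phi k) w) -> v = w.
Proof.
move=> Vv Vw E; rewrite (eigenbasis_expand hb eb Vv) (eigenbasis_expand hb eb Vw).
by apply: eq_bigr => k _; rewrite E.
Qed.

Lemma riesz_spectral v : riesz Vh v = vec (fun x => x^-1) v.
Proof.
apply: xget_unique => [|z [Vz zE]].
  split=> [|w Vw]; first exact: spectral_fun_mem.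
  rewrite (ip1_spectral (spectral_fun_mem _ _) Vw) ip0_spectral//.
  apply: eq_bigr => k _; rewrite spectral_fun_coord.
  by have l0 := lam_neq0 k; field.
apply: spectral_eq => // [|k]; first exact: spectral_fun_mem.
rewrite spectral_fun_coord; have Vk := eigenbasis_mem k eb.
have [_ _ _ eig] := eb; have := zE _ Vk; rewrite (sbC h1) eig// (sbC hb v) => <-.
by have l0 := lam_neq0 k; field.
Qed.

Lemma snapshot_spectral f t : snapshot Vh f t = vec (fun x => (1 + t ^+ 2 * x)^-1) f.
Proof.
have q k : 1 + t ^+ 2 * lam k ^+ 2 != 0.
  by rewrite gt_eqF// ltr_wpDr// mulr_ge0 ?sqr_ge0.
apply: xget_unique => [|z [Vz zE]].
  split=> [|w Vw]; first exact: spectral_fun_mem.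
  rewrite (ip1_spectral (spectral_fun_mem _ _) Vw) !ip0_spectral// mulr_sumr -big_split/=.
  apply: eq_bigr => k _; rewrite spectral_fun_coord.
  have E (m A B : R) : 1 + m != 0 -> (1 + m)^-1 * A * B + m * ((1 + m)^-1 * A * B) = A * B.
    by move=> h; field.
  by rewrite [t ^+ 2 * (_ * _)]mulrA E// q.
apply: spectral_eq => // [|k]; first exact: spectral_fun_mem.
rewrite spectral_fun_coord; have Vk := eigenbasis_mem k eb.
have [_ _ _ eig] := eb; have := zE _ Vk.
rewrite (sbC h1) eig// (sbC hb z) (sbC hb f) => <-.
have -> : b (phi k) z + t ^+ 2 * (lam k ^+ 2 * b (phi k) z) =
    (1 + t ^+ 2 * lam k ^+ 2) * b (phi k) z by ring.
by rewrite mulKf// q.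
Qed.

Lemma spectral_dual_sym_bilin : sym_bilin a.
Proof.
split=> [u v|c u v w]; first by apply: eq_bigr => k _; rewrite [X in _ * X]mulrC.
rewrite /a /spectral_dual mulr_sumr -big_split/=; apply: eq_bigr => k _.
by rewrite (sbDr hb) (sbZr hb); ring.
Qed.
Let ha := spectral_dual_sym_bilin.

Lemma spectral_dual_ge0 v : 0 <= a v v.
Proof.
by apply: sumr_ge0 => k _; rewrite mulr_ge0 ?invr_ge0 ?sqr_ge0// -expr2 sqr_ge0.
Qed.

Lemma spectral_dual_cauchy_schwarz v w : a v w ^+ 2 <= a v v * a w w.
Proof.
apply: discriminant_le => [|t]; first exact: spectral_dual_ge0.
have -> : a v v + 2 * t * a v w + t ^+ 2 * a w w = a (v + t *: w) (v + t *: w).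
  rewrite (sbDl ha) !(sbDr ha) !(sbZl ha) !(sbZr ha) (sbC ha w v); ring.
exact: spectral_dual_ge0.
Qed.

Lemma spectral_dual_posdef : posdef_on Vh a.
Proof.
move=> v Vv v0; rewrite lt_neqAle spectral_dual_ge0 andbT eq_sym.
apply: contra v0; rewrite psumr_eq0 => [/allP E|k _]; last first.
  by rewrite mulr_ge0 ?invr_ge0 ?sqr_ge0// -expr2 sqr_ge0.
apply/eqP; apply: spectral_eq => // k; rewrite (_ : b _ 0 = 0); last first.
  by rewrite (sbC hb) (sb0l hb).
have := E k (mem_index_enum k); rewrite implyTb mulf_eq0 invr_eq0 (negbTE (lam0 k))/=.
by rewrite mulf_eq0 orbb => /eqP.
Qed.

Lemma ip0_le_dual_norm v w : Vh w -> b v w ^+ 2 <= a v v * `|w| ^+ 2.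
Proof.
move=> Vw; rewrite -ip1E ip1_spectral// ip0_spectral//.
have -> : \sum_k b (phi k) v * b (phi k) w =
    \sum_k ((lam k)^-1 * b (phi k) v) * (lam k * b (phi k) w).
  by apply: eq_bigr => k _; have l := lam_neq0 k; field.
have -> : a v v = \sum_k ((lam k)^-1 * b (phi k) v) ^+ 2.
  by apply: eq_bigr => k _; rewrite exprMn exprVn expr2.
have -> : \sum_k lam k ^+ 2 * (b (phi k) w * b (phi k) w) = \sum_k (lam k * b (phi k) w) ^+ 2.
  by apply: eq_bigr => k _; rewrite exprMn expr2.
exact: sum_cauchy_schwarz.
Qed.

(** The supremum is attained at the Riesz representative of [v], unless that representative is 0. *)
Lemma dual_norm_spectral v : dual_norm Vh v ^+ 2 = a v v.
Proof.
have ub w : (Vh `\ 0) w -> (b v w / `|w|) ^+ 2 <= a v v.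
  move=> [Vw /eqP w0]; rewrite expr_div_n ler_pdivrMr ?exprn_gt0 ?normr_gt0//.
  exact: ip0_le_dual_norm.
(* In the degenerate case the set is [[set 0]], or empty when [Vh] is the zero space; the default
   value of [sup] on the empty set is also 0. *)
have [D0|Dn] := eqVneq (a v v) 0.
  rewrite D0 /dual_norm; set A := (X in sup X).
  have /subset_set1[] : A `<=` [set 0].
  - move=> _ [w Vw <-] /=; apply/eqP; rewrite -sqrf_eq0 eq_le sqr_ge0 -D0.
    by rewrite ub.
  - by move=> ->; rewrite sup0 expr0n.
  - by move=> ->; rewrite sup1 expr0n.
have Dp : 0 < a v v by rewrite lt_neqAle eq_sym Dn spectral_dual_ge0.
pose z := riesz Vh v; have zE : z = vec (fun x => x^-1) v := riesz_spectral v.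
have Vz : Vh z by rewrite zE; exact: spectral_fun_mem.
have bz : b v z = a v v.
  rewrite ip0_spectral//; apply: eq_bigr => k _; rewrite zE spectral_fun_coord.
  by rewrite mulrCA.
have nz : `|z| ^+ 2 = a v v.
  rewrite -ip1E ip1_spectral//; apply: eq_bigr => k _; rewrite zE spectral_fun_coord.
  by have l0 := lam_neq0 k; field.
have zn0 : z != 0 by apply: contraTneq Dp => z0; rewrite -nz z0 normr0 expr0n ltxx.
have ubz : ubound [set b v w / `|w| | w in Vh `\ 0] `|z|.
  move=> _ [w Vw <-]; apply: le_trans (ler_norm _) _.
  by rewrite -ler_sqr ?nnegrE// real_normK ?num_real// nz ub.
have Az : [set b v w / `|w| | w in Vh `\ 0] `|z|.
  exists z; first by split=> //; apply/eqP.
  by rewrite bz -nz expr2 mulfK// normr_eq0.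
rewrite -nz; congr (_ ^+ 2); apply/eqP; rewrite eq_le; apply/andP; split.
  by apply: ge_sup => //; exists `|z|.
by apply: ub_le_sup => //; exists `|z|.
Qed.

Lemma dual_ip_spectral : dual_ip Vh = a.
Proof.
apply/funext => v; apply/funext => w; rewrite /dual_ip !dual_norm_spectral.
by rewrite (sbDl ha v w) (sbBl ha v w) !(sbDr ha v w) !(sbBr ha v w) (sbC ha w v); field.
Qed.

(** Passing from the couple (0, 1) to the couple (-1, 0) rescales the eigenvectors and keeps the
    eigenvalues. *)
Lemma dual_eigenbasis : eigenbasis Vh a b (fun k => lam k *: phi k) lam.
Proof.
have [VE on l0 eig] := eb; split=> //.
- rewrite {1}VE; apply/seteqP; split.
    move=> _ [c ->]; exists (fun k => c k / lam k); apply: eq_bigr => k _.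
    by rewrite scalerA divfK// gt_eqF.
  by move=> _ [c ->]; exists (fun k => c k * lam k); apply: eq_bigr => k _; rewrite scalerA.
- move=> i j; rewrite /a /spectral_dual (bigD1 i)//= big1 ?addr0 => [|k ki].
    rewrite !(sbZr hb) !on eqxx; have [->|_] := eqVneq i j.
      by have l := lam_neq0 j; rewrite !mulr1 -expr2 mulVf// sqrf_eq0.
    by rewrite !mulr0.
  by rewrite !(sbZr hb) !on (negbTE ki); rewrite !(mulr0, mul0r).
- move=> j w Vw; rewrite /a /spectral_dual (sbZl hb) (bigD1 j)//= big1 ?addr0 => [|k kj].
    by rewrite (sbZr hb) on eqxx mulr1; have l := lam_neq0 j; field.
  by rewrite (sbZr hb) on (negbTE kj); rewrite !(mulr0, mul0r).
Qed.

Lemma dual_eigenbasis_coord k v : a (lam k *: phi k) v = (lam k)^-1 * b (phi k) v.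
Proof.
have [_ on l0 _] := eb; rewrite /a /spectral_dual (bigD1 k)//= big1 ?addr0 => [|i ik].
  by rewrite (sbZr hb) on eqxx mulr1; have l := lam_neq0 k; field.
by rewrite (sbZr hb) on (negbTE ik); rewrite !(mulr0, mul0r).
Qed.

Lemma resolvent_spectral tau f : 0 < tau ->
  resolvent a (fun k => lam k *: phi k) lam tau f = vec (fun x => (1 + tau * x)^-1) f.
Proof.
move=> t0; apply: eq_bigr => k _; rewrite dual_eigenbasis_coord scalerA; congr (_ *: _).
have q : 1 + tau * lam k ^+ 2 != 0 by rewrite gt_eqF// addr_gt0// mulr_gt0// lam_sqr_gt0.
by have l := lam_neq0 k; rewrite mulrA -mulrA mulrACA mulVf// mulr1 .
Qed.

End DiscreteSpectral.

Section InterpolationValues.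
Variables (R : realType) (V : lmodType R) (W : set V) (a b : V -> V -> R).
Hypothesis ha : sym_bilin a.
Hypothesis ebex : exists n (psi : 'I_n -> V) (mu : 'I_n -> R), eigenbasis W a b psi mu.

Let powR_sqr (m th : R) : 0 < m -> m `^ (2 * th) = (m ^+ 2) `^ th.
Proof. by move=> m0; rewrite powRrM powR_mulrn// ltW. Qed.

(** The norm is defined through an arbitrary choice. Existence of an eigenbasis ensures that the
    chosen value comes from one, and the estimates hold for whichever it is. *)
Lemma interp_norm_sqrE th f : exists n (psi : 'I_n -> V) (mu : 'I_n -> R),
  eigenbasis W a b psi mu /\ interp_norm W a b th f ^+ 2 = interp_form a psi mu th f f.
Proof.
rewrite /interp_norm; set P := (X in get X).
have Pg : P (get P).
  by apply: getPex; have [n [psi [mu eb]]] := ebex; eexists; exists n, psi, mu.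
have [n [psi [mu [eb ->]]]] := Pg.
exists n, psi, mu; split => //; rewrite sqr_sqrtr; last first.
  by apply: sumr_ge0 => j _; rewrite mulr_ge0 ?powR_ge0 ?sqr_ge0.
have [_ _ m0 _] := eb; apply: eq_bigr => j _; rewrite powR_sqr// (sbC ha).
by rewrite mulrC expr2.
Qed.

Lemma interp_op_formE th f : exists n (psi : 'I_n -> V) (mu : 'I_n -> R),
  eigenbasis W a b psi mu /\
  forall g, a (interp_op W a b th f) g = interp_form a psi mu th f g.
Proof.
rewrite /interp_op; set P := (X in xget 0 X).
have Pg : P (xget 0 P).
  by apply: xgetPex; have [n [psi [mu eb]]] := ebex; eexists; exists n, psi, mu.
have [n [psi [mu [eb ->]]]] := Pg.
exists n, psi, mu; split => // g; rewrite (sb_suml ha).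
have [_ _ m0 _] := eb; apply: eq_bigr => j _; rewrite (sbZl ha) powR_sqr//.
by ring.
Qed.

End InterpolationValues.

Lemma uniq_sqr_snapshots (R : realType) r (t : 'I_r.+1 -> R) :
  t ord0 = 0 -> (forall i j : 'I_r.+1, (i < j)%N -> t i < t j) ->
  uniq [seq t (lift ord0 i) ^+ 2 | i <- index_enum 'I_r].
Proof.
move=> t0 tmono; have tpos i : 0 < t (lift ord0 i) by rewrite -t0 tmono.
rewrite map_inj_uniq ?index_enum_uniq// => i j /eqP.
rewrite eqrXn2 ?ltW// => /eqP tij; apply/val_inj; case: (ltngtP i j) => // ij.
  by have := tmono (lift ord0 i) (lift ord0 j) ij; rewrite tij ltxx.
by have := tmono (lift ord0 j) (lift ord0 i) ij; rewrite tij ltxx.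
Qed.

Lemma zolotarev_blaschke_le (R : realType) (lamL lamU : R) r (t : 'I_r.+1 -> R) x :
  (0 < r)%N -> 0 < lamL ^+ 2 < lamU ^+ 2 -> zolotarev_snapshots lamL lamU t ->
  lamL ^+ 2 <= x <= lamU ^+ 2 ->
  blaschke [seq t (lift ord0 i) ^+ 2 | i <- index_enum 'I_r] x ^+ 2 <=
  expR (2 - 2 * zolotarev_rate (lamL ^+ 2 / lamU ^+ 2) * r%:R).
Proof.
move=> r0 /andP[L0 LU] [t0 tmono tE] /andP[Lx xU].
have U0 := lt_trans L0 LU; have x0 := lt_le_trans L0 Lx.
set dl := lamL ^+ 2 / lamU ^+ 2; set s := [seq _ | i <- _].
have dlE : lamU ^- 2 / lamL ^- 2 = dl by rewrite invrK mulrC.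
pose s' := [seq lamL ^- 2 * zolotarev_point dl r (r - j) | j : 'I_r <- index_enum 'I_r].
have us : uniq s := uniq_sqr_snapshots t0 tmono.
(* The snapshots are given by an equality of sets. Since those in [s] are distinct and [s'] is no
   longer than [s], inclusion makes the two lists permutations of each other, as needed to reindex
   the product. *)
have ss' : {subset s <= s'}.
  move=> _ /mapP[i _ ->].
  have : [set t i ^+ 2 | i in ~` [set ord0]] (t (lift ord0 i) ^+ 2) by exists (lift ord0 i).
  rewrite tE /transformed_zolotarev_points dlE => -[j /= /andP[j1 jr] <-].
  have jr' : (r - j < r)%N by rewrite ltn_subrL j1.
  by apply/mapP; exists (Ordinal jr'); rewrite ?mem_index_enum//= subKn.
have szE : (size s' <= size s)%N by rewrite !size_map.
have us' := leq_size_uniq us ss' szE.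
have [_ ms] := uniq_min_size us ss' szE.
have pss : perm_eq s s' by apply: uniq_perm.
rewrite /blaschke (perm_big _ pss) big_map -prodrXl.
(* The inversion [x -> lamL ^+ 2 / x] carries the spectral interval to [[dl, 1]] and each factor to
   the one of [zolotarev_bound]. *)
have xi : dl <= lamL ^+ 2 / x <= 1.
  by rewrite ler_pM2l// lef_pV2 ?posrE// xU ler_pdivrMr// mul1r.
have dl1 : 0 < dl < 1 by rewrite divr_gt0// ltr_pdivrMr// mul1r.
apply: le_trans (zolotarev_bound dl1 r0 xi).
rewrite le_eqVlt; apply/orP; left; apply/eqP; apply: eq_bigr => j _; congr (_ ^+ 2).
set z := zolotarev_point _ _ _; have q : x / lamL ^+ 2 != 0 by rewrite gt_eqF// divr_gt0.
have Ln : lamL ^+ 2 != 0 by rewrite gt_eqF.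
have -> : 1 - lamL ^- 2 * z * x = (lamL ^+ 2 / x - z) * (x / lamL ^+ 2).
  by field; rewrite -(sqrf_eq0 lamL) Ln gt_eqF.
have -> : 1 + lamL ^- 2 * z * x = (lamL ^+ 2 / x + z) * (x / lamL ^+ 2).
  by field; rewrite -(sqrf_eq0 lamL) Ln gt_eqF.
by rewrite -mulf_div divff// mulr1.
Qed.

Section InterpolationMonotone.
Variables (R : realType) (V : lmodType R) (a b : V -> V -> R) (U W : set V).
Hypotheses (ha : sym_bilin a) (hb : sym_bilin b).
Hypotheses (posU : posdef_on U a) (posUb : posdef_on U b) (WU : W `<=` U).
Variables (n : nat) (psi : 'I_n -> V) (mu : 'I_n -> R).
Variables (m : nat) (chi : 'I_m -> V) (nu : 'I_m -> R).
Hypotheses (ebW : eigenbasis W a b psi mu) (ebU : eigenbasis U a b chi nu).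

Lemma interp_form_subspace_le th f : 0 < th < 1 -> W f ->
  interp_form a chi nu th f f <= interp_form a psi mu th f f.
Proof.
move=> hth Wf; rewrite -subr_ge0.
apply: (interp_form_diff_ge0 ha ebW ebU WU Wf hth) => tau tau0.
rewrite (err_energy ha hb ebW ebU WU f tau0); set v := _ - _.
have Uv : U v.
  have [UE _ _ _] := ebU; rewrite UE; apply: lin_spanB; rewrite -UE.
    exact: resolvent_mem ebU.
  by apply: WU; exact: resolvent_mem ebW.
have [p1 p2] := energy_ge0 ha hb posU posUb (ltW tau0) Uv.
exact: le_trans p1 p2.
Qed.

End InterpolationMonotone.

(** * Error of the reduced basis method *)

Section ReducedBasis.
Variables (R : realType) (X : interpolation_couple R).
Notation V1 := (space1 X).
Notation b := (@ip0_on1 R X).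
Variables (Vh : set V1) (N : nat) (phi : 'I_N -> V1) (lam : 'I_N -> R).
Hypothesis eb : eigenbasis Vh b (ip1 X) phi lam.
Variables (r : nat) (t : 'I_r.+1 -> R) (f : V1).
Hypotheses (t0 : t ord0 = 0) (tmono : forall i j : 'I_r.+1, (i < j)%N -> t i < t j).
Hypothesis Vf : Vh f.
Implicit Types (g u v : V1) (rho : R -> R).

Let hb := ip0_on1_sym_bilin X.
Let a := spectral_dual phi lam.
Let ha : sym_bilin a := spectral_dual_sym_bilin phi lam.
Let vec := spectral_fun phi lam.
Let W := rb_space Vh f t.
Let s := [seq t (lift ord0 i) ^+ 2 | i <- index_enum 'I_r].
Let y k v := b (phi k) v.
Let x k := lam k ^+ 2.

Let x0 k : 0 < x k. Proof. exact: lam_sqr_gt0 eb k. Qed.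

Let spos : {in s, forall z, 0 < z}.
Proof. by move=> _ /mapP[i _ ->]; rewrite exprn_gt0// -t0 tmono. Qed.

Let us : uniq s. Proof. exact: uniq_sqr_snapshots. Qed.

Lemma rb_space_sub : W `<=` Vh.
Proof.
have [VE _ _ _] := eb; rewrite VE; apply: lin_span_sub => i; rewrite -VE.
by rewrite (snapshot_spectral eb); exact: spectral_fun_mem eb _ _.
Qed.

(** The snapshot at [t ord0 = 0] is [f] itself and provides the constant term; every other snapshot
    provides one simple fraction. *)
Lemma rb_space_rational (c0 : R) (d : R -> R) :
  W (vec (fun x => c0 + \sum_(z <- s) d z / (1 + z * x)) f).
Proof.
exists (fun i => if unlift ord0 i is Some j then d (t (lift ord0 j) ^+ 2) else c0).
apply: (spectral_eq eb) => [||k]; first exact: spectral_fun_mem eb _ _.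
  apply: rb_space_sub; eexists; reflexivity.
rewrite (spectral_fun_coord eb) (sb_sumr hb) big_ord_recl unlift_none t0.
rewrite (sbZr hb) (snapshot_spectral eb) (spectral_fun_coord eb).
rewrite expr0n mul0r addr0 invr1 mul1r mulrDl; congr (_ + _).
rewrite big_map mulr_suml; apply: eq_bigr => i _.
by rewrite liftK (sbZr hb) (snapshot_spectral eb) (spectral_fun_coord eb) [RHS]mulrA.
Qed.

Lemma rb_space_mem : W f.
Proof.
have := rb_space_rational 1 (fun=> 0); congr W; rewrite -[RHS](spectral_fun1 eb Vf).
apply: eq_bigr => k _; congr ((_ * _) *: _).
by rewrite big1 ?addr0// => i _; rewrite mul0r.
Qed.

Let Vpos : posdef_on Vh a := spectral_dual_posdef eb.
Let Vposb : posdef_on Vh b. Proof. by move=> v _; exact: ip0_on1_gt0. Qed.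

Lemma rb_eigenbasis_exists : exists n (psi : 'I_n -> V1) (mu : 'I_n -> R), eigenbasis W a b psi mu.
Proof.
by apply: (eigenbasis_exists ha hb); exact: posdef_on_sub rb_space_sub _.
Qed.

Variable c : R.
Hypothesis c0 : 0 < c.
Hypothesis emb_le : forall v, norm0_on1 v <= c * `|v|.

(** This is the embedding bound at the eigenvector [phi k], whose two norms are 1 and [lam k]. *)
Let invx_le k : (x k)^-1 <= c ^+ 2.
Proof.
have [_ on l0 eig] := eb.
have n0 : norm0_on1 (phi k) = 1.
  by apply/eqP; rewrite -sqrp_eq1 ?normr_ge0// -ip0_on1E on eqxx.
have n1 : `|phi k| ^+ 2 = x k.
  by rewrite -ip1E eig ?on ?eqxx ?mulr1//; exact: eigenbasis_mem eb.
rewrite -[leLHS]mul1r ler_pdivrMr// -n1 -exprMn -[leLHS](expr1n _ 2) -n0.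
by rewrite ler_sqr ?nnegrE ?normr_ge0 ?mulr_ge0 ?normr_ge0 ?(ltW c0)// emb_le.
Qed.

Let norm0_spectral v : Vh v -> norm0_on1 v ^+ 2 = \sum_k y k v ^+ 2.
Proof. by move=> Vv; rewrite -ip0_on1E (ip0_spectral eb)//; apply: eq_bigr => k _; rewrite expr2. Qed.

Let norm1_spectral v : Vh v -> `|v| ^+ 2 = \sum_k x k * y k v ^+ 2.
Proof. by move=> Vv; rewrite -ip1E (ip1_spectral eb)//; apply: eq_bigr => k _; rewrite expr2. Qed.

Let dual_le v : Vh v -> a v v <= c ^+ 2 * norm0_on1 v ^+ 2.
Proof.
move=> Vv; rewrite norm0_spectral// mulr_sumr; apply: ler_sum => k _.
by rewrite expr2 ler_wpM2r ?invx_le// -expr2 sqr_ge0.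
Qed.

Variables (n : nat) (psi : 'I_n -> V1) (mu : 'I_n -> R).
Hypothesis ebW : eigenbasis W a b psi mu.

Let chi k := lam k *: phi k.
Let ebU : eigenbasis Vh a b chi lam := dual_eigenbasis eb.
Let err tau := resolvent a chi lam tau f - resolvent a psi mu tau f.

(** Any rational function available in the reduced space may compete. The weight [(x k)^-1 + tau] is
    the symbol of the energy form [a + tau * b]. *)
Let err_le_rational tau (rho sig : R -> R) : 0 < tau ->
  W (vec rho f) -> (forall z, 0 < z -> (1 + tau * z)^-1 - rho z = sig z) ->
  a (err tau) f <= \sum_k ((x k)^-1 + tau) * sig (x k) ^+ 2 * y k f ^+ 2.
Proof.
move=> tau0 Wr E; rewrite (err_energy ha hb ebW ebU rb_space_sub f tau0).
have M := err_energy_min ha hb Vpos Vposb ebW ebU rb_space_sub f tau0 Wr.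
apply: le_trans M _.
rewrite (resolvent_spectral eb f tau0).
have -> : spectral_fun phi lam (fun x => (1 + tau * x)^-1) f - vec rho f = vec sig f.
  rewrite /vec /spectral_fun -sumrB; apply: eq_bigr => k _.
  by rewrite -scalerBl -mulrBl E// x0.
rewrite (ip0_spectral eb _ (spectral_fun_mem eb _ _)) mulr_sumr -big_split/=.
rewrite le_eqVlt; apply/orP; left; apply/eqP; apply: eq_bigr => k _.
by rewrite (spectral_fun_coord eb) /y /x; ring.
Qed.

Variable E : R.
Hypothesis E0 : 0 <= E.
Hypothesis blaschke_le : forall k, blaschke s (lam k ^+ 2) ^+ 2 <= E ^+ 2.

Let cand1 tau : 0 < tau ->
  a (err tau) f <= \sum_k ((x k)^-1 + tau) * (E / (1 + tau * x k)) ^+ 2 * y k f ^+ 2.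
Proof.
move=> tau0; have [d dE] := blaschke_interpolation tau0 us spos.
set B' := blaschke s tau^-1 in dE.
pose rho z := 0 + \sum_(w <- s) d w / (1 + w * z).
pose sig z := blaschke s z * B' / (1 + tau * z).
have E1 z : 0 < z -> (1 + tau * z)^-1 - rho z = sig z.
  move=> z0; rewrite /rho add0r -dE// /sig -[X in X - _]mul1r -mulrBl.
  by rewrite opprB addrC subrK.
apply: le_trans (err_le_rational tau0 (rb_space_rational 0 d) E1) _.
apply: ler_sum => k _; rewrite ler_wpM2r ?sqr_ge0// ler_wpM2l//.
  by rewrite addr_ge0 ?invr_ge0 ?ltW.
rewrite /sig !expr_div_n ler_wpM2r ?invr_ge0 ?sqr_ge0// exprMn.
(* The point [tau^-1] may lie outside the spectrum, so [B'] is only bounded by 1 in absolute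
   value. *)
rewrite -[leRHS]mulr1 ler_pM ?sqr_ge0 ?blaschke_le// blaschke_sqr_le1// invr_gt0//.
Qed.

(** The added term [Theta(L) Theta(1/tau) f] multiplies the symbol of the error of the previous
    competitor by [- tau * x], a gain for small [tau]. *)
Let cand2 tau : 0 < tau ->
  a (err tau) f <= \sum_k ((x k)^-1 + tau) * (tau * x k * E / (1 + tau * x k)) ^+ 2 * y k f ^+ 2.
Proof.
move=> tau0; have [d dE] := blaschke_interpolation tau0 us spos.
have [e0 [e eE]] := blaschke_partial_fractions us spos.
set B' := blaschke s tau^-1 in dE.
pose rho z := B' * e0 + \sum_(w <- s) (d w + B' * e w) / (1 + w * z).
pose sig z := - (tau * z * (blaschke s z * B') / (1 + tau * z)).
have E1 z : 0 < z -> (1 + tau * z)^-1 - rho z = sig z.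
  move=> z0; have -> : rho z = (1 - blaschke s z * B') / (1 + tau * z) + B' * blaschke s z.
    rewrite dE// eE// /rho mulrDr addrCA; congr (_ + _).
    rewrite mulr_sumr -big_split/=; apply: eq_bigr => w _.
    by rewrite mulrDl mulrA.
  have q : 1 + tau * z != 0 by rewrite gt_eqF// addr_gt0// mulr_gt0.
  by rewrite /sig; field.
apply: le_trans (err_le_rational tau0 (rb_space_rational _ _) E1) _.
apply: ler_sum => k _; rewrite ler_wpM2r ?sqr_ge0// ler_wpM2l//.
  by rewrite addr_ge0 ?invr_ge0 ?ltW.
rewrite /sig sqrrN !expr_div_n ler_wpM2r ?invr_ge0 ?sqr_ge0// !(exprMn _ (tau * x k)).
rewrite ler_wpM2l ?sqr_ge0// exprMn.
rewrite -[leRHS]mulr1 ler_pM ?sqr_ge0 ?blaschke_le// blaschke_sqr_le1// invr_gt0//.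
Qed.

Let den tau k : 0 < tau -> 0 < 1 + tau * x k.
Proof. by move=> h; rewrite addr_gt0// mulr_gt0. Qed.

(** This bound, from [cand1], is used for [tau >= 1]. The two after it, from [cand2], are used for
    [tau <= 1]: one is linear in [tau], the other quadratic at the price of the stronger norm of
    [f]. *)
Lemma rb_err_le_const tau : 0 < tau -> a (err tau) f <= E ^+ 2 * c ^+ 2 * norm0_on1 f ^+ 2.
Proof.
move=> tau0; apply: le_trans (cand1 tau0) _; rewrite norm0_spectral// mulr_sumr.
apply: ler_sum => k _; rewrite ler_wpM2r ?sqr_ge0//.
have q := den k tau0.
have -> : ((x k)^-1 + tau) * (E / (1 + tau * x k)) ^+ 2 = E ^+ 2 * ((x k)^-1 * (1 + tau * x k)^-1).
  by field; rewrite !gt_eqF// ?x0.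
rewrite ler_wpM2l ?sqr_ge0// -[leRHS]mulr1 ler_pM ?invr_ge0 ?(ltW q) ?(ltW (x0 k)) ?invx_le//.
by rewrite invf_le1// lerDl mulr_ge0 ?(ltW tau0) ?(ltW (x0 k)).
Qed.

Lemma rb_err_le_lin tau : 0 < tau -> a (err tau) f <= E ^+ 2 * tau * norm0_on1 f ^+ 2.
Proof.
move=> tau0; apply: le_trans (cand2 tau0) _; rewrite norm0_spectral// mulr_sumr.
apply: ler_sum => k _; rewrite ler_wpM2r ?sqr_ge0//.
have q := den k tau0.
have -> : ((x k)^-1 + tau) * (tau * x k * E / (1 + tau * x k)) ^+ 2 =
    E ^+ 2 * tau * (tau * x k / (1 + tau * x k)).
  by field; rewrite !gt_eqF// ?x0.
rewrite -[leRHS]mulr1 ler_wpM2l ?mulr_ge0 ?sqr_ge0 ?(ltW tau0) ?(ltW (x0 k))//.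
by rewrite ler_pdivrMr// mul1r lerDr.
Qed.

Lemma rb_err_le_sqr tau : 0 < tau -> a (err tau) f <= E ^+ 2 * tau ^+ 2 * `|f| ^+ 2.
Proof.
move=> tau0; apply: le_trans (cand2 tau0) _; rewrite norm1_spectral// mulr_sumr.
apply: ler_sum => k _; rewrite [leRHS]mulrA ler_wpM2r ?sqr_ge0//.
have q := den k tau0.
have -> : ((x k)^-1 + tau) * (tau * x k * E / (1 + tau * x k)) ^+ 2 =
    E ^+ 2 * tau ^+ 2 * x k * (1 + tau * x k)^-1.
  by field; rewrite !gt_eqF// ?x0.
rewrite -[leRHS]mulr1 ler_wpM2l ?(mulr_ge0 (mulr_ge0 (sqr_ge0 E) (sqr_ge0 tau)) (ltW (x0 k)))//.
by rewrite invf_le1// lerDl mulr_ge0 ?(ltW tau0) ?(ltW (x0 k)).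
Qed.

Let err_mem tau : Vh (err tau).
Proof.
have [VE _ _ _] := eb; rewrite VE; apply: lin_spanB; rewrite -VE.
  exact: resolvent_mem ebU.
by apply: rb_space_sub; exact: resolvent_mem ebW.
Qed.

(** Cauchy-Schwarz for the dual inner product, where the squared dual norm of the error is at most
    its energy, that is, [a (err tau) f]. *)
Lemma rb_err_pairing_le tau z K : 0 < tau -> Vh z -> 0 <= K ->
  a (err tau) f <= K ^+ 2 -> a (err tau) z <= K * c * norm0_on1 z.
Proof.
move=> tau0 Vz K0 HK; apply: le_trans (ler_norm _) _.
have N0 : 0 <= norm0_on1 z by exact: normr_ge0.
rewrite -ler_sqr ?nnegrE ?mulr_ge0 ?(ltW c0)// real_normK ?num_real//.
apply: le_trans (spectral_dual_cauchy_schwarz _ _ _ _) _.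
rewrite -mulrA exprMn ler_pM ?(spectral_dual_ge0)//; last first.
  by rewrite exprMn dual_le.
apply: le_trans HK; rewrite (err_energy ha hb ebW ebU rb_space_sub f tau0).
exact: (energy_ge0 ha hb Vpos Vposb (ltW tau0) (err_mem tau)).2.
Qed.

Variable th : R.
Hypothesis th0 : 0 < th.

Lemma rb_interp_form_diff_le : th < 1 ->
  interp_form a psi mu th f f - interp_form a chi lam th f f <=
  E ^+ 2 * ((1 / (1 - th) + c ^+ 2 / th) / power_mass th) * norm0_on1 f ^+ 2.
Proof.
move=> th1; have hth : 0 < th < 1 by rewrite th0.
have N0 : 0 <= norm0_on1 f by exact: normr_ge0.
have := interp_form_diff_le ha ebW ebU rb_space_sub rb_space_mem hth th1
  (mulr_ge0 (sqr_ge0 E) (sqr_ge0 (norm0_on1 f)))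
  (mulr_ge0 (mulr_ge0 (sqr_ge0 E) (sqr_ge0 c)) (sqr_ge0 (norm0_on1 f))).
move=> /(_ f) H; apply: le_trans (H _ _) _.
- by move=> tau /andP[tau0 _]; rewrite powRr1 ?(ltW tau0)// [leRHS]mulrAC rb_err_le_lin.
- by move=> tau tau1; rewrite rb_err_le_const// (lt_le_trans _ tau1).
- by rewrite le_eqVlt; apply/orP; left; apply/eqP; ring.
Qed.

(** The linear bound, once its square root is taken, leaves the exponent [p = 2^-1], which must
    exceed [th]; with [th = 1 - s] this is the condition [1 / 2 < s]. *)
Lemma rb_pairing_diff_le_half z : th < 2^-1 -> Vh z ->
  interp_form a psi mu th f z - interp_form a chi lam th f z <=
  E * ((c / (2^-1 - th) + c ^+ 2 / th) / power_mass th) * norm0_on1 f * norm0_on1 z.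
Proof.
move=> thp Vz; have hth : 0 < th < 1 by rewrite th0; lra.
have N0 : 0 <= norm0_on1 f by exact: normr_ge0.
have Nz : 0 <= norm0_on1 z by exact: normr_ge0.
have K1 : 0 <= E * c * norm0_on1 f * norm0_on1 z by rewrite !mulr_ge0// ltW.
have K2 : 0 <= E * c ^+ 2 * norm0_on1 f * norm0_on1 z by rewrite mulr_ge0// mulr_ge0// mulr_ge0// sqr_ge0.
have := interp_form_diff_le ha ebW ebU rb_space_sub rb_space_mem hth thp K1 K2.
move=> /(_ z) H; apply: le_trans (H _ _) _.
- move=> tau /andP[tau0 _].
  have := @rb_err_pairing_le tau z (E * tau `^ 2^-1 * norm0_on1 f) tau0 Vz.
  have -> : E * tau `^ 2^-1 * norm0_on1 f * c * norm0_on1 z =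
    E * c * norm0_on1 f * norm0_on1 z * tau `^ 2^-1 by ring.
  apply; first by rewrite !mulr_ge0// powR_ge0.
  rewrite !exprMn powR12_sqrt ?(ltW tau0)// sqr_sqrtr ?(ltW tau0)//; exact: rb_err_le_lin.
- move=> tau tau1; have tau0 : 0 < tau by rewrite (lt_le_trans _ tau1).
  have := @rb_err_pairing_le tau z (E * c * norm0_on1 f) tau0 Vz.
  have -> : E * c * norm0_on1 f * c * norm0_on1 z =
    E * c ^+ 2 * norm0_on1 f * norm0_on1 z by ring.
  by apply; [rewrite !mulr_ge0// ltW|rewrite !exprMn; exact: rb_err_le_const].
- by rewrite le_eqVlt; apply/orP; left; apply/eqP; ring.
Qed.

(** The square root of the quadratic bound leaves [p = 1], which exceeds every admissible [th]. For
    [tau >= 1] the weaker norm of [f] is converted by the embedding bound, whence the third power of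
    [c]. *)
Lemma rb_pairing_diff_le_one z : th < 1 -> Vh z ->
  interp_form a psi mu th f z - interp_form a chi lam th f z <=
  E * ((c / (1 - th) + c ^+ 3 / th) / power_mass th) * `|f| * norm0_on1 z.
Proof.
move=> th1 Vz; have hth : 0 < th < 1 by rewrite th0.
have N0 : 0 <= norm0_on1 f by exact: normr_ge0.
have Nz : 0 <= norm0_on1 z by exact: normr_ge0.
have K1 : 0 <= E * c * `|f| * norm0_on1 z by rewrite !mulr_ge0// ltW.
have K2 : 0 <= E * c ^+ 3 * `|f| * norm0_on1 z by rewrite mulr_ge0// mulr_ge0// mulr_ge0// exprn_ge0// ltW.
have := interp_form_diff_le ha ebW ebU rb_space_sub rb_space_mem hth th1 K1 K2.
move=> /(_ z) H; apply: le_trans (H _ _) _.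
- move=> tau /andP[tau0 _]; rewrite powRr1 ?(ltW tau0)//.
  have := @rb_err_pairing_le tau z (E * tau * `|f|) tau0 Vz.
  have -> : E * tau * `|f| * c * norm0_on1 z =
    E * c * `|f| * norm0_on1 z * tau by ring.
  apply; first by rewrite !mulr_ge0// ltW.
  by rewrite !exprMn; exact: rb_err_le_sqr.
- move=> tau tau1; have tau0 : 0 < tau by rewrite (lt_le_trans _ tau1).
  have := @rb_err_pairing_le tau z (E * c * norm0_on1 f) tau0 Vz.
  move=> /(_ _ _)/le_trans; apply.
  + by rewrite !mulr_ge0// ltW.
  + by rewrite !exprMn; exact: rb_err_le_const.
  + have -> : E * c ^+ 3 * `|f| * norm0_on1 z = E * c * (c * `|f|) * c * norm0_on1 z by ring.
    by rewrite !ler_wpM2r ?(ltW c0)// ler_wpM2l ?emb_le// mulr_ge0// ltW.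
- by rewrite le_eqVlt; apply/orP; left; apply/eqP; ring.
Qed.

End ReducedBasis.

(** * Pairings with the two solutions and the final estimates *)

Section Solutions.
Variables (R : realType) (X : interpolation_couple R).
Notation V1 := (space1 X).
Notation b := (@ip0_on1 R X).
Variables (Vh : set V1) (N : nat) (phi : 'I_N -> V1) (lam : 'I_N -> R).
Hypothesis eb : eigenbasis Vh b (ip1 X) phi lam.
Let hb := ip0_on1_sym_bilin X.
Let a := spectral_dual phi lam.

Lemma riesz_mem v : Vh (riesz Vh v).
Proof. by rewrite (riesz_spectral eb); exact: spectral_fun_mem eb _ _. Qed.

Lemma riesz_pairing v z : Vh z -> b (riesz Vh v) z = a v z.
Proof.
move=> Vz; rewrite (riesz_spectral eb) (ip0_spectral eb _ Vz).
by apply: eq_bigr => k _; rewrite (spectral_fun_coord eb) mulrA.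
Qed.

Lemma exact_solution_mem s f : Vh (exact_solution phi lam s f).
Proof. by have [-> _ _ _] := eb; eexists. Qed.

Lemma exact_solution_pairing s f z :
  b (exact_solution phi lam s f) z = interp_form a (fun k => lam k *: phi k) lam (1 - s) f z.
Proof.
have [_ _ l0 _] := eb; rewrite /exact_solution (sb_suml hb); apply: eq_bigr => k _.
rewrite (sbZl hb) /a !(dual_eigenbasis_coord eb).
have l := gt_eqF (l0 k); have -> : (lam k ^+ 2) `^ (1 - s) = lam k ^+ 2 * lam k `^ (- (2 * s)).
  rewrite -powR_mulrn ?(ltW (l0 k))// -powRD ?l ?implybT// -powRrM; congr (_ `^ _); ring.
by field; rewrite l.
Qed.

(** Pairing in [space0] with a Riesz image is the dual pairing, so both solutions become
    interpolation forms of the same order and the resolvent estimates apply to their difference. *)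
Lemma rb_solution_pairing W s f :
  (exists n (psi : 'I_n -> V1) (mu : 'I_n -> R), eigenbasis W a b psi mu) ->
  exists n (psi : 'I_n -> V1) (mu : 'I_n -> R), eigenbasis W a b psi mu /\
    forall z, Vh z -> b (rb_solution Vh W s f - exact_solution phi lam s f) z =
      interp_form a psi mu (1 - s) f z -
      interp_form a (fun k => lam k *: phi k) lam (1 - s) f z.
Proof.
move=> ebex; have ha : sym_bilin a := spectral_dual_sym_bilin phi lam.
have [n [psi [mu [ebW H]]]] := interp_op_formE ha ebex (1 - s) f.
exists n, psi, mu; split=> // z Vz.
by rewrite (sbBl hb) exact_solution_pairing /rb_solution (dual_ip_spectral eb) riesz_pairing// H.
Qed.

End Solutions.

Theorem theorem4p3 (R : realType) (X : interpolation_couple R) (s : R)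
    (hs : 0 < s < 1) :
  (exists C : R, 0 < C /\
    forall (Vh : set (space1 X)) (N : nat)
      (phi : 'I_N -> space1 X) (lam : 'I_N -> R)
      (r : nat) (f : space1 X) (lamL lamU : R) (t : 'I_r.+1 -> R),
    eigenbasis Vh (@ip0_on1 R X) (ip1 X) phi lam ->
    (0 < r)%N ->
    Vh f ->
    0 < lamL ^+ 2 < lamU ^+ 2 ->
    (forall k, lamL ^+ 2 <= lam k ^+ 2 <= lamU ^+ 2) ->
    zolotarev_snapshots lamL lamU t ->
    let Vr := rb_space Vh f t in
    let delta := lamL ^+ 2 / lamU ^+ 2 in
    let Cstar := zolotarev_rate delta in
    (0 <= neg_norm Vh Vr s f ^+ 2 - neg_norm Vh Vh s f ^+ 2
       <= C * expR (- (2 * Cstar * r%:R)) * norm0_on1 f ^+ 2) /\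
    norm0_on1 (rb_solution Vh Vr s f - exact_solution phi lam s f)
      <= C * expR (- (Cstar * r%:R)) *
         (if 1 / 2 < s then norm0_on1 f else `|f|)) /\
  (exists g : R -> R,
    (forall lamL lamU : R, 0 < lamL ^+ 2 < lamU ^+ 2 ->
       zolotarev_rate (lamL ^+ 2 / lamU ^+ 2) = g (lamU ^+ 2 / lamL ^+ 2)) /\
    g =O_ (pinfty_nbhs R) (fun kappa : R => (ln kappa)^-1)).
Proof.
split; last exact: zolotarev_rate_bigO.
have [c c0 Hc] := emb_bounded X.
have hth : 0 < 1 - s < 1 by lra.
have [th0 th1] := andP hth.
have m0 := power_mass_gt0 hth.
set mass := power_mass (1 - s) in m0 *.
have q1 : 0 < 1 - (1 - s) by lra.
(* The factors [expR 2] and [expR 1] absorb the summand 2 in the exponent of the Zolotarev bound,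
   which the second estimate halves. *)
pose A1 := expR 2 * ((1 / (1 - (1 - s)) + c ^+ 2 / (1 - s)) / mass).
pose A2 := expR 1 * (if 1 / 2 < s then (c / (2^-1 - (1 - s)) + c ^+ 2 / (1 - s)) / mass
  else (c / (1 - (1 - s)) + c ^+ 3 / (1 - s)) / mass).
have A10 : 0 < A1.
  by rewrite mulr_gt0 ?expR_gt0// divr_gt0// addr_gt0 ?divr_gt0// exprn_gt0.
have A20 : 0 < A2.
  rewrite mulr_gt0 ?expR_gt0//; case: ifPn => hs2.
    by rewrite divr_gt0// addr_gt0 ?divr_gt0 ?exprn_gt0//; lra.
  by rewrite divr_gt0// addr_gt0 ?divr_gt0 ?exprn_gt0.
exists (A1 + A2); split; first exact: addr_gt0.
move=> Vh N phi lam r f lamL lamU t eb r0 Vf LU lamb zol Vr delta Cstar.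
have [t0 tmono _] := zol.
have ha : sym_bilin (spectral_dual phi lam) := spectral_dual_sym_bilin phi lam.
have hb := ip0_on1_sym_bilin X.
pose E := expR (1 - Cstar * r%:R).
have E0 : 0 <= E by exact: expR_ge0.
have E2 : E ^+ 2 = expR (2 - 2 * Cstar * r%:R).
  by rewrite /E -expRM_natl; congr expR; ring.
have blE k : blaschke [seq t (lift ord0 i) ^+ 2 | i <- index_enum 'I_r] (lam k ^+ 2) ^+ 2 <= E ^+ 2.
  by rewrite E2; exact: zolotarev_blaschke_le zol (lamb k).
have Vpos := spectral_dual_posdef eb.
have Vposb : posdef_on Vh (@ip0_on1 R X) by move=> v _; exact: ip0_on1_gt0.
have ebex := rb_eigenbasis_exists eb t f.
have WV : Vr `<=` Vh := @rb_space_sub _ _ _ _ _ _ eb _ t f.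
have Wf := rb_space_mem eb t0 Vf.
have ebU := dual_eigenbasis eb.
split.
  have [n [psi [mu [ebW ->]]]] : exists n (psi : 'I_n -> space1 X) (mu : 'I_n -> R),
      eigenbasis Vr (spectral_dual phi lam) (@ip0_on1 R X) psi mu /\
      neg_norm Vh Vr s f ^+ 2 = interp_form (spectral_dual phi lam) psi mu (1 - s) f f.
    by rewrite /neg_norm (dual_ip_spectral eb); exact: interp_norm_sqrE.
  have -> : neg_norm Vh Vh s f ^+ 2 = interp_form (spectral_dual phi lam)
      (fun k => lam k *: phi k) lam (1 - s) f f.
    rewrite /neg_norm (dual_ip_spectral eb).
    have ebVex : exists n (psi : 'I_n -> space1 X) (mu : 'I_n -> R),
        eigenbasis Vh (spectral_dual phi lam) (@ip0_on1 R X) psi mu.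
      by exists N, (fun k => lam k *: phi k), lam.
    have [m [chi [nu [ebV ->]]]] := interp_norm_sqrE ha ebVex (1 - s) f.
    (* Monotonicity applied in both directions with both subspaces equal to [Vh] identifies the
       value of the chosen eigenbasis with that of the explicit one. *)
    have VV : Vh `<=` Vh by [].
    have le12 := interp_form_subspace_le ha hb Vpos Vposb VV ebU ebV hth Vf.
    have le21 := interp_form_subspace_le ha hb Vpos Vposb VV ebV ebU hth Vf.
    by apply/eqP; rewrite eq_le le12 le21.
  apply/andP; split.
    by rewrite subr_ge0; exact: (interp_form_subspace_le ha hb Vpos Vposb WV ebW ebU hth Wf).
  apply: le_trans (rb_interp_form_diff_le eb t0 tmono Vf c0 Hc ebW E0 blE th0 th1) _.
  rewrite ler_wpM2r ?sqr_ge0// E2 expRD -/mass mulrAC -/A1.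
  by rewrite ler_wpM2r ?expR_ge0// lerDl ltW.
have [n [psi [mu [ebW H]]]] := rb_solution_pairing eb s f ebex.
set z := rb_solution _ _ _ _ - _ in H *.
have Vz : Vh z.
  have [VE _ _ _] := eb; rewrite VE; apply: lin_spanB; rewrite -VE.
    exact: riesz_mem eb _.
  exact: exact_solution_mem eb _ _.
have := H z Vz; rewrite ip0_on1E => zE.
set n1 := (if 1 / 2 < s then norm0_on1 f else `|f|).
have n10 : 0 <= n1 by rewrite /n1; case: ifP => _; exact: normr_ge0.
have Nz : 0 <= norm0_on1 z by exact: normr_ge0.
(* The error [z] of the solution is tested against itself; one factor [norm0_on1 z] is divided out
   afterwards. *)
have zle : norm0_on1 z ^+ 2 <= A2 * expR (- (Cstar * r%:R)) * n1 * norm0_on1 z.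
  have EE : E = expR 1 * expR (- (Cstar * r%:R)) by rewrite /E expRD.
  rewrite zE /A2 /n1; case: ifPn => hs2.
    have th2 : 1 - s < 2^-1 by lra.
    apply: le_trans (rb_pairing_diff_le_half eb t0 tmono Vf c0 Hc ebW E0 blE th0 th2 Vz) _.
    by rewrite EE le_eqVlt; apply/orP; left; apply/eqP; rewrite -/mass; ring.
  apply: le_trans (rb_pairing_diff_le_one eb t0 tmono Vf c0 Hc ebW E0 blE th0 th1 Vz) _.
  by rewrite EE le_eqVlt; apply/orP; left; apply/eqP; rewrite -/mass; ring.
have zle' : norm0_on1 z <= A2 * expR (- (Cstar * r%:R)) * n1.
  have [->|zn] := eqVneq (norm0_on1 z) 0.
    by rewrite mulr_ge0// mulr_ge0 ?expR_ge0// ltW.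
  by move: zle; rewrite expr2 ler_pM2r// lt_neqAle eq_sym zn.
apply: le_trans zle' _; rewrite ler_wpM2r// ler_wpM2r ?expR_ge0//.
by rewrite lerDr ltW.
Qed.
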